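(* Let $U$ and $W$ be two $\mathcal L(R_q,1)$-modules (objects of the category $\mathrm{SW}(V_{(m|n)})$) with equivariant representations $\rho_U$ and $\rho_W$. Then an equivariant representation $\mathcal L(R_q,1)\to\mathrm{End}(U\otimes W)$ is given by the rule $$a\mapsto\rho_{U\otimes W}(\Delta(a)),\qquad \forall\,a\in\mathcal L(R_q,1),$$ where $\Delta$ is the braided coproduct of $\mathcal L(R_q,1)$ and, for $a,b\in\mathcal L(R_q,1)$, $u\in U$, $w\in W$, $$\rho_{U\otimes W}(a\otimes b)\triangleright(u\otimes w)=(\rho_U(a)\triangleright u')\otimes(\rho_W(b')\triangleright w),\qquad u'\otimes b':=\mathsf R(b\otimes u).$$
   Context: $V$ is a finite dimensional space over $\mathbb K$, $N=\dim V$, basis $\{x_i\}$, summation convention. $R$ is a skew-invertible Hecke symmetry of bi-rank $(m|n)$ on $V$: an invertible operator on $V^{\otimes2}$, $R(x_i\otimes x_j)=x_k\otimes x_lR^{kl}_{\;ij}$, with $R_{12}R_{23}R_{12}=R_{23}R_{12}R_{23}$, $(R-qI)(R+q^{-1}I)=0$, $q\in\mathbb K^\times$ generic ($q=1$ or not a root of unity), such that there is $\Psi$ with $R^{ia}_{\;jb}\Psi^{bl}_{\;ak}=\delta^i_k\delta^l_j=\Psi^{ia}_{\;jb}R^{bl}_{\;ak}$. The bi-rank $(m|n)$ is the pair of degrees of numerator and denominator, in lowest terms, of the (rational) series $\sum_k t^k\dim\Lambda^k_-(V)$, $\Lambda_-(V)=T(V)/\langle\mathrm{Im}(q^{-1}I+R)\rangle$.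 Put $B^j_{\;i}=\Psi^{kj}_{\;ki}$, $C^j_{\;i}=\Psi^{jk}_{\;ik}$. Extended braiding: $V^*$ has basis $\{x^i\}$ dual to $\{x_i\}$, and $R$ is extended to $(V\oplus V^* )^{\otimes2}$ by $R(x_i\otimes x^j)=x^k\otimes x_l(R^{-1})^{lj}_{\;ki}$, $R(x^j\otimes x_i)=x_k\otimes x^l\Psi^{kj}_{\;li}$, $R(x^i\otimes x^j)=x^k\otimes x^lR^{ji}_{\;lk}$. Category $\mathrm{SW}(V_{(m|n)})$: objects are direct sums of $V_\lambda\otimes V_\mu^*$ and $V^*_\mu\otimes V_\lambda$ (including $V$, $V^*$ and the unit object $\mathbb K$), where for a partition $\lambda$ of $k$, $V_\lambda\subset V^{\otimes k}$ is the image of a primitive idempotent of type $\lambda$ of the Hecke algebra $H_k(q)$ acting by $\sigma_i\mapsto R_{i,i+1}$, and $V^*_\mu\subset V^{*\otimes k}$ is defined analogously; tensor products of objects are considered via their realization in tensor products of $V$ and $V^*$. The braidings $\mathsf R=R_{X,Y}:X\otimes Y\to Y\otimes X$ are induced by the extended $R$, moving tensor factors past each other one by one ($\mathbb K$ being braided trivially). Morphisms are generated, under linear combinations, compositions, tensor products and direct sums, by identity maps, the extended braidings, the pairings $\langle x_i,x^j\rangle_r=\delta_i^j$ on $V\otimes V^*$ and $\langle x^i,x_j\rangle_l=B^i_{\;j}$ on $V^*\otimes V$, and the maps $\pi_r:\mathbb K\to V^*\otimes V$, $1\mapsto\sum_ix^i\otimes x_i$, $\pi_l:\mathbb K\to V\otimes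 V^*$, $1\mapsto\sum_i x_i\otimes {}^i\!x$ with ${}^i\!x=q^{2(m-n)}C^i_{\;j}x^j$. Algebra: let $\bar R_{i_1i_2}^{\;\,j_1j_2}=R^{j_1j_2}_{\;\,i_1i_2}$ (lower indices number rows), $L=\|l_i^j\|$ (row $i$, column $j$), $L_1=L\otimes I$. $\mathcal L(R_q,1)$ is the unital associative algebra (unit $e_{\mathcal L}$) generated by $l_i^j$ with relations $\bar R_{12}L_1\bar R_{12}L_1-L_1\bar R_{12}L_1\bar R_{12}=\bar R_{12}L_1-L_1\bar R_{12}$. Identifying $l_i^j=x_i\otimes x^j\in V\otimes V^*\cong\mathrm{End}(V)$, the categorical braidings extend multiplicatively (trivially on the unit) to braidings $\mathsf R$ between $\mathcal L(R_q,1)$ and objects, and of $\mathcal L(R_q,1)$ with itself; the latter is denoted $R_{\mathrm{End}}$. $\mathbf L(R_q)=\mathcal L(R_q,1)\otimes\mathcal L(R_q,1)$ has the product $(a_1\otimes b_1)\star(a_2\otimes b_2)=a_1a_2'\otimes b_1'b_2$, $a_2'\otimes b_1'=R_{\mathrm{End}}(b_1\otimes a_2)$. The coproduct $\Delta:\mathcal L(R_q,1)\to\mathbf L(R_q)$ is defined by $\Delta(e_{\mathcal L})=e_{\mathcal L}\otimes e_{\mathcal L}$, $\Delta(l_i^j)=l_i^j\otimes e_{\mathcal L}+e_{\mathcal L}\otimes l_i^j-(q-q^{-1})\sum_kl_i^k\otimes l_k^j$, $\Delta(ab)=\Delta(a)\star\Delta(b)$. A representation $\rho_U:\mathcal L(R_q,1)\to\mathrm{End}(U)$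 in an object $U$ is equivariant if the map $\mathrm{End}(V)\to\mathrm{End}(U)$, $l_i^j\mapsto\rho_U(l_i^j)$, is a morphism of the category (equivalently, the action map $V\otimes V^*\otimes U\to U$ is a morphism). *)

(* Defs.v *)
From HB Require Import structures.
From mathcomp Require Import all_boot all_order all_algebra finmap.
From mathcomp.multinomials Require Import monalg.
From mathcomp Require Import boolp.

Set Implicit Arguments.
Unset Strict Implicit.
Unset Printing Implicit Defensive.

Import GRing.Theory.

Local Open Scope ring_scope.
Local Open Scope quotient_scope.

Section LinearSpan.
Variables (K : fieldType) (V : lmodType K) (S : V -> Prop).

Definition lspan (v : V) : Prop :=
  exists s : seq (K * V),
    (forall p, p \in s -> S p.2) /\ v = \sum_(p <- s) p.1 *: p.2.

Lemma lspan_gen v : S v -> lspan v.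
Proof.
move=> Sv; exists [:: (1, v)]; split; last by rewrite big_seq1 scale1r.
by move=> p; rewrite inE => /eqP ->.
Qed.

Lemma lspan0 : lspan 0.
Proof. by exists [::]; split => //; rewrite big_nil. Qed.

Lemma lspanD u v : lspan u -> lspan v -> lspan (u + v).
Proof.
move=> [s [sS ->]] [t [tS ->]]; exists (s ++ t); split; last by rewrite big_cat.
by move=> p; rewrite mem_cat => /orP[/sS|/tS].
Qed.

Lemma lspanZ c v : lspan v -> lspan (c *: v).
Proof.
move=> [s [sS ->]]; exists [seq (c * p.1, p.2) | p <- s]; split.
  by move=> p /mapP[p' /sS ? ->].
by rewrite big_map scaler_sumr; apply: eq_bigr => p _; rewrite scalerA.
Qed.

Lemma lspanN v : lspan v -> lspan (- v).
Proof. by rewrite -scaleN1r; apply: lspanZ. Qed.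

Lemma lspanB u v : lspan u -> lspan v -> lspan (u - v).
Proof. by move=> ? /lspanN; apply: lspanD. Qed.

Lemma lspan_kernel (W : lmodType K) (f : {linear V -> W}) :
  (forall v, S v -> f v = 0) -> forall v, lspan v -> f v = 0.
Proof.
move=> fS v [s [sS ->]]; rewrite linear_sum big_seq big1 // => p /sS /fS fp.
by rewrite linearZ /= fp scaler0.
Qed.

Definition qmod_eq (u v : V) : bool := `[< lspan (u - v) >].

Lemma qmod_eq_refl : reflexive qmod_eq.
Proof. by move=> x; apply/asboolP; rewrite subrr; apply: lspan0. Qed.

Lemma qmod_eq_sym : symmetric qmod_eq.
Proof.
by move=> x y; apply/idP/idP => /asboolP /lspanN xy; apply/asboolP;
  rewrite opprB in xy.
Qed.

Lemma qmod_eq_trans : transitive qmod_eq.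
Proof.
move=> y x z /asboolP xy /asboolP yz; apply/asboolP.
by have := lspanD xy yz; rewrite addrA subrK.
Qed.

Canonical qmod_equiv := EquivRel qmod_eq qmod_eq_refl qmod_eq_sym qmod_eq_trans.

(* The quotient of V by the linear span of S; classical logic makes membership
   in the span a boolean. *)
Definition qmod := {eq_quot qmod_equiv}.

HB.instance Definition _ := Choice.on qmod.
HB.instance Definition _ := EqQuotient.on qmod.

Definition qpi (v : V) : qmod := \pi_qmod v.
Definition qrepr (x : qmod) : V := repr x.

Lemma qreprK x : qpi (qrepr x) = x.
Proof. exact: reprK. Qed.

Lemma qpiP u v : qpi u = qpi v <-> lspan (u - v).
Proof.
split=> [/eqquotP|uv]; first by move/asboolP.
by apply/eqquotP/asboolP.
Qed.

Definition qzero := qpi 0.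
Definition qopp x := qpi (- qrepr x).
Definition qadd x y := qpi (qrepr x + qrepr y).
Definition qscale (c : K) x := qpi (c *: qrepr x).

Lemma lspan_repr v : lspan (qrepr (qpi v) - v).
Proof. by apply/qpiP; rewrite qreprK. Qed.

Lemma qaddE u v : qadd (qpi u) (qpi v) = qpi (u + v).
Proof.
apply/qpiP; rewrite opprD addrACA.
by apply: lspanD; apply: lspan_repr.
Qed.

Lemma qoppE u : qopp (qpi u) = qpi (- u).
Proof. by apply/qpiP; rewrite -opprD; apply/lspanN/lspan_repr. Qed.

Lemma qscaleE c u : qscale c (qpi u) = qpi (c *: u).
Proof. by apply/qpiP; rewrite -scalerBr; apply/lspanZ/lspan_repr. Qed.

Lemma qaddA : associative qadd.
Proof.
by move=> x y z; rewrite -[x]qreprK -[y]qreprK -[z]qreprK !qaddE addrA.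
Qed.

Lemma qaddC : commutative qadd.
Proof. by move=> x y; rewrite /qadd addrC. Qed.

Lemma qadd0 : left_id qzero qadd.
Proof. by move=> x; rewrite -[x]qreprK qaddE add0r. Qed.

Lemma qaddN : left_inverse qzero qopp qadd.
Proof. by move=> x; rewrite -[x]qreprK qoppE qaddE addNr. Qed.

HB.instance Definition _ := GRing.isZmodule.Build qmod qaddA qaddC qadd0 qaddN.

Lemma qpiD : {morph qpi : u v / u + v}.
Proof. by move=> u v; rewrite -qaddE. Qed.

Lemma qscaleA a b x : qscale a (qscale b x) = qscale (a * b) x.
Proof. by rewrite -[x]qreprK !qscaleE scalerA. Qed.

Lemma qscale1 : left_id 1 qscale.
Proof. by move=> x; rewrite -[x]qreprK qscaleE scale1r. Qed.

Lemma qscaleDr : right_distributive qscale +%R.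
Proof.
by move=> c x y; rewrite -[x]qreprK -[y]qreprK -qpiD !qscaleE scalerDr qpiD.
Qed.

Lemma qscaleDl x : {morph qscale^~ x : a b / a + b}.
Proof. by move=> a b; rewrite -[x]qreprK !qscaleE scalerDl qpiD. Qed.

HB.instance Definition _ :=
  GRing.Zmodule_isLmodule.Build K qmod qscaleA qscale1 qscaleDr qscaleDl.

Lemma qpi_is_linear : linear qpi.
Proof. by move=> c u v; rewrite qpiD -qscaleE. Qed.

HB.instance Definition _ := GRing.isLinear.Build K V qmod _ qpi qpi_is_linear.

Lemma qpi_gen v : S v -> qpi v = 0.
Proof. by move=> Sv; apply/qpiP; rewrite subr0; apply: lspan_gen. Qed.

(* The map induced on the quotient is computed on any representative. *)
Lemma qmod_lift (W : lmodType K) (f : {linear V -> W}) :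
  (forall v, S v -> f v = 0) -> forall v, f (qrepr (qpi v)) = f v.
Proof.
move=> fS v; apply/eqP; rewrite -subr_eq0 -linearB; apply/eqP.
exact: lspan_kernel fS _ (lspan_repr v).
Qed.

End LinearSpan.

Section LinearExtension.
Variables (K : fieldType) (T : choiceType) (W : lmodType K).

Definition linext (f : T -> W) (p : {malg K[T]}) : W :=
  \sum_(w <- msupp p) p@_w *: f w.

Lemma linextEw f (d : {fset T}) p : (msupp p `<=` d)%fset ->
  linext f p = \sum_(w <- d) p@_w *: f w.
Proof.
move=> pd; rewrite /linext (big_fset_incl _ pd) // => w _ wp.
by rewrite mcoeff_outdom // scale0r.
Qed.

Lemma linext_is_linear f : linear (linext f).
Proof.
move=> c p r; pose d := (msupp p `|` msupp r `|` msupp (c *: p + r))%fset.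
rewrite !(@linextEw _ d) ?fsubsetUr //; first last.
- by rewrite /d fsubsetU // fsubsetUl.
- by rewrite /d fsubsetU // fsubsetUr.
rewrite scaler_sumr -big_split; apply: eq_bigr => w _ /=.
by rewrite mcoeffD mcoeffZ scalerDl scalerA.
Qed.

HB.instance Definition _ f :=
  GRing.isLinear.Build K {malg K[T]} W _ (linext f) (linext_is_linear f).

Lemma linextU f w : linext f (mkmalgU w 1) = f w.
Proof. by rewrite /linext msuppU oner_eq0 big_seq_fset1 mcoeffUU scale1r. Qed.

End LinearExtension.

Section TensorProduct.
Variables (K : fieldType) (A B : lmodType K).

Local Notation F := {malg K[(A * B)%type]}.
Local Notation "[ a , b ]" := (mkmalgU (a, b) 1 : F).

Inductive bilin_rel : F -> Prop :=
| Bilin_l c a a' b :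
    bilin_rel ([c *: a + a', b] - (c *: [a, b] + [a', b]))
| Bilin_r c a b b' :
    bilin_rel ([a, c *: b + b'] - (c *: [a, b] + [a, b'])).

Definition tprod := qmod bilin_rel.

HB.instance Definition _ := GRing.Lmodule.on tprod.

Definition ten (a : A) (b : B) : tprod := qpi bilin_rel [a, b].

(* The linear map on the tensor product induced by a bilinear map. *)
Definition tlift (W : lmodType K) (f : A -> B -> W) (t : tprod) : W :=
  linext (fun p : A * B => f p.1 p.2) (qrepr t).

Section Lift.
Variables (W : lmodType K) (f : A -> B -> W).
Hypothesis f_linear_l : forall b, linear (f^~ b).
Hypothesis f_linear_r : forall a, linear (f a).

Let g := linext (fun p : A * B => f p.1 p.2).

Lemma tlift_qpi p : tlift f (qpi bilin_rel p) = g p.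
Proof.
apply: qmod_lift => v [c a a' b|c a b b'];
  rewrite linearB linearP /= !linextU /=; apply/eqP; rewrite subr_eq0;
  apply/eqP; first exact: f_linear_l.
exact: f_linear_r.
Qed.

Lemma tlift_ten a b : tlift f (ten a b) = f a b.
Proof. by rewrite /ten tlift_qpi /g linextU. Qed.

Lemma tlift_is_linear : linear (tlift f).
Proof.
move=> c x y; rewrite -[x]qreprK -[y]qreprK -linearP !tlift_qpi.
exact: linearP.
Qed.

End Lift.

End TensorProduct.

Section QuotientAlgebra.
Variables (K : fieldType) (A : algType K) (rel : A -> Prop).

Definition ideal_gen (v : A) : Prop :=
  exists a x b : A, rel x /\ v = a * x * b.

(* The quotient of A by the two-sided ideal generated by rel. Since it may be
   the zero ring, it is not declared as an algType; compatibility of the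
   product with scalars is given by qalg_scaleAl and qalg_scaleAr. *)
Definition qalg := qmod ideal_gen.

HB.instance Definition _ := GRing.Lmodule.on qalg.

Definition qapi (a : A) : qalg := qpi ideal_gen a.

Definition qone : qalg := qapi 1.
Definition qmul (x y : qalg) : qalg := qapi (qrepr x * qrepr y).

Lemma ideal_mull a v : lspan ideal_gen v -> lspan ideal_gen (a * v).
Proof.
move=> [s [sS ->]]; exists [seq (p.1, a * p.2) | p <- s]; split.
  move=> p /mapP[p' /sS [b [x [c [rx e]]]] ->] /=; exists (a * b), x, c.
  by split; [exact: rx|rewrite e !mulrA].
by rewrite big_map mulr_sumr; apply: eq_bigr => p _; rewrite scalerAr.
Qed.

Lemma ideal_mulr a v : lspan ideal_gen v -> lspan ideal_gen (v * a).
Proof.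
move=> [s [sS ->]]; exists [seq (p.1, p.2 * a) | p <- s]; split.
  move=> p /mapP[p' /sS [b [x [c [rx e]]]] ->] /=; exists b, x, (c * a).
  by split; [exact: rx|rewrite e !mulrA].
by rewrite big_map mulr_suml; apply: eq_bigr => p _; rewrite scalerAl.
Qed.

Lemma qapiK (x : qalg) : qapi (qrepr x) = x.
Proof. exact: qreprK. Qed.

Lemma qapi_is_linear : linear qapi.
Proof. exact: qpi_is_linear. Qed.

HB.instance Definition _ := GRing.isLinear.Build K A qalg _ qapi qapi_is_linear.

Lemma qmulE u v : qmul (qapi u) (qapi v) = qapi (u * v).
Proof.
apply/qpiP; set u' := qrepr _; set v' := qrepr _.
have -> : u' * v' - u * v = u' * (v' - v) + (u' - u) * v.
  by rewrite mulrBr mulrBl addrA subrK.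
by apply: lspanD; [apply/ideal_mull/lspan_repr|apply/ideal_mulr/lspan_repr].
Qed.

Lemma qmulA : associative qmul.
Proof.
by move=> x y z; rewrite -[x]qapiK -[y]qapiK -[z]qapiK !qmulE mulrA.
Qed.

Lemma qmul1l : left_id qone qmul.
Proof. by move=> x; rewrite -[x]qapiK qmulE mul1r. Qed.

Lemma qmul1r : right_id qone qmul.
Proof. by move=> x; rewrite -[x]qapiK qmulE mulr1. Qed.

Lemma qmulDl : left_distributive qmul +%R.
Proof.
move=> x y z; rewrite -[x]qapiK -[y]qapiK -[z]qapiK -linearD /= !qmulE.
by rewrite mulrDl linearD.
Qed.

Lemma qmulDr : right_distributive qmul +%R.
Proof.
move=> x y z; rewrite -[x]qapiK -[y]qapiK -[z]qapiK -linearD /= !qmulE.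
by rewrite mulrDr linearD.
Qed.

HB.instance Definition _ :=
  GRing.Zmodule_isPzRing.Build qalg qmulA qmul1l qmul1r qmulDl qmulDr.

Lemma qapiM u v : qapi (u * v) = qapi u * qapi v.
Proof. by rewrite -qmulE. Qed.

Lemma qapi1 : qapi 1 = 1.
Proof. by []. Qed.

Lemma qapiZ c u : qapi (c *: u) = c *: qapi u.
Proof. exact: linearZ. Qed.

Lemma qalg_scaleAl (c : K) (x y : qalg) : c *: (x * y) = (c *: x) * y.
Proof.
rewrite -[x]qapiK -[y]qapiK -[qapi _ * qapi _]qapiM -[LHS]qapiZ.
by rewrite -[c *: qapi (qrepr x)]qapiZ -[RHS]qapiM scalerAl.
Qed.

Lemma qalg_scaleAr (c : K) (x y : qalg) : c *: (x * y) = x * (c *: y).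
Proof.
rewrite -[x]qapiK -[y]qapiK -[qapi _ * qapi _]qapiM -[LHS]qapiZ.
by rewrite -[c *: qapi (qrepr y)]qapiZ -[RHS]qapiM scalerAr.
Qed.

Lemma qapi_rel x : rel x -> qapi x = 0.
Proof. by move=> rx; apply: qpi_gen; exists 1, x, 1; rewrite mul1r mulr1. Qed.

End QuotientAlgebra.

Definition freealg (K : fieldType) (G : choiceType) := {malg K[{fmonom G}]}.

Section PresentedAlgebra.
Variables (K : fieldType) (G : choiceType).

HB.instance Definition _ := GRing.Lalgebra.on (freealg K G).

Lemma freealg_scaleAr (c : K) (x y : freealg K G) :
  c *: (x * y) = x * (c *: y).
Proof.
suff scal (z : freealg K G) : c *: z = z * (c *: 1).
  by rewrite [LHS]scal [c *: y]scal mulrA.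
apply/malgP => k; rewrite mcoeffZ -[c *: 1]mul_malgC mulr1 mcoeffMr.
have [->|c0] := eqVneq c 0.
  by rewrite mul0r monalgU0 msupp0 big_seq_fset0.
rewrite msuppU (negPf c0) big_seq_fset1 mcoeffUU.
have [kz|kz] := boolP (k \in msupp z); last first.
  rewrite (mcoeff_outdom kz) mulr0 big_seq big1 // => w wz.
  rewrite mulm1; case: eqP => [wk|//].
  by rewrite -wk wz in kz.
rewrite (big_fsetD1 k) //= mulm1 eqxx mulr1n mulrC big_seq big1 ?addr0 //.
by move=> w; rewrite in_fsetD1 => /andP[/negPf wk _]; rewrite mulm1 wk.
Qed.

HB.instance Definition _ :=
  GRing.Lalgebra_isAlgebra.Build K (freealg K G) freealg_scaleAr.

Definition fgen (g : G) : freealg K G := mkmalgU (fmu g) 1.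

Variable rel : freealg K G -> Prop.

(* The unital associative algebra with generators G and relations x = 0 for
   all x such that rel x. *)
Definition presented := qalg rel.

HB.instance Definition _ := GRing.PzRing.on presented.
HB.instance Definition _ := GRing.Lmodule.on presented.

Definition pgen (g : G) : presented := qapi rel (fgen g).

(* The linear map on the presented algebra induced by a map prescribed on the
   words g1 ... gk (products of generators) that is compatible with the
   relations. *)
Definition alift (W : lmodType K) (f : seq G -> W) (a : presented) : W :=
  linext (fun w : {fmonom G} => f w) (qrepr a).

Lemma alift_qapi (W : lmodType K) (f : seq G -> W) :
  (forall a x b : freealg K G, rel x ->
     linext (fun w : {fmonom G} => f w) (a * x * b) = 0) ->
  forall p, alift f (qapi rel p) = linext (fun w : {fmonom G} => f w) p.
Proof.
by move=> f0 p; apply: qmod_lift => v [a [x [b [rx ->]]]]; exact: f0.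
Qed.

End PresentedAlgebra.

(* Objects realized in V, V^* and the unit object by tensor products and direct
   sums. *)
Inductive expr := EUnit | EV | EVd | ETens of expr & expr | ESum of expr & expr.

Section Realization.
Variables (K : fieldType) (N : nat).

Fixpoint basis (X : expr) : finType :=
  match X with
  | EUnit => unit
  | EV | EVd => 'I_N
  | ETens X Y => (basis X * basis Y)%type
  | ESum X Y => (basis X + basis Y)%type
  end.

Definition sp (X : expr) := {ffun basis X -> K^o}.

HB.instance Definition _ X := Vector.on (sp X).

Definition bvec X (x : basis X) : sp X := [ffun y => (y == x)%:R].

Definition tvec X Y (u : sp X) (v : sp Y) : sp (ETens X Y) :=
  [ffun p : basis X * basis Y => u p.1 * v p.2].

Definition lmap X Y (f : basis X -> sp Y) : 'Hom(sp X, sp Y) :=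
  linfun (fun u : sp X => \sum_x (u x : K) *: f x).

Lemma lmapE X Y (f : basis X -> sp Y) (u : sp X) :
  lmap f u = \sum_x (u x : K) *: f x.
Proof.
pose g (u : sp X) : sp Y := \sum_x (u x : K) *: f x.
have g_linear : linear g.
  move=> c a b; rewrite /g scaler_sumr -big_split; apply: eq_bigr => x _ /=.
  by rewrite !ffunE scalerDl scalerA.
pose gM := GRing.isLinear.Build K (sp X) (sp Y) _ g g_linear.
pose gL : {linear sp X -> sp Y} := HB.pack g gM.
exact: (lfunE gL u).
Qed.

Lemma lmap_bvec X Y (f : basis X -> sp Y) x : lmap f (bvec x) = f x.
Proof.
rewrite lmapE (bigD1 x) //= ffunE eqxx scale1r big1 ?addr0 // => y /negPf yx.
by rewrite ffunE yx scale0r.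
Qed.

Definition tmap X X' Y Y' (f : 'Hom(sp X, sp Y)) (g : 'Hom(sp X', sp Y')) :
    'Hom(sp (ETens X X'), sp (ETens Y Y')) :=
  lmap (fun p : basis (ETens X X') => tvec (f (bvec p.1)) (g (bvec p.2))).

Definition assoc X Y Z :
    'Hom(sp (ETens (ETens X Y) Z), sp (ETens X (ETens Y Z))) :=
  lmap (fun p : basis (ETens (ETens X Y) Z) =>
    bvec ((p.1.1, (p.1.2, p.2)) : basis (ETens X (ETens Y Z)))).

Definition assocV X Y Z :
    'Hom(sp (ETens X (ETens Y Z)), sp (ETens (ETens X Y) Z)) :=
  lmap (fun p : basis (ETens X (ETens Y Z)) =>
    bvec (((p.1, p.2.1), p.2.2) : basis (ETens (ETens X Y) Z))).

Definition lunit X : 'Hom(sp (ETens EUnit X), sp X) :=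
  lmap (fun p : basis (ETens EUnit X) => bvec p.2).
Definition lunitV X : 'Hom(sp X, sp (ETens EUnit X)) :=
  lmap (fun x : basis X => bvec ((tt, x) : basis (ETens EUnit X))).
Definition runit X : 'Hom(sp (ETens X EUnit), sp X) :=
  lmap (fun p : basis (ETens X EUnit) => bvec p.1).
Definition runitV X : 'Hom(sp X, sp (ETens X EUnit)) :=
  lmap (fun x : basis X => bvec ((x, tt) : basis (ETens X EUnit))).

Definition inj1 X Y : 'Hom(sp X, sp (ESum X Y)) :=
  lmap (fun x : basis X => bvec (inl x : basis (ESum X Y))).
Definition inj2 X Y : 'Hom(sp Y, sp (ESum X Y)) :=
  lmap (fun y : basis Y => bvec (inr y : basis (ESum X Y))).
Definition prj1 X Y : 'Hom(sp (ESum X Y), sp X) :=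
  lmap (fun p : basis (ESum X Y) => if p is inl x then bvec x else 0).
Definition prj2 X Y : 'Hom(sp (ESum X Y), sp Y) :=
  lmap (fun p : basis (ESum X Y) => if p is inr y then bvec y else 0).

Fixpoint power (Z : expr) (k : nat) : expr :=
  if k is k'.+1 then ETens Z (power Z k') else EUnit.

(* at_pos r k i is the operator r acting on the i-th and (i+1)-st factors of
   the k-th tensor power of Z, counting from 0; it is 0 when i.+1 >= k. *)
Fixpoint at_pos Z (r : 'End(sp (ETens Z Z))) (k i : nat) :
    'End(sp (power Z k)) :=
  match k, i with
  | 0, _ => 0
  | k'.+1, 0 =>
      match k' return 'End(sp (power Z k'.+1)) with
      | 0 => 0
      | k''.+1 =>
          (assoc Z Z (power Z k'') \o tmap r \1
             \o assocV Z Z (power Z k''))%VF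
      end
  | k'.+1, i'.+1 => tmap \1%VF (at_pos r k' i')
  end.

End Realization.

(* T k l i j stands for the coefficient T^{kl}_{ij}. *)
Definition tensor4 (K : fieldType) (N : nat) :=
  'I_N -> 'I_N -> 'I_N -> 'I_N -> K.

Definition generic_parameter (K : fieldType) (q : K) : Prop :=
  q != 0 /\ (q = 1 \/ forall k, (0 < k)%N -> q ^+ k != 1).

Section HeckeSymmetry.
Variables (K : fieldType) (N : nat).

Definition op_of (T : tensor4 K N) : 'End(sp K N (ETens EV EV)) :=
  lmap (fun p : basis N (ETens EV EV) =>
    [ffun p' : basis N (ETens EV EV) => T p'.1 p'.2 p.1 p.2]
      : sp K N (ETens EV EV)).

Definition yang_baxter (R : tensor4 K N) : Prop :=
  let R12 := tmap (op_of R) (\1%VF : 'End(sp K N EV)) in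
  let R23 := (assocV K N EV EV EV \o tmap (\1%VF : 'End(sp K N EV)) (op_of R)
                \o assoc K N EV EV EV)%VF in
  (R12 \o R23 \o R12 = R23 \o R12 \o R23)%VF.

Definition hecke_condition (q : K) (R : tensor4 K N) : Prop :=
  ((op_of R - q *: \1) \o (op_of R + q^-1 *: \1) = 0)%VF.

Definition mutually_inverse (R Rinv : tensor4 K N) : Prop :=
  (op_of R \o op_of Rinv = \1)%VF /\ (op_of Rinv \o op_of R = \1)%VF.

Definition skew_inverse (R Psi : tensor4 K N) : Prop :=
  forall i j k l,
    \sum_a \sum_b R i a j b * Psi b l a k = (i == k)%:R * (l == j)%:R /\
    \sum_a \sum_b Psi i a j b * R b l a k = (i == k)%:R * (l == j)%:R.

(* The dimension of the degree k component of the quadratic algebra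
   T(V) / < Im (q^-1 I + R) >. *)
Definition skew_dim (q : K) (R : tensor4 K N) (k : nat) : nat :=
  (\dim {:sp K N (power EV k)}
   - \dim (\sum_(i < k.-1)
       limg (q^-1 *: \1%VF + at_pos (op_of R) k i)%R)%VS)%N.

(* The power series sum_k (skew_dim q R k) t^k equals num / den in lowest
   terms, with num of degree m and den of degree n. *)
Definition bi_rank (q : K) (R : tensor4 K N) (m n : nat) : Prop :=
  exists num den : {poly rat},
    [/\ coprimep num den, size num = m.+1, size den = n.+1 &
        forall k, \sum_(i < k.+1) den`_i * (skew_dim q R (k - i)%N)%:R
                  = num`_k].

Record hecke_symmetry (q : K) (m n : nat) (R Rinv Psi : tensor4 K N) : Prop :=
  HeckeSymmetry {
    hs_braid : yang_baxter R;
    hs_hecke : hecke_condition q R;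
    hs_inverse : mutually_inverse R Rinv;
    hs_skew : skew_inverse R Psi;
    hs_birank : bi_rank q R m n
  }.

End HeckeSymmetry.

Section HeckeAlgebra.
Variables (K : fieldType) (q : K).

(* The generators of H_k(q) are numbered from 0 to k - 2. *)
Inductive hecke_rel (k : nat) : freealg K 'I_k.-1 -> Prop :=
| Hecke_braid (i j : 'I_k.-1) : j = i.+1 :> nat ->
    hecke_rel (fgen K i * fgen K j * fgen K i - fgen K j * fgen K i * fgen K j)
| Hecke_comm (i j : 'I_k.-1) : (i.+1 < j)%N ->
    hecke_rel (fgen K i * fgen K j - fgen K j * fgen K i)
| Hecke_quad (i : 'I_k.-1) :
    hecke_rel ((fgen K i - q%:A) * (fgen K i + q^-1%:A)).

Definition hecke (k : nat) := presented (@hecke_rel k).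

HB.instance Definition _ k := GRing.PzRing.on (hecke k).
HB.instance Definition _ k := GRing.Lmodule.on (hecke k).

Definition sigma k (i : nat) : hecke k :=
  if insub i is Some j then pgen (@hecke_rel k) j else 0.

(* Additive Jucys-Murphy elements: 1 + (q - q^-1) jucys_murphy k i is the
   multiplicative one, and for q = 1 one gets the sums of transpositions. *)
Fixpoint jucys_murphy k (i : nat) : hecke k :=
  if i is i'.+1 then
    sigma k i' + sigma k i' * jucys_murphy k i' * sigma k i'
  else 0.

Definition is_partition (lam : seq nat) (k : nat) : Prop :=
  [/\ sorted geq lam, 0%N \notin lam & sumn lam = k].

Definition boxes (lam : seq nat) : seq (nat * nat) :=
  [seq (i, j) | i <- iota 0 (size lam), j <- iota 0 (nth 0%N lam i)].

(* The q-content q^c [c]_q = (q^(2c) - 1) / (q - q^-1) with c = j - i of the box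
   in row i and column j, written so as to make sense also for q = 1. *)
Definition qcontent (b : nat * nat) : K :=
  q ^- (2 * b.1) *
  (\sum_(s < b.2) q ^+ (2 * s).+1 - \sum_(s < b.1) q ^+ (2 * s).+1).

Definition primitive_idempotent k (e : hecke k) : Prop :=
  [/\ e * e = e, e <> 0 &
      forall f : hecke k, f * f = f -> e * f = f -> f * e = f ->
        f = 0 \/ f = e].

(* The irreducible module of type lam is the one on which the symmetric
   functions of the Jucys-Murphy elements take their values at the q-contents
   of lam; in particular sigma_i = q for lam = (k). *)
Definition idempotent_of_type k (lam : seq nat) (e : hecke k) : Prop :=
  primitive_idempotent e /\
  forall t : K,
    (\prod_(i < k) (t *: (1 : hecke k) + jucys_murphy k i)) * e
    = (\prod_(b <- boxes lam) (t + qcontent b)) *: e.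

Definition hecke_act N Z (r : 'End(sp K N (ETens Z Z))) k (e : hecke k) :
    'End(sp K N (power Z k)) :=
  alift (fun w : seq 'I_k.-1 =>
           foldr (fun (i : 'I_k.-1) f => (at_pos r k i \o f)%VF) \1%VF w) e.

End HeckeAlgebra.

Section Category.
Variables (K : fieldType) (N m n : nat) (q : K) (R Rinv Psi : tensor4 K N).

Local Notation basis := (basis N).
Local Notation sp := (sp K N).

(* ext_braid c d i j k l is the coefficient of y_k (x) z_l in the image of
   the i-th basis vector of the first factor tensored with the j-th basis
   vector of the second one; the booleans tell which factors are V^*. *)
Definition ext_braid (c d : bool) (i j k l : 'I_N) : K :=
  match c, d with
  | false, false => R k l i j
  | false, true => Rinv l j k i
  | true, false => Psi k i l j
  | true, true => R j i l k
  end.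

(* braid X Y x y y' x' is the coefficient of y' (x) x' in R_{X,Y}(x (x) y). *)
Fixpoint braid_letter (c : bool) (Y : expr) :
    'I_N -> basis Y -> basis Y -> 'I_N -> K :=
  match Y return 'I_N -> basis Y -> basis Y -> 'I_N -> K with
  | EUnit => fun i _ _ i' => (i == i')%:R
  | EV => fun i j k l => ext_braid c false i j k l
  | EVd => fun i j k l => ext_braid c true i j k l
  | ETens Y1 Y2 => fun i y y' i' =>
      \sum_(a < N) @braid_letter c Y1 i y.1 y'.1 a
                   * @braid_letter c Y2 a y.2 y'.2 i'
  | ESum Y1 Y2 => fun i y y' i' =>
      match y, y' with
      | inl y1, inl y1' => @braid_letter c Y1 i y1 y1' i'
      | inr y2, inr y2' => @braid_letter c Y2 i y2 y2' i'
      | _, _ => 0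
      end
  end.

Fixpoint braid (X Y : expr) : basis X -> basis Y -> basis Y -> basis X -> K :=
  match X return basis X -> basis Y -> basis Y -> basis X -> K with
  | EUnit => fun _ y y' _ => (y == y')%:R
  | EV => @braid_letter false Y
  | EVd => @braid_letter true Y
  | ETens X1 X2 => fun x y y' x' =>
      \sum_(z : basis Y) @braid X2 Y x.2 y z x'.2 * @braid X1 Y x.1 z y' x'.1
  | ESum X1 X2 => fun x y y' x' =>
      match x, x' with
      | inl x1, inl x1' => @braid X1 Y x1 y y' x1'
      | inr x2, inr x2' => @braid X2 Y x2 y y' x2'
      | _, _ => 0
      end
  end.

Definition braiding X Y : 'Hom(sp (ETens X Y), sp (ETens Y X)) :=
  lmap (fun p : basis (ETens X Y) =>
    [ffun p' : basis (ETens Y X) => braid p.1 p.2 p'.1 p'.2] : sp (ETens Y X)).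

Definition Bmx (j i : 'I_N) : K := \sum_k Psi k j k i.
Definition Cmx (j i : 'I_N) : K := \sum_k Psi j k i k.

Definition pair_r : 'Hom(sp (ETens EV EVd), sp EUnit) :=
  lmap (fun p : basis (ETens EV EVd) =>
    [ffun _ : basis EUnit => (p.1 == p.2)%:R] : sp EUnit).

Definition pair_l : 'Hom(sp (ETens EVd EV), sp EUnit) :=
  lmap (fun p : basis (ETens EVd EV) =>
    [ffun _ : basis EUnit => Bmx p.1 p.2] : sp EUnit).

Definition pi_r : 'Hom(sp EUnit, sp (ETens EVd EV)) :=
  lmap (fun _ : basis EUnit =>
    [ffun p : basis (ETens EVd EV) => (p.1 == p.2)%:R] : sp (ETens EVd EV)).

Definition pi_l : 'Hom(sp EUnit, sp (ETens EV EVd)) :=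
  lmap (fun _ : basis EUnit =>
    [ffun p : basis (ETens EV EVd) =>
       q ^ (2%:Z * (m%:Z - n%:Z)) * Cmx p.1 p.2] : sp (ETens EV EVd)).

(* The maps between realizing spaces generated by the identities, the
   braidings, the pairings and copairings. The associativity and unit maps are
   the identifications implicit in the realization by tensor products; the
   injections and projections give closure under direct sums. *)
Inductive generated : forall X Y, 'Hom(sp X, sp Y) -> Prop :=
| Gen_id X : generated (\1%VF : 'End(sp X))
| Gen_braiding X Y : generated (braiding X Y)
| Gen_pair_r : generated pair_r
| Gen_pair_l : generated pair_l
| Gen_pi_r : generated pi_r
| Gen_pi_l : generated pi_l
| Gen_assoc X Y Z : generated (assoc K N X Y Z)
| Gen_assocV X Y Z : generated (assocV K N X Y Z)
| Gen_lunit X : generated (lunit K N X)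
| Gen_lunitV X : generated (lunitV K N X)
| Gen_runit X : generated (runit K N X)
| Gen_runitV X : generated (runitV K N X)
| Gen_inj1 X Y : generated (inj1 K N X Y)
| Gen_inj2 X Y : generated (inj2 K N X Y)
| Gen_prj1 X Y : generated (prj1 K N X Y)
| Gen_prj2 X Y : generated (prj2 K N X Y)
| Gen_0 X Y : generated (0 : 'Hom(sp X, sp Y))
| Gen_lin X Y (c : K) (f g : 'Hom(sp X, sp Y)) :
    generated f -> generated g -> generated (c *: f + g)
| Gen_comp X Y Z (f : 'Hom(sp Y, sp Z)) (g : 'Hom(sp X, sp Y)) :
    generated f -> generated g -> generated (f \o g)%VF
| Gen_tens X X' Y Y' (f : 'Hom(sp X, sp Y)) (g : 'Hom(sp X', sp Y')) :
    generated f -> generated g -> generated (tmap f g).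

(* A realized object is the image of the idempotent proj in the space sp amb.
   Linear maps between the images of P and Q are encoded by the linear maps f
   between the ambient spaces such that f = Q f P; in particular End of the
   image of P is { f | f = P f P }, with unit P. *)
Record robj := Robj { amb : expr; proj : 'End(sp amb) }.

Definition rtens (U W : robj) : robj :=
  @Robj (ETens (amb U) (amb W)) (tmap (proj U) (proj W)).

Definition rsum (U W : robj) : robj :=
  @Robj (ESum (amb U) (amb W))
    ((inj1 K N (amb U) (amb W) \o proj U \o prj1 K N (amb U) (amb W))
     + (inj2 K N (amb U) (amb W) \o proj W \o prj2 K N (amb U) (amb W)))%VF.

Definition schur k (e : hecke q k) : robj :=
  @Robj (power EV k) (hecke_act (braiding EV EV) e).

Definition schur_dual k (e : hecke q k) : robj :=
  @Robj (power EVd k) (hecke_act (braiding EVd EVd) e).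

Inductive SW_object : robj -> Prop :=
| SW_VVd k l lam mu (e : hecke q k) (f : hecke q l) :
    is_partition lam k -> idempotent_of_type lam e ->
    is_partition mu l -> idempotent_of_type mu f ->
    SW_object (rtens (schur e) (schur_dual f))
| SW_VdV k l lam mu (e : hecke q k) (f : hecke q l) :
    is_partition lam k -> idempotent_of_type lam e ->
    is_partition mu l -> idempotent_of_type mu f ->
    SW_object (rtens (schur_dual f) (schur e))
| SW_sum U W : SW_object U -> SW_object W -> SW_object (rsum U W)
| SW_tens U W : SW_object U -> SW_object W -> SW_object (rtens U W).

Definition SW_morphism (U W : robj) (f : 'Hom(sp (amb U), sp (amb W))) : Prop :=
  generated f /\ f = (proj W \o f \o proj U)%VF.

(* V (x) V^* = End(V), with l_i^j = x_i (x) x^j. *)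
Definition EndV : expr := ETens EV EVd.
Definition EndV_obj : robj := @Robj EndV \1%VF.

Local Notation gens := ('I_N * 'I_N)%type.
Local Notation F := (freealg K gens).

Definition mx2_mul (A B : gens -> gens -> F) (i j : gens) : F :=
  \sum_(k : gens) A i k * B k j.

Definition Rbar (i j : gens) : F := (R j.1 j.2 i.1 i.2)%:A.

Definition L1 (i j : gens) : F :=
  if i.2 == j.2 then fgen K ((i.1, j.1) : gens) else 0.

Definition re_rel (x : F) : Prop :=
  exists i j : gens,
    x = mx2_mul Rbar (mx2_mul L1 (mx2_mul Rbar L1)) i j
        - mx2_mul L1 (mx2_mul Rbar (mx2_mul L1 Rbar)) i j
        - (mx2_mul Rbar L1 i j - mx2_mul L1 Rbar i j).

(* The modified reflection equation algebra L(R_q, 1). *)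
Definition mrea := presented re_rel.

HB.instance Definition _ := GRing.PzRing.on mrea.
HB.instance Definition _ := GRing.Lmodule.on mrea.

Definition lgen (g : gens) : mrea := pgen re_rel g.

(* The space X (x) L. *)
Definition xL (X : expr) := {ffun basis X -> mrea}.

HB.instance Definition _ X := GRing.Lmodule.on (xL X).

(* R(b (x) u) for b in L and u in X: one has R(1 (x) u) = u (x) 1 and
   R(l b (x) u) = (id (x) mult) (R(l (x) .) (x) id) R(b (x) u) for a generator
   l, where R(l (x) u) is the braiding of V (x) V^* with X. *)
Definition braid_LX X (b : mrea) (u : sp X) : xL X :=
  alift (fun w : seq gens =>
    foldr (fun (g : gens) (t : xL X) =>
             [ffun y => \sum_(x : basis X) \sum_(h : gens)
                @braid EndV X g x y h *: (lgen h * t x)] : xL X)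
          ([ffun y => (u y : K) *: (1 : mrea)] : xL X) w) b.

Definition LL := tprod mrea mrea.

HB.instance Definition _ := GRing.Lmodule.on LL.

Definition tenL (a b : mrea) : LL := ten a b.

(* R_End(b (x) a): the factors of a = l1 ... lk are moved one by one to the
   left of b. *)
Definition braid_LL (b a : mrea) : LL :=
  alift (fun w : seq gens =>
    foldl (fun (t : LL) (g : gens) =>
             tlift (fun a' b' : mrea =>
               \sum_(h : gens)
                 tenL (a' * lgen h) (@braid_LX EndV b' (@bvec K N EndV g) h)) t)
          (tenL 1 b) w) a.

Definition star (s t : LL) : LL :=
  tlift (fun a1 b1 : mrea =>
    tlift (fun a2 b2 : mrea =>
      tlift (fun a2' b1' : mrea => tenL (a1 * a2') (b1' * b2))
            (braid_LL b1 a2)) t) s.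

Definition Delta_gen (g : gens) : LL :=
  tenL (lgen g) 1 + tenL 1 (lgen g)
  - (q - q^-1) *: \sum_(k < N) tenL (lgen (g.1, k)) (lgen (k, g.2)).

(* Delta is the star-multiplicative extension of Delta_gen to words. *)
Definition Delta (a : mrea) : LL :=
  alift (fun w : seq gens =>
    foldr (fun (g : gens) (t : LL) => star (Delta_gen g) t) (tenL 1 1) w) a.

Definition representation (U : robj) (rho : mrea -> 'End(sp (amb U))) : Prop :=
  [/\ linear rho, rho 1 = proj U & forall a b, rho (a * b) = (rho a \o rho b)%VF].

(* The map V (x) V^* (x) U -> U, l_i^j (x) u |-> rho(l_i^j) |> u. *)
Definition action_map (U : robj) (rho : mrea -> 'End(sp (amb U))) :
    'Hom(sp (amb (rtens EndV_obj U)), sp (amb U)) :=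
  lmap (fun p : basis (ETens EndV (amb U)) => rho (lgen p.1) (bvec K p.2)).

Definition equivariant_representation (U : robj)
    (rho : mrea -> 'End(sp (amb U))) : Prop :=
  representation rho /\ SW_morphism (action_map rho).

Section TensorRepresentation.
Variables (U W : robj).
Variables (rhoU : mrea -> 'End(sp (amb U))) (rhoW : mrea -> 'End(sp (amb W))).

(* (rho_U(a) |> u') (x) (rho_W(b') |> w), where u' (x) b' = R(b (x) u) is
   expanded over the basis of the ambient space of U. *)
Definition tens_act (a b : mrea) (u : sp (amb U)) (w : sp (amb W)) :
    sp (amb (rtens U W)) :=
  \sum_(x : basis (amb U))
     tvec (rhoU a (bvec K x)) (rhoW (braid_LX b u x) w).

Definition rho_tens (t : LL) : 'End(sp (amb (rtens U W))) :=
  tlift (fun a b : mrea =>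
    lmap (fun p : basis (ETens (amb U) (amb W)) =>
            tens_act a b (bvec K p.1) (bvec K p.2))
      : 'End(sp (amb (rtens U W)))) t.

End TensorRepresentation.

End Category.

(* Main.v *)
From HB Require Import structures.
Require Import Defs.
From mathcomp Require Import all_boot all_order all_algebra finmap.
From mathcomp.multinomials Require Import monalg.
From mathcomp Require Import boolp ring.

Set Implicit Arguments.
Unset Strict Implicit.
Unset Printing Implicit Defensive.

Import GRing.Theory.

Local Open Scope ring_scope.

(* Put K = I - (q - q^-1) L. If q != q^-1, the quadratic-linear relations for L
   are the reflection equation for K (if q = q^-1, they are treated directly),
   and Delta is matrix multiplication on K. On U (x) W the first factor acts by
   rho_U on U, the second one through the braiding of L(R_q,1) past U; since
   rho_U is equivariant, naturality of this braiding gives the exchange relation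
   B R A = R A R^-1 B R between the two matrices A and B of operators, and under
   this relation the product of two solutions of the reflection equation is a
   solution again.
   Naturality is needed for all generated morphisms f, that is: moving a letter,
   or an element of L(R_q,1), past the source and then applying f is the same as
   applying f and then moving past the target. It is an induction on f, which
   starts with the Yang-Baxter equations among V and V^*. *)

(** * Matrices and coordinates *)

(** Maps on a quotient or on a tensor product are computed on a chosen representative, so
    independence of the choice is an issue throughout. For the braiding of L(R_q,1) past an object X
    it calls for naturality in the object that moves, besides naturality in the object that is
    passed: the relations are given by two maps, from V (x) V (x) V^* (x) V^* to End(V) (x) End(V)
    and to End(V), and moving them past X turns relations into relations. One ingredient of these
    maps, the inverse of the braiding of V^* past V, is not a generating map; it is natural as the
    inverse of a natural map. For the braiding of L(R_q,1) with itself, for the product of L (x) L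
    and for Delta the issue is bypassed: they are only evaluated under rho_{U (x) W}, where the
    choice becomes invisible. The second obstacle is the unit. rho_U(1) is the projection of U and
    not the identity of the ambient space, so a word in ambient operators differs from the value of
    the representation by the factor E0 = rho_{U (x) W}(1 (x) 1). The operators of the generators
    absorb E0 on both sides; on the right this is naturality for the projection of U. *)

Section FiniteMatrices.
Variable I : finType.

Lemma sum_delta_l (V : pzRingType) (F : I -> V) i :
  \sum_k (i == k)%:R * F k = F i.
Proof.
rewrite (bigD1 i) //= eqxx mul1r big1 ?addr0 // => k /negPf ki.
by rewrite eq_sym ki mul0r.
Qed.

Lemma sum_delta_r (V : pzRingType) (F : I -> V) i :
  \sum_k F k * (k == i)%:R = F i.
Proof.
rewrite (bigD1 i) //= eqxx mulr1 big1 ?addr0 // => k /negPf ki.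
by rewrite ki mulr0.
Qed.

Lemma sum_delta_scale (K : pzRingType) (V : lmodType K) (F : I -> V) i :
  \sum_k ((k == i)%:R : K) *: F k = F i.
Proof.
rewrite (bigD1 i) //= eqxx scale1r big1 ?addr0 // => k /negPf ki.
by rewrite ki scale0r.
Qed.

Variable A : pzRingType.

(** Indices will be tuples of basis vectors, entries scalars or operators. The ring of entries may
    be zero, because the space on which the operators act may be. *)
Definition fmx := {ffun I * I -> A}.

HB.instance Definition _ := GRing.Zmodule.on fmx.

Implicit Types a b c : fmx.

Definition fmx_mul a b : fmx := [ffun p => \sum_k a (p.1, k) * b (k, p.2)].
Definition fmx_one : fmx := [ffun p => (p.1 == p.2)%:R].

Lemma fmx_mulA : associative fmx_mul.
Proof.
move=> a b c; apply/ffunP => -[i j]; rewrite !ffunE /=.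
under eq_bigr => k _ do rewrite ffunE /= mulr_sumr.
rewrite exchange_big /=; apply: eq_bigr => k _; rewrite ffunE /= mulr_suml.
by apply: eq_bigr => l _; rewrite mulrA.
Qed.

Lemma fmx_1mul : left_id fmx_one fmx_mul.
Proof.
move=> a; apply/ffunP => -[i j]; rewrite ffunE /= -[RHS](sum_delta_l (fun k => a (k, j))).
by apply: eq_bigr => k _; rewrite ffunE.
Qed.

Lemma fmx_mul1 : right_id fmx_one fmx_mul.
Proof.
move=> a; apply/ffunP => -[i j]; rewrite ffunE /=.
rewrite -[RHS](sum_delta_r (fun k => a (i, k))).
by apply: eq_bigr => k _; rewrite ffunE.
Qed.

Lemma fmx_mulDl : left_distributive fmx_mul +%R.
Proof.
move=> a b c; apply/ffunP => p; rewrite !ffunE -big_split.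
by apply: eq_bigr => k _; rewrite ffunE mulrDl.
Qed.

Lemma fmx_mulDr : right_distributive fmx_mul +%R.
Proof.
move=> a b c; apply/ffunP => p; rewrite !ffunE -big_split.
by apply: eq_bigr => k _; rewrite ffunE mulrDr.
Qed.

HB.instance Definition _ := GRing.Zmodule_isPzRing.Build fmx
  fmx_mulA fmx_1mul fmx_mul1 fmx_mulDl fmx_mulDr.

Lemma fmxM a b i j : (a * b) (i, j) = \sum_k a (i, k) * b (k, j).
Proof. by rewrite ffunE. Qed.

Lemma fmx1 i j : (1 : fmx) (i, j) = (i == j)%:R.
Proof. by rewrite ffunE. Qed.

End FiniteMatrices.

Section FieldMatrices.
Variables (K : fieldType) (J : finType).

HB.instance Definition _ := GRing.Lmodule.copy (fmx J K) {ffun J * J -> K^o}.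

Lemma fmxZ (c : K) (a : fmx J K) p : (c *: a) p = c * a p.
Proof. by rewrite ffunE. Qed.

Lemma fmx_scaleAl (c : K) (a b : fmx J K) : c *: (a * b) = (c *: a) * b.
Proof.
apply/ffunP => -[i j]; rewrite fmxZ !fmxM mulr_sumr.
by apply: eq_bigr => k _; rewrite fmxZ mulrA.
Qed.

Lemma fmx_scaleAr (c : K) (a b : fmx J K) : c *: (a * b) = a * (c *: b).
Proof.
apply/ffunP => -[i j]; rewrite fmxZ !fmxM mulr_sumr.
by apply: eq_bigr => k _; rewrite fmxZ mulrCA.
Qed.

Lemma fmx_sumE (T : Type) (s : seq T) (F : T -> fmx J K) p :
  (\sum_(i <- s) F i) p = \sum_(i <- s) F i p.
Proof. by apply: (big_morph (fun a : fmx J K => a p)) => [a b|]; rewrite ffunE. Qed.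

End FieldMatrices.

Section Coordinates.
Variables (K : fieldType) (N : nat).

Local Notation basis := (basis N).
Local Notation sp := (sp K N).

(* Column index first: the coefficient of [y] in the image of [x]. *)
Definition mc X Y (f : 'Hom(sp X, sp Y)) (x : basis X) (y : basis Y) : K :=
  f (bvec K x) y.

Lemma bvecE X (x y : basis X) : bvec K x y = (y == x)%:R.
Proof. by rewrite ffunE. Qed.

Lemma sp_sumE X (T : Type) (s : seq T) (F : T -> sp X) x :
  (\sum_(i <- s) F i) x = \sum_(i <- s) F i x.
Proof.
by apply: (big_morph (fun u : sp X => u x)) => [a b|]; rewrite ffunE.
Qed.

Lemma sp_expand X (u : sp X) : u = \sum_x (u x : K) *: bvec K x.
Proof.
apply/ffunP => y; rewrite sp_sumE -[LHS](sum_delta_r (fun x => u x : K)).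
by apply: eq_bigr => x _; rewrite !ffunE eq_sym.
Qed.

Lemma mc_app X Y (f : 'Hom(sp X, sp Y)) u y :
  f u y = \sum_x (u x : K) * mc f x y.
Proof.
rewrite {1}[u]sp_expand linear_sum sp_sumE; apply: eq_bigr => x _.
by rewrite linearZ ffunE.
Qed.

Lemma mcP X Y (f g : 'Hom(sp X, sp Y)) : mc f =2 mc g -> f = g.
Proof.
move=> fg; apply/lfunP => u; apply/ffunP => y; rewrite !mc_app.
by apply: eq_bigr => x _; rewrite fg.
Qed.

Lemma lfun_bvecP X Y (f g : 'Hom(sp X, sp Y)) :
  (forall x, f (bvec K x) = g (bvec K x)) -> f = g.
Proof. by move=> fg; apply: mcP => x y; rewrite /mc fg. Qed.

Lemma mc_lmap X Y (f : basis X -> sp Y) x y : mc (lmap f) x y = f x y.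
Proof. by rewrite /mc lmap_bvec. Qed.

Lemma mc_id X x y : mc (\1%VF : 'End(sp X)) x y = (x == y)%:R.
Proof. by rewrite /mc id_lfunE bvecE eq_sym. Qed.

Lemma mc_comp X Y Z (f : 'Hom(sp Y, sp Z)) (g : 'Hom(sp X, sp Y)) x z :
  mc (f \o g)%VF x z = \sum_y mc g x y * mc f y z.
Proof. by rewrite /mc comp_lfunE mc_app. Qed.

Lemma mc_lin X Y c (f g : 'Hom(sp X, sp Y)) x y :
  mc (c *: f + g) x y = c * mc f x y + mc g x y.
Proof. by rewrite /mc add_lfunE scale_lfunE !ffunE. Qed.

Lemma tvecE X Y (u : sp X) (v : sp Y) x y : tvec u v (x, y) = u x * v y.
Proof. by rewrite ffunE. Qed.

Lemma mc_tmap X X' Y Y' (f : 'Hom(sp X, sp Y)) (g : 'Hom(sp X', sp Y')) x y :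
  mc (tmap f g) x y = mc f x.1 y.1 * mc g x.2 y.2.
Proof. by case: y => y y'; rewrite mc_lmap tvecE. Qed.

Lemma tvec_bvec X Y (x : basis X) (y : basis Y) :
  tvec (bvec K x) (bvec K y) = bvec K ((x, y) : basis (ETens X Y)).
Proof.
by apply/ffunP => -[a b]; rewrite tvecE !bvecE -natrM mulnb xpair_eqE.
Qed.

Lemma tmap_tvec X X' Y Y' (f : 'Hom(sp X, sp Y)) (g : 'Hom(sp X', sp Y')) u v :
  tmap f g (tvec u v) = tvec (f u) (g v).
Proof.
apply/ffunP => -[y y']; rewrite mc_app tvecE !mc_app big_distrlr /=.
rewrite pair_big; apply: eq_bigr => -[x x'] _ /=.
by rewrite tvecE mc_tmap mulrACA.
Qed.

Lemma tmap_bvec X X' Y Y' (f : 'Hom(sp X, sp Y)) (g : 'Hom(sp X', sp Y')) x y :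
  tmap f g (bvec K ((x, y) : basis (ETens X X')))
  = tvec (f (bvec K x)) (g (bvec K y)).
Proof. exact: lmap_bvec. Qed.

Lemma tmap_comp X X' Y Y' Z Z' (f : 'Hom(sp Y, sp Z)) (f' : 'Hom(sp Y', sp Z'))
    (g : 'Hom(sp X, sp Y)) (g' : 'Hom(sp X', sp Y')) :
  (tmap f f' \o tmap g g')%VF = tmap (f \o g)%VF (f' \o g')%VF.
Proof.
apply: lfun_bvecP => -[x x'].
by rewrite comp_lfunE !tmap_bvec tmap_tvec !comp_lfunE.
Qed.

(** Associators only relabel basis vectors, so their values are read off through the inverse
    relabelling. *)
Lemma lmap_relabel X Y (h : basis X -> basis Y) (g : basis Y -> basis X)
    (u : sp X) y : cancel h g -> cancel g h ->
  lmap (fun x => bvec K (h x)) u y = u (g y).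
Proof.
move=> hK gK; rewrite mc_app -[RHS](sum_delta_r (fun x => u x : K)).
apply: eq_bigr => x _; rewrite mc_lmap bvecE; congr (_ * _%:R).
by rewrite eq_sym (can2_eq hK gK).
Qed.

Lemma assocE X Y Z u x y z : assoc K N X Y Z u (x, (y, z)) = u ((x, y), z).
Proof.
exact: (lmap_relabel (X := ETens (ETens X Y) Z) (Y := ETens X (ETens Y Z))
  (h := fun p => (p.1.1, (p.1.2, p.2))) (g := fun p => ((p.1, p.2.1), p.2.2))
  u (x, (y, z)) (fun p => let: ((a, b), c) := p in erefl)
  (fun p => let: (a, (b, c)) := p in erefl)).
Qed.

Lemma assocVE X Y Z u x y z : assocV K N X Y Z u ((x, y), z) = u (x, (y, z)).
Proof.
exact: (lmap_relabel (X := ETens X (ETens Y Z)) (Y := ETens (ETens X Y) Z)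
  (h := fun p => ((p.1, p.2.1), p.2.2)) (g := fun p => (p.1.1, (p.1.2, p.2)))
  u ((x, y), z) (fun p => let: (a, (b, c)) := p in erefl)
  (fun p => let: ((a, b), c) := p in erefl)).
Qed.

Lemma assoc_bvec X Y Z (x : basis X) (y : basis Y) (z : basis Z) :
  assoc K N X Y Z (bvec K (((x, y), z) : basis (ETens (ETens X Y) Z)))
  = bvec K ((x, (y, z)) : basis (ETens X (ETens Y Z))).
Proof. exact: lmap_bvec. Qed.

Lemma assocV_bvec X Y Z (x : basis X) (y : basis Y) (z : basis Z) :
  assocV K N X Y Z (bvec K ((x, (y, z)) : basis (ETens X (ETens Y Z))))
  = bvec K (((x, y), z) : basis (ETens (ETens X Y) Z)).
Proof. exact: lmap_bvec. Qed.

End Coordinates.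

Lemma sum_prod (V : nmodType) (A B : finType) (F : A * B -> V) :
  \sum_p F p = \sum_a \sum_b F (a, b).
Proof. by rewrite pair_bigA; apply: eq_bigr => -[]. Qed.

Lemma sum_rotate (V : nmodType) (A B C : finType) (F : A -> B -> C -> V) :
  \sum_x \sum_y \sum_z F x y z = \sum_z \sum_x \sum_y F x y z.
Proof.
by under eq_bigr => x _ do rewrite exchange_big /=; rewrite exchange_big.
Qed.

(** * Yang-Baxter equations among V and V^* *)

Section YangBaxter.
Variables (K : fieldType) (N : nat).

Local Notation I := 'I_N.
Local Notation crossing := (I -> I -> I -> I -> K).

Implicit Types e f : crossing.

(* [e i j k l] is the coefficient of the outgoing pair [(k, l)] in the image of
   the incoming pair [(i, j)], and products are in diagrammatic order. *)
Definition lift12 e : fmx (I * I * I)%type K :=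
  [ffun p => e p.1.1.1 p.1.1.2 p.2.1.1 p.2.1.2 * (p.1.2 == p.2.2)%:R].

Definition lift23 e : fmx (I * I * I)%type K :=
  [ffun p => (p.1.1.1 == p.2.1.1)%:R * e p.1.1.2 p.1.2 p.2.1.2 p.2.2].

Lemma lift12E e i j k a b c :
  lift12 e (i, j, k, (a, b, c)) = e i j a b * (k == c)%:R.
Proof. by rewrite ffunE. Qed.

Lemma lift23E e i j k a b c :
  lift23 e (i, j, k, (a, b, c)) = (i == a)%:R * e j k b c.
Proof. by rewrite ffunE. Qed.

Lemma mul_lift12 e (M : fmx (I * I * I)%type K) i j k p :
  (lift12 e * M) (i, j, k, p) = \sum_x \sum_y e i j x y * M (x, y, k, p).
Proof.
rewrite fmxM sum_prod sum_prod; apply: eq_bigr => x _; apply: eq_bigr => y _.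
rewrite -[RHS](sum_delta_l (fun z => e i j x y * M (x, y, z, p))).
by apply: eq_bigr => z _; rewrite lift12E mulrCA mulrA.
Qed.

Lemma mul_lift23 e (M : fmx (I * I * I)%type K) i j k p :
  (lift23 e * M) (i, j, k, p) = \sum_y \sum_z e j k y z * M (i, y, z, p).
Proof.
rewrite fmxM sum_prod sum_prod.
rewrite -[RHS](sum_delta_l (fun x => \sum_y \sum_z e j k y z * M (x, y, z, p))).
apply: eq_bigr => x _; rewrite mulr_sumr; apply: eq_bigr => y _.
by rewrite mulr_sumr; apply: eq_bigr => z _; rewrite lift23E mulrA.
Qed.

Definition inverse_crossing e f : Prop :=
  forall i j k l,
    \sum_a \sum_b e i j a b * f a b k l = (i == k)%:R * (j == l)%:R.

Lemma lift12M e f : inverse_crossing e f -> lift12 e * lift12 f = 1.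
Proof.
move=> ef; apply/ffunP => -[[[i j] k] [[a b] c]].
rewrite mul_lift12 fmx1 !xpair_eqE -!mulnb !natrM -ef mulr_suml.
apply: eq_bigr => x _; rewrite mulr_suml; apply: eq_bigr => y _.
by rewrite lift12E mulrA.
Qed.

Lemma lift23M e f : inverse_crossing e f -> lift23 e * lift23 f = 1.
Proof.
move=> ef; apply/ffunP => -[[[i j] k] [[a b] c]].
rewrite mul_lift23 fmx1 !xpair_eqE -!mulnb !natrM -mulrA -ef mulr_sumr.
apply: eq_bigr => x _; rewrite mulr_sumr; apply: eq_bigr => y _.
by rewrite lift23E mulrCA.
Qed.

(** The two sides of the Yang-Baxter equation with the Kronecker deltas summed away: one index per
    inner edge of the diagram. In this form a rotation of the diagram is a renaming of indices. *)
Definition triangle_down e1 e2 e3 i j k a b c : K :=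
  \sum_x \sum_y \sum_z e1 j k x y * e2 i x a z * e3 z y b c.

Definition triangle_up e1 e2 e3 i j k a b c : K :=
  \sum_x \sum_y \sum_z e1 i j x y * e2 y k z c * e3 x z a b.

Lemma lift_triangle_down e1 e2 e3 i j k a b c :
  (lift23 e1 * lift12 e2 * lift23 e3) (i, j, k, (a, b, c))
  = triangle_down e1 e2 e3 i j k a b c.
Proof.
rewrite -mulrA mul_lift23; apply: eq_bigr => x _; apply: eq_bigr => y _.
rewrite mul_lift12 exchange_big mulr_sumr; apply: eq_bigr => z _.
rewrite -mulrA; congr (_ * _).
rewrite -[RHS](sum_delta_r (fun t => e2 i x t z * e3 z y b c)).
by apply: eq_bigr => t _; rewrite lift23E; ring.
Qed.

Lemma lift_triangle_up e1 e2 e3 i j k a b c :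
  (lift12 e1 * lift23 e2 * lift12 e3) (i, j, k, (a, b, c))
  = triangle_up e1 e2 e3 i j k a b c.
Proof.
rewrite -mulrA mul_lift12; apply: eq_bigr => x _; apply: eq_bigr => y _.
rewrite mul_lift23 mulr_sumr; apply: eq_bigr => z _.
rewrite -mulrA; congr (_ * _).
rewrite -[RHS](sum_delta_r (fun t => e2 y k z t * e3 x z a b)).
by apply: eq_bigr => t _; rewrite lift12E; ring.
Qed.

(** Six independent crossings, because strands of type V and V^* cross differently and because
    rotating or inverting affects only some of the crossings. *)
Definition yb e1 e2 e3 f1 f2 f3 : Prop :=
  lift23 e1 * lift12 e2 * lift23 e3 = lift12 f1 * lift23 f2 * lift12 f3.

Lemma ybP e1 e2 e3 f1 f2 f3 :
  yb e1 e2 e3 f1 f2 f3 <->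
  forall i j k a b c, triangle_down e1 e2 e3 i j k a b c
                      = triangle_up f1 f2 f3 i j k a b c.
Proof.
split=> [ef i j k a b c|ef].
  by rewrite -lift_triangle_down -lift_triangle_up ef.
apply/ffunP => -[[[i j] k] [[a b] c]].
by rewrite lift_triangle_down lift_triangle_up.
Qed.

(** A quarter turn: around the crossing the legs are [k, i, j, l] for [e] and [i, j, l, k] for
    [flat e]. *)
Definition flat e : crossing := fun i j k l => e k i l j.

(* Turning the six legs of the diagram by one step exchanges the two
   triangles. *)
Lemma yb_flat e1 e2 e3 f1 f2 f3 :
  yb f1 f3 f2 e2 e1 e3 -> yb (flat e1) (flat e2) e3 f1 (flat f2) (flat f3).
Proof.
move=> /ybP ef; apply/ybP => i j k a b c.
transitivity (triangle_up e2 e1 e3 a i j b c k).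
  rewrite /triangle_down /triangle_up sum_rotate.
  by do 3![apply: eq_bigr => ? _]; rewrite /flat; ring.
rewrite -ef; do 3![apply: eq_bigr => ? _].
by rewrite /flat; ring.
Qed.

(** Multiplying by [f1'] on the left and by [e3'] on the right carries one crossing from each side
    to the other. The two triangles change roles, so the sides of the equation are exchanged. *)
Lemma yb_inv_l e1 e2 e3 e3' f1 f1' f2 f3 :
  inverse_crossing e3 e3' -> inverse_crossing f1' f1 ->
  yb e1 e2 e3 f1 f2 f3 -> yb f2 f3 e3' f1' e1 e2.
Proof.
rewrite /yb => /lift23M e3K /lift12M f1K ef.
have := congr1 (fun M => lift12 f1' * M * lift23 e3') ef.
by rewrite /= -!mulrA e3K mulr1 !mulrA f1K mul1r => <-.
Qed.

Lemma yb_inv_r e1 e1' e2 e3 f1 f2 f3 f3' :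
  inverse_crossing e1' e1 -> inverse_crossing f3 f3' ->
  yb e1 e2 e3 f1 f2 f3 -> yb e1' f1 f2 e2 e3 f3'.
Proof.
rewrite /yb => /lift23M e1K /lift12M f3K ef.
have := congr1 (fun M => lift23 e1' * M * lift12 f3') ef.
by rewrite /= -!mulrA f3K mulr1 !mulrA e1K mul1r => ->.
Qed.

End YangBaxter.

Section Letters.
Variables (K : fieldType) (N m n : nat) (q : K) (R Rinv Psi : tensor4 K N).
Hypothesis hR : hecke_symmetry q m n R Rinv Psi.

Local Notation E := (ext_braid R Rinv Psi).
Local Notation r := (E false false).

(** This is [flat] of R, and skew-invertibility says that Psi, the braiding of V^* past V, is its
    inverse. A second quarter turn gives the braiding of V^* with itself, while [flat] of R^-1 is
    the braiding of V past V^*. *)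
Definition opposite_skew (i j k l : 'I_N) : K := R l j k i.
Local Notation s := opposite_skew.
Local Notation ri := (fun i j k l : 'I_N => Rinv k l i j).

Lemma mc_op_of (T : tensor4 K N) (x y : basis N (ETens EV EV)) :
  mc (op_of T) x y = T y.1 y.2 x.1 x.2.
Proof. by rewrite mc_lmap ffunE. Qed.

Lemma op_of_inverse (T T' : tensor4 K N) :
  (op_of T \o op_of T')%VF = \1%VF ->
  inverse_crossing (fun i j k l => T' k l i j) (fun i j k l => T k l i j).
Proof.
move=> TT' i j k l; have := congr1 (fun f => mc f ((i, j) : basis N (ETens EV EV))
  ((k, l) : basis N (ETens EV EV))) TT'.
rewrite /= mc_comp mc_id xpair_eqE -natrM mulnb => <-.
by rewrite sum_prod; do 2![apply: eq_bigr => ? _]; rewrite !mc_op_of.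
Qed.

Lemma R_Rinv : inverse_crossing r ri.
Proof. by case: hR => _ _ [_ /op_of_inverse]. Qed.

Lemma Rinv_R : inverse_crossing ri r.
Proof. by case: hR => _ _ [/op_of_inverse]. Qed.

Lemma skew_l : inverse_crossing (E true false) s.
Proof.
case: hR => _ _ _ skew _ i j k l; have [+ _] := skew l k j i.
rewrite exchange_big /= mulrC eq_sym [k == i]eq_sym [j == l]eq_sym => <-.
by do 2![apply: eq_bigr => ? _]; rewrite /s mulrC.
Qed.

Lemma skew_r : inverse_crossing s (E true false).
Proof.
case: hR => _ _ _ skew _ i j k l; have [_ +] := skew k l i j.
rewrite [k == i]eq_sym => <-.
by do 2![apply: eq_bigr => ? _]; rewrite /s mulrC.
Qed.

Lemma yb_R : yb r r r r r r.
Proof.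
have [braidR _ _ _ _] := hR.
pose toM (f : 'End(sp K N (ETens (ETens EV EV) EV)))
  : fmx ('I_N * 'I_N * 'I_N)%type K := [ffun p => mc f p.1 p.2].
(* Matrix products are diagrammatic, so the order is reversed; both sides of the braid equation are
   palindromes. *)
have toM_comp f g : toM (f \o g)%VF = toM g * toM f.
  by apply/ffunP => -[x y]; rewrite fmxM ffunE mc_comp; apply: eq_bigr => z _;
    rewrite !ffunE.
have M12 : toM (tmap (op_of R) \1%VF) = lift12 r.
  apply/ffunP => -[[[i j] k] [[a b] c]].
  by rewrite lift12E ffunE mc_tmap mc_op_of mc_id.
have M23 : toM (assocV K N EV EV EV \o tmap \1%VF (op_of R)
                 \o assoc K N EV EV EV)%VF = lift23 r.
  apply/ffunP => -[[[i j] k] [[a b] c]].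
  rewrite lift23E ffunE /= /mc !comp_lfunE assoc_bvec tmap_bvec id_lfunE assocVE.
  by rewrite tvecE bvecE [a == i]eq_sym; congr (_ * _); rewrite -/(mc _ _ _) mc_op_of.
have := congr1 toM braidR.
by rewrite !toM_comp M12 M23 /yb !mulrA => ->.
Qed.

(* The mixed equations are reduced to the one for [R] by rotating the diagram
   and by moving inverse crossings from one side to the other. *)
Lemma yb_letters (b c d : bool) :
  yb (E c d) (E b d) (E b c) (E b c) (E b d) (E c d).
Proof.
have RK := R_Rinv; have KR := Rinv_R; have TK := skew_l; have KT := skew_r.
have y0 := yb_R.
have yl : yb r r ri ri r r := yb_inv_l RK KR y0.
have yr : yb ri r r r r ri := yb_inv_r KR RK y0.
have yrl : yb r ri ri ri ri r := yb_inv_l RK KR yr.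
have ylr : yb ri ri r r ri ri := yb_inv_r KR RK yl.
(* By conversion, [flat] takes [r] to [s], [s] to [E true true] and [ri] to [E false true]; only
   [E true false] has to be reached by inverting [s]. *)
have ssr : yb s s r r s s := yb_flat (e1 := r) (e2 := r) (f2 := r) (f3 := r) y0.
have oss : yb (E true true) s s s s (E true true) :=
  yb_flat (e1 := s) (e2 := r) (f2 := r) (f3 := s) ssr.
have ese : yb (E false true) s ri ri s (E false true) :=
  yb_flat (e1 := ri) (e2 := r) (f2 := r) (f3 := ri) ylr.
have oes : yb (E true true) (E false true) s s (E false true) (E true true).
  apply: (yb_flat (e1 := s) (e2 := ri) (f2 := ri) (f3 := s)).
  exact: (yb_flat (e1 := r) (e2 := r) (f2 := r) (f3 := r) yr).
have ser : yb s (E false true) r r (E false true) s :=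
  yb_flat (e1 := r) (e2 := ri) (f2 := ri) (f3 := r) yl.
case: b; case: c; case: d.
- exact: (yb_flat (e1 := s) (e2 := s) (f2 := s) (f3 := s) oss).
- exact: yb_inv_r TK KT (yb_inv_l KT TK oss).
- exact: yb_inv_l KT TK oes.
- exact: yb_inv_l KT TK (yb_inv_r TK KT ssr).
- exact: (yb_flat (e1 := s) (e2 := ri) (f2 := ri) (f3 := s) ese).
- exact: yb_inv_r TK KT ser.
- exact: (yb_flat (e1 := ri) (e2 := ri) (f2 := ri) (f3 := ri) yrl).
- exact: y0.
Qed.

End Letters.

(** * Naturality of the braidings *)

Section Corepresentations.
Variables (K : fieldType) (N m n : nat) (q : K) (R Rinv Psi : tensor4 K N).

Local Notation basis := (basis N).
Local Notation sp := (sp K N).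

(* The operator-valued matrix [cr_mx] stands for moving a fixed vector space
   with basis [J] past [X]: [cr_mx x x'] is the component from [x] to [x'], so
   that the intertwiners below are the maps for which this is natural. *)
Record corep (J : finType) := Corep {
  cr_mx : forall X, basis X -> basis X -> fmx J K;
  cr_unit : forall x y : basis EUnit, cr_mx x y = 1;
  cr_tens : forall X Y (p p' : basis (ETens X Y)),
    cr_mx p p' = cr_mx p.1 p'.1 * cr_mx p.2 p'.2;
  cr_inl : forall X Y (x x' : basis X),
    cr_mx (inl x : basis (ESum X Y)) (inl x' : basis (ESum X Y)) = cr_mx x x';
  cr_inr : forall X Y (y y' : basis Y),
    cr_mx (inr y : basis (ESum X Y)) (inr y' : basis (ESum X Y)) = cr_mx y y';
  cr_inlr : forall X Y (x : basis X) (y : basis Y),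
    cr_mx (inl x : basis (ESum X Y)) (inr y : basis (ESum X Y)) = 0;
  cr_inrl : forall X Y (x : basis X) (y : basis Y),
    cr_mx (inr y : basis (ESum X Y)) (inl x : basis (ESum X Y)) = 0
}.

Arguments cr_mx : simpl never.

Variables (J : finType) (c : corep J).
Local Notation t := (cr_mx c).

Definition intertwiner X Y (f : 'Hom(sp X, sp Y)) : Prop :=
  forall x y', \sum_y mc f x y *: t y y' = \sum_x' mc f x' y' *: t x x'.

Lemma intertwiner_id X : intertwiner (\1%VF : 'End(sp X)).
Proof.
move=> x y; under eq_bigr => z _ do rewrite mc_id eq_sym.
under [RHS]eq_bigr => z _ do rewrite mc_id.
by rewrite !sum_delta_scale.
Qed.

Lemma intertwiner_comp X Y Z (f : 'Hom(sp Y, sp Z)) (g : 'Hom(sp X, sp Y)) :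
  intertwiner f -> intertwiner g -> intertwiner (f \o g)%VF.
Proof.
move=> If Ig x z'.
under eq_bigr => z _ do rewrite mc_comp scaler_suml.
rewrite exchange_big /=.
under eq_bigr => y _ do (under eq_bigr => z _ do rewrite -scalerA).
under eq_bigr => y _ do rewrite -scaler_sumr If scaler_sumr.
rewrite exchange_big /=.
under eq_bigr => y _ do (under eq_bigr => z _ do rewrite scalerA mulrC -scalerA).
under eq_bigr => y _ do rewrite -scaler_sumr Ig scaler_sumr.
rewrite exchange_big /=; apply: eq_bigr => x' _.
rewrite mc_comp scaler_suml; apply: eq_bigr => y _.
by rewrite scalerA mulrC.
Qed.

Lemma intertwiner_lin X Y k (f g : 'Hom(sp X, sp Y)) :
  intertwiner f -> intertwiner g -> intertwiner (k *: f + g).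
Proof.
move=> If Ig x y'.
under eq_bigr => y _ do rewrite mc_lin scalerDl -scalerA.
under [RHS]eq_bigr => y _ do rewrite mc_lin scalerDl -scalerA.
by rewrite !big_split /= -!scaler_sumr If Ig.
Qed.

Lemma intertwiner0 X Y : intertwiner (0 : 'Hom(sp X, sp Y)).
Proof.
by move=> x y'; rewrite !big1 // => z _; rewrite /mc zero_lfunE ffunE scale0r.
Qed.

Lemma intertwinerZ X Y k (f : 'Hom(sp X, sp Y)) :
  intertwiner f -> intertwiner (k *: f).
Proof.
by move=> If; rewrite -[_ *: _]addr0; apply: intertwiner_lin => //;
  apply: intertwiner0.
Qed.

Lemma intertwinerB X Y (f g : 'Hom(sp X, sp Y)) :
  intertwiner f -> intertwiner g -> intertwiner (f - g).
Proof.
by move=> If Ig; rewrite addrC -scaleN1r; apply: intertwiner_lin.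
Qed.

Lemma intertwiner_tens X X' Y Y' (f : 'Hom(sp X, sp Y))
    (g : 'Hom(sp X', sp Y')) :
  intertwiner f -> intertwiner g -> intertwiner (tmap f g).
Proof.
move=> If Ig [x x'] [y y'].
have E (A B : finType) (F : A -> K) (G : B -> K) (a : A -> fmx J K)
    (b : B -> fmx J K) :
    \sum_(p : A * B) (F p.1 * G p.2) *: (a p.1 * b p.2)
    = (\sum_i F i *: a i) * (\sum_i G i *: b i).
  rewrite sum_prod mulr_suml; apply: eq_bigr => i _.
  rewrite mulr_sumr; apply: eq_bigr => j _.
  by rewrite -fmx_scaleAl -fmx_scaleAr scalerA.
under eq_bigr => p _ do rewrite mc_tmap cr_tens.
under [RHS]eq_bigr => p _ do rewrite mc_tmap cr_tens.
rewrite (E _ _ (mc f x) (mc g x') (fun i => t i y) (fun i => t i y')).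
rewrite (E _ _ (fun i => mc f i y) (fun i => mc g i y') (t x) (t x')).
by rewrite If Ig.
Qed.

Lemma intertwiner_relabel X Y (h : basis X -> basis Y) (g : basis Y -> basis X) :
  cancel h g -> cancel g h -> (forall x x', t (h x) (h x') = t x x') ->
  intertwiner (lmap (fun x => bvec K (h x))).
Proof.
move=> hK gK th x y'.
under eq_bigr => y _ do rewrite mc_lmap bvecE.
under [RHS]eq_bigr => x' _ do rewrite mc_lmap bvecE eq_sym (can2_eq hK gK).
by rewrite !sum_delta_scale -{1}[y']gK th.
Qed.

Lemma intertwiner_inj1 X Y : intertwiner (inj1 K N X Y).
Proof.
move=> x y'; under eq_bigr => y _ do rewrite mc_lmap bvecE.
rewrite sum_delta_scale; case: y' => [x'|y'].
  under eq_bigr => y _ do rewrite mc_lmap bvecE (inj_eq inl_inj) eq_sym.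
  by rewrite sum_delta_scale cr_inl.
by rewrite cr_inlr big1 // => y _; rewrite mc_lmap bvecE scale0r.
Qed.

Lemma intertwiner_inj2 X Y : intertwiner (inj2 K N X Y).
Proof.
move=> x y'; under eq_bigr => y _ do rewrite mc_lmap bvecE.
rewrite sum_delta_scale; case: y' => [x'|y'].
  by rewrite cr_inrl big1 // => y _; rewrite mc_lmap bvecE scale0r.
under eq_bigr => y _ do rewrite mc_lmap bvecE (inj_eq inr_inj) eq_sym.
by rewrite sum_delta_scale cr_inr.
Qed.

Lemma intertwiner_prj1 X Y : intertwiner (prj1 K N X Y).
Proof.
move=> x y'; rewrite [RHS]big_sumType /= [X in _ = _ + X]big1 ?addr0; last first.
  by move=> y _; rewrite mc_lmap ffunE scale0r.
under [RHS]eq_bigr => x' _ do rewrite mc_lmap bvecE eq_sym.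
rewrite sum_delta_scale; case: x => [x|y].
  under eq_bigr => y _ do rewrite mc_lmap bvecE.
  by rewrite sum_delta_scale cr_inl.
by rewrite cr_inrl big1 // => x _; rewrite mc_lmap ffunE scale0r.
Qed.

Lemma intertwiner_prj2 X Y : intertwiner (prj2 K N X Y).
Proof.
move=> x y'; rewrite [RHS]big_sumType /= [X in _ = X + _]big1 ?add0r; last first.
  by move=> y _; rewrite mc_lmap ffunE scale0r.
under [RHS]eq_bigr => x' _ do rewrite mc_lmap bvecE eq_sym.
rewrite sum_delta_scale; case: x => [x|y].
  by rewrite cr_inlr big1 // => y _; rewrite mc_lmap ffunE scale0r.
under eq_bigr => z _ do rewrite mc_lmap bvecE.
by rewrite sum_delta_scale cr_inr.
Qed.

Lemma intertwiner_assoc X Y Z : intertwiner (assoc K N X Y Z).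
Proof.
apply: (intertwiner_relabel (X := ETens (ETens X Y) Z) (Y := ETens X (ETens Y Z))
  (h := fun p => (p.1.1, (p.1.2, p.2))) (g := fun p => ((p.1, p.2.1), p.2.2))).
- by case=> -[].
- by case=> ? [].
- by move=> [[x y] z] [[x' y'] z']; rewrite !cr_tens mulrA.
Qed.

Lemma intertwiner_assocV X Y Z : intertwiner (assocV K N X Y Z).
Proof.
apply: (intertwiner_relabel (X := ETens X (ETens Y Z)) (Y := ETens (ETens X Y) Z)
  (h := fun p => ((p.1, p.2.1), p.2.2)) (g := fun p => (p.1.1, (p.1.2, p.2)))).
- by case=> ? [].
- by case=> -[].
- by move=> [x [y z]] [x' [y' z']]; rewrite !cr_tens mulrA.
Qed.

Lemma intertwiner_lunit X : intertwiner (lunit K N X).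
Proof.
apply: (intertwiner_relabel (X := ETens EUnit X) (Y := X)
  (h := fun p => p.2) (g := fun x => (tt, x))) => //; first by case=> -[].
by move=> [u x] [u' x']; rewrite !cr_tens cr_unit mul1r.
Qed.

Lemma intertwiner_lunitV X : intertwiner (lunitV K N X).
Proof.
apply: (intertwiner_relabel (X := X) (Y := ETens EUnit X)
  (h := fun x => (tt, x)) (g := fun p => p.2)) => //; first by case=> -[].
by move=> x x'; rewrite !cr_tens cr_unit mul1r.
Qed.

Lemma intertwiner_runit X : intertwiner (runit K N X).
Proof.
apply: (intertwiner_relabel (X := ETens X EUnit) (Y := X)
  (h := fun p => p.1) (g := fun x => (x, tt))) => //; first by case=> ? [].
by move=> [x u] [x' u']; rewrite !cr_tens cr_unit mulr1.
Qed.

Lemma intertwiner_runitV X : intertwiner (runitV K N X).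
Proof.
apply: (intertwiner_relabel (X := X) (Y := ETens X EUnit)
  (h := fun x => (x, tt)) (g := fun p => p.1)) => //; first by case=> ? [].
by move=> x x'; rewrite !cr_tens cr_unit mulr1.
Qed.

(** Meant for the inverse of the braiding of V^* past V, which occurs in the quadratic relations of
    L(R_q,1) without being one of the generating maps. *)
Lemma intertwiner_inv X Y (f : 'Hom(sp X, sp Y)) (g : 'Hom(sp Y, sp X)) :
  (f \o g)%VF = \1%VF -> (g \o f)%VF = \1%VF -> intertwiner f -> intertwiner g.
Proof.
move=> fg gf If y x'.
have gfE x z : \sum_w mc f x w * mc g w z = (x == z)%:R.
  by rewrite -mc_comp gf mc_id.
have fgE x z : \sum_w mc g x w * mc f w z = (x == z)%:R.
  by rewrite -mc_comp fg mc_id.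
transitivity (\sum_x mc g y x *: \sum_w mc g w x' *: \sum_z mc f z w *: t x z).
  apply: eq_bigr => x _; congr (_ *: _).
  rewrite -[LHS](sum_delta_scale (K := K) (fun z => t x z)).
  under eq_bigr => z _ do rewrite -gfE scaler_suml.
  rewrite exchange_big /=; apply: eq_bigr => w _.
  by rewrite scaler_sumr; apply: eq_bigr => z _; rewrite scalerA mulrC.
transitivity (\sum_x \sum_w (mc g y x * mc g w x') *: \sum_z mc f x z *: t z w).
  apply: eq_bigr => x _; rewrite scaler_sumr; apply: eq_bigr => w _.
  by rewrite scalerA If.
rewrite exchange_big /=; apply: eq_bigr => w _.
rewrite -[t y w](sum_delta_scale (K := K) (fun z => t z w)) scaler_sumr.
under [LHS]eq_bigr => x _ do rewrite scaler_sumr.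
rewrite exchange_big /=; apply: eq_bigr => z _.
rewrite [z == y]eq_sym -fgE scaler_suml scaler_sumr.
by apply: eq_bigr => x _; rewrite !scalerA; congr (_ *: _); ring.
Qed.

Local Notation braid X Y := (@braid K N R Rinv Psi X Y).
Local Notation braiding := (braiding R Rinv Psi).

Lemma mc_braiding X Y p p' :
  mc (braiding X Y) p p' = braid X Y p.1 p.2 p'.1 p'.2.
Proof. by rewrite mc_lmap ffunE. Qed.

Lemma braiding_bvec X Y x y p :
  braiding X Y (bvec K ((x, y) : basis (ETens X Y))) p = braid X Y x y p.1 p.2.
Proof. exact: (mc_braiding (X := X) (Y := Y) (x, y) p). Qed.

(** The recursion defining [braid], read as a composite of simpler maps. With its analogues for sums
    and for a letter passing a composite object, it reduces the naturality of all braidings to pairs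
    of letters. *)
Lemma braiding_tensl X1 X2 Y :
  braiding (ETens X1 X2) Y
  = (assoc K N Y X1 X2 \o tmap (braiding X1 Y) \1%VF \o assocV K N X1 Y X2
     \o tmap \1%VF (braiding X2 Y) \o assoc K N X1 X2 Y)%VF.
Proof.
apply: mcP => -[[x1 x2] y] [y' [x1' x2']]; rewrite mc_braiding /= /mc.
rewrite !comp_lfunE assoc_bvec tmap_bvec id_lfunE assocE mc_app sum_prod sum_prod.
rewrite (bigD1 x1) //= [X in _ + X]big1 ?addr0; last first.
  move=> a /negPf ax; rewrite big1 // => z _; rewrite big1 // => b _.
  by rewrite assocVE tvecE bvecE ax !mul0r.
apply: eq_bigr => z _.
rewrite -[LHS](sum_delta_r (fun b => braid X2 Y x2 y z b * braid X1 Y x1 z y' x1')).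
apply: eq_bigr => b _.
rewrite assocVE tvecE bvecE eqxx mul1r braiding_bvec mc_tmap mc_braiding mc_id.
by rewrite mulrA.
Qed.

Local Notation letter c := (if c then EVd else EV).

Lemma braiding_letter_tensr d Y1 Y2 :
  braiding (letter d) (ETens Y1 Y2)
  = (assocV K N Y1 Y2 (letter d) \o tmap \1%VF (braiding (letter d) Y2)
     \o assoc K N Y1 (letter d) Y2 \o tmap (braiding (letter d) Y1) \1%VF
     \o assocV K N (letter d) Y1 Y2)%VF.
Proof.
apply: mcP => -[i [y1 y2]] [[y1' y2'] i'].
(* [braid] reduces only once [d] is known. *)
have -> : mc (braiding (letter d) (ETens Y1 Y2)) (i, (y1, y2)) (y1', y2', i')
    = \sum_j braid (letter d) Y1 i y1 y1' j * braid (letter d) Y2 j y2 y2' i'.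
  by rewrite mc_braiding; case: d i i' => i i'.
rewrite /mc !comp_lfunE assocV_bvec tmap_bvec id_lfunE assocVE mc_app sum_prod.
rewrite (bigD1 y1') //= [X in _ + X]big1 ?addr0; last first.
  move=> a /negPf ax; rewrite sum_prod big1 // => z _; rewrite big1 // => b _.
  by rewrite mc_tmap mc_id ax mul0r mulr0.
rewrite sum_prod; apply: eq_bigr => j _; rewrite (bigD1 y2) //=.
rewrite [X in _ + X]big1 ?addr0; last first.
  by move=> b /negPf by2; rewrite assocE tvecE bvecE by2 mulr0 mul0r.
rewrite assocE tvecE bvecE eqxx mulr1 braiding_bvec mc_tmap mc_id eqxx mul1r.
by rewrite mc_braiding.
Qed.

Lemma tvec0l X Y (v : sp Y) : tvec (0 : sp X) v = 0.
Proof. by apply/ffunP => -[x y]; rewrite tvecE !ffunE mul0r. Qed.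

Lemma tvec0r X Y (u : sp X) : tvec u (0 : sp Y) = 0.
Proof. by apply/ffunP => -[x y]; rewrite tvecE !ffunE mulr0. Qed.

Lemma prj1_bvec X Y p :
  prj1 K N X Y (bvec K p) = if p is inl x then bvec K x else 0.
Proof. exact: lmap_bvec. Qed.

Lemma prj2_bvec X Y p :
  prj2 K N X Y (bvec K p) = if p is inr y then bvec K y else 0.
Proof. exact: lmap_bvec. Qed.

Lemma inj1E X Y u p : inj1 K N X Y u p = if p is inl x then u x else 0.
Proof.
rewrite mc_app; under eq_bigr => x _ do rewrite mc_lmap bvecE.
case: p => [x|y]; last by rewrite big1 // => x _; rewrite mulr0.
rewrite -[RHS](sum_delta_r (fun x => u x : K)); apply: eq_bigr => z _.
by rewrite (inj_eq inl_inj) eq_sym.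
Qed.

Lemma inj2E X Y u p : inj2 K N X Y u p = if p is inr y then u y else 0.
Proof.
rewrite mc_app; under eq_bigr => y _ do rewrite mc_lmap bvecE.
case: p => [x|y]; first by rewrite big1 // => y _; rewrite mulr0.
rewrite -[RHS](sum_delta_r (fun x => u x : K)); apply: eq_bigr => z _.
by rewrite (inj_eq inr_inj) eq_sym.
Qed.

Lemma tmap_1_app X Y Z (f : 'Hom(sp Y, sp Z)) u x z :
  tmap (\1%VF : 'End(sp X)) f u (x, z) = f [ffun y => u (x, y)] z.
Proof.
rewrite !mc_app sum_prod (bigD1 x) //= [X in _ + X]big1 ?addr0.
  by apply: eq_bigr => y _; rewrite mc_tmap mc_id eqxx mul1r ffunE.
by move=> a /negPf ax; rewrite big1 // => y _; rewrite mc_tmap mc_id ax mul0r mulr0.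
Qed.

Lemma tmap_app_1 X Y Z (f : 'Hom(sp Y, sp Z)) u x z :
  tmap f (\1%VF : 'End(sp X)) u (z, x) = f [ffun y => u (y, x)] z.
Proof.
rewrite !mc_app sum_prod; apply: eq_bigr => y _.
rewrite (bigD1 x) //= [X in _ + X]big1 ?addr0.
  by rewrite mc_tmap mc_id eqxx mulr1 ffunE.
by move=> a /negPf ax; rewrite mc_tmap mc_id ax !mulr0.
Qed.

Lemma braiding_suml X1 X2 Y :
  braiding (ESum X1 X2) Y
  = ((tmap \1 (inj1 K N X1 X2) \o braiding X1 Y \o tmap (prj1 K N X1 X2) \1)
     + (tmap \1 (inj2 K N X1 X2) \o braiding X2 Y \o tmap (prj2 K N X1 X2) \1))%VF.
Proof.
apply: lfun_bvecP => -[x y]; apply/ffunP => -[y' x'].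
rewrite braiding_bvec add_lfunE !comp_lfunE !tmap_bvec !id_lfunE ffunE.
rewrite !tmap_1_app inj1E inj2E prj1_bvec prj2_bvec.
by case: x => x; rewrite !tvec_bvec tvec0l linear0; case: x' => x';
  rewrite ?ffunE ?braiding_bvec ?addr0 ?add0r.
Qed.

Lemma braiding_letter_sumr d Y1 Y2 :
  braiding (letter d) (ESum Y1 Y2)
  = ((tmap (inj1 K N Y1 Y2) \1 \o braiding (letter d) Y1
       \o tmap \1 (prj1 K N Y1 Y2))
     + (tmap (inj2 K N Y1 Y2) \1 \o braiding (letter d) Y2
       \o tmap \1 (prj2 K N Y1 Y2)))%VF.
Proof.
apply: lfun_bvecP => -[i y]; apply/ffunP => -[y' i'].
rewrite braiding_bvec add_lfunE !comp_lfunE !tmap_bvec !id_lfunE ffunE.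
rewrite !tmap_app_1 inj1E inj2E prj1_bvec prj2_bvec.
have -> : braid (letter d) (ESum Y1 Y2) i y y' i' =
    match y, y' with
    | inl y1, inl y1' => braid (letter d) Y1 i y1 y1' i'
    | inr y2, inr y2' => braid (letter d) Y2 i y2 y2' i'
    | _, _ => 0
    end by case: d i i' => i i'.
by case: y => y; rewrite !tvec_bvec tvec0r linear0; case: y' => y';
  rewrite ?ffunE ?braiding_bvec ?addr0 ?add0r.
Qed.

Hypothesis letters : forall d e : bool,
  intertwiner (braiding (letter d) (letter e)).

Lemma intertwiner_braiding_letter d Y : intertwiner (braiding (letter d) Y).
Proof.
elim: Y => [|||Y1 I1 Y2 I2|Y1 I1 Y2 I2].
- have -> : braiding (letter d) EUnit = (lunitV K N _ \o runit K N _)%VF.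
    apply: mcP => -[i []] [[] i']; rewrite /mc comp_lfunE !lmap_bvec ffunE bvecE /=.
    by case: d i i' => i i' /=; rewrite xpair_eqE /= eq_sym.
  by apply: intertwiner_comp; [exact: intertwiner_lunitV|exact: intertwiner_runit].
- exact: (@letters d false).
- exact: (@letters d true).
- rewrite braiding_letter_tensr.
  by do ![apply: intertwiner_comp]; do ?[apply: intertwiner_tens];
    do ?[exact: intertwiner_assoc|exact: intertwiner_assocV|exact: intertwiner_id].
- have sumE := intertwiner_lin 1; rewrite braiding_letter_sumr -[X in X + _]scale1r.
  by apply: sumE; do ![apply: intertwiner_comp]; do ?[apply: intertwiner_tens];
    do ?[exact: intertwiner_inj1|exact: intertwiner_inj2|exact: intertwiner_prj1
        |exact: intertwiner_prj2|exact: intertwiner_id].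
Qed.

Lemma intertwiner_braiding X Y : intertwiner (braiding X Y).
Proof.
elim: X => [|||X1 I1 X2 I2|X1 I1 X2 I2].
- have -> : braiding EUnit Y = (runitV K N _ \o lunit K N _)%VF.
    apply: mcP => -[[] y] [y' []]; rewrite /mc comp_lfunE !lmap_bvec ffunE bvecE /=.
    by rewrite xpair_eqE /= andbT eq_sym.
  by apply: intertwiner_comp; [exact: intertwiner_runitV|exact: intertwiner_lunit].
- exact: (@intertwiner_braiding_letter false).
- exact: (@intertwiner_braiding_letter true).
- rewrite braiding_tensl.
  by do ![apply: intertwiner_comp]; do ?[apply: intertwiner_tens];
    do ?[exact: intertwiner_assoc|exact: intertwiner_assocV|exact: intertwiner_id].
- have sumE := intertwiner_lin 1; rewrite braiding_suml -[X in X + _]scale1r.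
  by apply: sumE; do ![apply: intertwiner_comp]; do ?[apply: intertwiner_tens];
    do ?[exact: intertwiner_inj1|exact: intertwiner_inj2|exact: intertwiner_prj1
        |exact: intertwiner_prj2|exact: intertwiner_id].
Qed.

Lemma mc_pair_r p u : mc (pair_r K N) p u = (p.1 == p.2)%:R.
Proof. by rewrite mc_lmap ffunE. Qed.

Lemma mc_pi_r u p : mc (pi_r K N) u p = (p.1 == p.2)%:R.
Proof. by rewrite mc_lmap ffunE. Qed.

(** B is a partial trace of Psi, which is the braiding of V^* past V. Since C is the other partial
    trace, the copairing [pi_l] is treated in the same way, and naturality has to be checked only
    for the right pairing and copairing. *)
Lemma pair_l_braiding :
  pair_l Psi = (pair_r K N \o braiding EVd EV)%VF.
Proof.
apply: mcP => -[i j] []; rewrite mc_comp sum_prod mc_lmap ffunE.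
apply: eq_bigr => k _; rewrite (bigD1 k) //= mc_braiding mc_pair_r eqxx mulr1.
rewrite big1 ?addr0 // => l /negPf lk.
by rewrite mc_pair_r eq_sym lk mulr0.
Qed.

Lemma pi_l_braiding :
  pi_l m n q Psi
  = q ^ (2%:Z * (m%:Z - n%:Z)) *: (braiding EVd EV \o pi_r K N)%VF.
Proof.
apply: mcP => -[] [k l]; rewrite mc_lmap ffunE /mc scale_lfunE ffunE.
rewrite -/(mc _ _ _) mc_comp sum_prod; congr (_ * _).
apply: eq_bigr => i _; rewrite (bigD1 i) //= mc_pi_r eqxx mul1r.
rewrite mc_braiding big1 ?addr0 // => j /negPf ji.
by rewrite mc_pi_r eq_sym ji mul0r.
Qed.

Hypothesis pair_r_int : intertwiner (pair_r K N).
Hypothesis pi_r_int : intertwiner (pi_r K N).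

Lemma intertwiner_generated X Y (f : 'Hom(sp X, sp Y)) :
  generated m n q R Rinv Psi f -> intertwiner f.
Proof.
elim=> {X Y f}.
- exact: intertwiner_id.
- exact: intertwiner_braiding.
- exact: pair_r_int.
- rewrite pair_l_braiding.
  by apply: intertwiner_comp; [exact: pair_r_int|exact: intertwiner_braiding].
- exact: pi_r_int.
- rewrite pi_l_braiding; apply: intertwinerZ.
  by apply: intertwiner_comp; [exact: intertwiner_braiding|exact: pi_r_int].
- exact: intertwiner_assoc.
- exact: intertwiner_assocV.
- exact: intertwiner_lunit.
- exact: intertwiner_lunitV.
- exact: intertwiner_runit.
- exact: intertwiner_runitV.
- exact: intertwiner_inj1.
- exact: intertwiner_inj2.
- exact: intertwiner_prj1.
- exact: intertwiner_prj2.
- exact: intertwiner0.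
- by move=> X Y k f g _ If _ Ig; apply: intertwiner_lin.
- by move=> X Y Z f g _ If _ Ig; apply: intertwiner_comp.
- by move=> X X' Y Y' f g _ If _ Ig; apply: intertwiner_tens.
Qed.

End Corepresentations.

Arguments cr_mx : simpl never.

(** * ** Naturality in the object that is passed: moving a letter past a morphism *)

Section LetterCorepresentation.
Variables (K : fieldType) (N m n : nat) (q : K) (R Rinv Psi : tensor4 K N).
Hypothesis hR : hecke_symmetry q m n R Rinv Psi.

Local Notation basis := (basis N).
Local Notation sp := (sp K N).
Local Notation braiding := (braiding R Rinv Psi).
Local Notation letter c := (if c then EVd else EV).
Local Notation E := (ext_braid R Rinv Psi).

Definition letter_mx (d : bool) Y (y y' : basis Y) : fmx 'I_N K :=
  [ffun p => @braid_letter K N R Rinv Psi d Y p.1 y y' p.2].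

Lemma letter_mxE d Y y y' i i' :
  @letter_mx d Y y y' (i, i') = @braid_letter K N R Rinv Psi d Y i y y' i'.
Proof. by rewrite ffunE. Qed.

Definition letter_corep (d : bool) : corep K N 'I_N.
Proof.
exists (@letter_mx d).
- by move=> [] []; apply/ffunP => -[i j]; rewrite !ffunE.
- move=> X Y p p'; apply/ffunP => -[i j]; rewrite ffunE fmxM.
  by apply: eq_bigr => k _; rewrite !ffunE.
- by move=> X Y x x'; apply/ffunP => -[i j]; rewrite !ffunE.
- by move=> X Y x x'; apply/ffunP => -[i j]; rewrite !ffunE.
- by move=> X Y x x'; apply/ffunP => -[i j]; rewrite !ffunE.
- by move=> X Y x x'; apply/ffunP => -[i j]; rewrite !ffunE.
Defined.

Lemma ext_braid_triangle b c d j k k' j' i i' :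
  \sum_(p : 'I_N * 'I_N) E c d j k p.1 p.2
      * \sum_a E b d i p.1 k' a * E b c a p.2 j' i'
  = \sum_(p : 'I_N * 'I_N) E c d p.1 p.2 k' j'
      * \sum_a E b c i j p.1 a * E b d a k p.2 i'.
Proof.
have /ybP/(_ i j k k' j' i') := yb_letters hR b c d.
rewrite /triangle_down /triangle_up !sum_prod => down_up.
transitivity (\sum_x \sum_y \sum_z E c d j k x y * E b d i x k' z * E b c z y j' i').
  do 2![apply: eq_bigr => ? _]; rewrite mulr_sumr.
  by apply: eq_bigr => ? _; rewrite mulrA.
rewrite down_up; apply: eq_bigr => x _; rewrite exchange_big /=.
apply: eq_bigr => y _; rewrite mulr_sumr; apply: eq_bigr => z _.
by rewrite mulrC.
Qed.

Lemma letters_intertwiner b c d :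
  intertwiner (letter_corep b) (braiding (letter c) (letter d)).
Proof.
by case: c; case: d => -[j k] [k' j']; apply/ffunP => -[i i'];
  rewrite !fmx_sumE;
  [have := ext_braid_triangle b true true j k k' j' i i'
  |have := ext_braid_triangle b true false j k k' j' i i'
  |have := ext_braid_triangle b false true j k k' j' i i'
  |have := ext_braid_triangle b false false j k k' j' i i'];
  move=> tri; (etransitivity; last (etransitivity; first exact: tri));
  apply: eq_bigr => -[x y] _; rewrite mc_braiding fmxZ !cr_tens fmxM;
  congr (_ * _); apply: eq_bigr => z _; rewrite !ffunE.
Qed.

(** A letter V passes V (x) V^* by R and then R^-1, which cancel; a letter V^* passes it by Psi and
    then R, which cancel by skew-invertibility. The same holds for V^* (x) V and the copairing, with
    the two inverse relations on the other side. *)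
Lemma pair_r_contract b i j k l :
  \sum_(p : 'I_N) \sum_(a : 'I_N) E b false i j p a * E b true a k p l
  = (j == k)%:R * (i == l)%:R.
Proof.
case: b; last first.
  have := R_Rinv hR i j l k.
  by rewrite mulrC => <-.
have := skew_l hR i j l k.
rewrite mulrC => <-; do 2![apply: eq_bigr => ? _].
by rewrite /opposite_skew.
Qed.

Lemma pi_r_contract b i j k l :
  \sum_(p : 'I_N) \sum_(a : 'I_N) E b true i p j a * E b false a p k l
  = (j == k)%:R * (i == l)%:R.
Proof.
case: b.
  have := skew_r hR j i k l => <-.
  rewrite exchange_big /=.
  by do 2![apply: eq_bigr => ? _].
have := Rinv_R hR j i k l => <-.
by rewrite exchange_big /=; do 2![apply: eq_bigr => ? _].
Qed.

Lemma pair_r_intertwiner b : intertwiner (letter_corep b) (pair_r K N).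
Proof.
move=> [j k] []; apply/ffunP => -[i i']; rewrite !fmx_sumE.
rewrite (bigD1 tt) //= [X in _ + X]big1 ?addr0; last by case.
rewrite fmxZ mc_pair_r cr_unit !ffunE /= -(pair_r_contract b) sum_prod.
apply: esym.
apply: eq_bigr => p _; rewrite (bigD1 p) //= [X in _ + X]big1 ?addr0.
  rewrite fmxZ mc_pair_r eqxx mul1r cr_tens fmxM.
  by apply: eq_bigr => a _; rewrite !ffunE.
by move=> a /negPf ap; rewrite fmxZ mc_pair_r /= eq_sym ap mul0r.
Qed.

Lemma pi_r_intertwiner b : intertwiner (letter_corep b) (pi_r K N).
Proof.
move=> [] [j k]; apply/ffunP => -[i i']; rewrite !fmx_sumE.
rewrite [RHS](bigD1 tt) //= [X in _ = _ + X]big1 ?addr0; last by case.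
rewrite fmxZ mc_pi_r cr_unit !ffunE /= -(pi_r_contract b) sum_prod.
apply: eq_bigr => p _; rewrite (bigD1 p) //= [X in _ + X]big1 ?addr0.
  rewrite fmxZ mc_pi_r eqxx mul1r cr_tens fmxM.
  by apply: eq_bigr => a _; rewrite !ffunE.
by move=> a /negPf ap; rewrite fmxZ mc_pi_r /= eq_sym ap mul0r.
Qed.

Lemma letter_natural b X Y (f : 'Hom(sp X, sp Y)) :
  generated m n q R Rinv Psi f -> intertwiner (letter_corep b) f.
Proof.
move=> gf; apply: (intertwiner_generated _ _ _ gf).
- exact: letters_intertwiner.
- exact: pair_r_intertwiner.
- exact: pi_r_intertwiner.
Qed.

End LetterCorepresentation.

(** * ** Naturality in the object that moves *)

Section BraidPast.
Variables (K : fieldType) (N m n : nat) (q : K) (R Rinv Psi : tensor4 K N).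
Hypothesis hR : hecke_symmetry q m n R Rinv Psi.
Variable Y : expr.

Local Notation basis := (basis N).
Local Notation sp := (sp K N).
Local Notation braid X Y := (@braid K N R Rinv Psi X Y).
Local Notation braiding := (braiding R Rinv Psi).
Local Notation letter c := (if c then EVd else EV).

(* The row index is the outgoing one, which turns the order of composition
   around, as needed for multiplicativity in [X]. *)
Definition past_mx X (x x' : basis X) : fmx (basis Y) K :=
  [ffun p => braid X Y x p.2 p.1 x'].

Definition past_corep : corep K N (basis Y).
Proof.
exists past_mx.
- by move=> [] []; apply/ffunP => -[y' y]; rewrite !ffunE eq_sym.
- move=> X1 X2 p p'; apply/ffunP => -[y' y]; rewrite ffunE fmxM.
  by apply: eq_bigr => z _; rewrite !ffunE mulrC.
- by move=> X1 X2 x x'; apply/ffunP => -[i j]; rewrite !ffunE.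
- by move=> X1 X2 x x'; apply/ffunP => -[i j]; rewrite !ffunE.
- by move=> X1 X2 x x'; apply/ffunP => -[i j]; rewrite !ffunE.
- by move=> X1 X2 x x'; apply/ffunP => -[i j]; rewrite !ffunE.
Defined.

(** The Yang-Baxter equation for two letters [e], [d] and an object Y. It is obtained as naturality,
    for the letter [e], of the braiding of [d] past Y; in coordinates it can be read again as
    naturality, under moving past Y, of the braiding of [e] with [d]. *)
Lemma letter_natural_coef e d j j' k y y' k' :
  \sum_z \sum_a braid (letter d) Y k y z a
     * \sum_b @braid_letter K N R Rinv Psi e Y j z y' b
         * @braid_letter K N R Rinv Psi e (letter d) b a k' j'
  = \sum_a \sum_z braid (letter d) Y a z y' k'
     * \sum_b @braid_letter K N R Rinv Psi e (letter d) j k a b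
         * @braid_letter K N R Rinv Psi e Y b y z j'.
Proof.
have nat_Y : intertwiner (letter_corep R Rinv Psi e) (braiding (letter d) Y).
  by apply: (letter_natural hR); apply: Gen_braiding.
have := congr1 (fun M : fmx 'I_N K => M (j, j')) (nat_Y (k, y) (y', k')).
rewrite /= !fmx_sumE !sum_prod => nat_jj.
etransitivity; last (etransitivity; first exact: nat_jj);
  apply: eq_bigr => a _; apply: eq_bigr => b _;
  rewrite fmxZ mc_braiding cr_tens fmxM; congr (_ * _);
  by apply: eq_bigr => z _; rewrite !letter_mxE.
Qed.

Lemma past_letters c d :
  intertwiner past_corep (braiding (letter c) (letter d)).
Proof.
by case: c; case: d => -[j k] [k' j']; apply/ffunP => -[y' y];
  [have := @letter_natural_coef true true j j' k y y' k'
  |have := @letter_natural_coef true false j j' k y y' k'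
  |have := @letter_natural_coef false true j j' k y y' k'
  |have := @letter_natural_coef false false j j' k y y' k'];
  rewrite !fmx_sumE !sum_prod => nat_jj;
  (etransitivity; last (etransitivity; first exact: (esym nat_jj));
  [ apply: eq_bigr => a _; under [RHS]eq_bigr => z _ do rewrite mulr_sumr;
    rewrite [RHS]exchange_big; apply: eq_bigr => x _;
    rewrite fmxZ mc_braiding cr_tens fmxM mulr_sumr; apply: eq_bigr => z _;
    rewrite /cr_mx /= !ffunE /=; ring
  | under eq_bigr => z _ do (under eq_bigr => a _ do rewrite mulr_sumr);
    under eq_bigr => z _ do rewrite exchange_big;
    rewrite exchange_big; apply: eq_bigr => b _;
    rewrite exchange_big; apply: eq_bigr => a _;
    rewrite fmxZ mc_braiding cr_tens fmxM mulr_sumr; apply: eq_bigr => z _;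
    rewrite /cr_mx /= !ffunE /=; ring]).
Qed.

(** The inverse of the braiding of V^* past V. Its coefficients are those of R, which is how the
    factor R in the middle of L_1 R L_1 becomes a map between objects. *)
Definition unbraid : 'Hom(sp (ETens EV EVd), sp (ETens EVd EV)) :=
  lmap (fun p : basis (ETens EV EVd) =>
    [ffun p' : basis (ETens EVd EV) => opposite_skew R p.1 p.2 p'.1 p'.2]
      : sp (ETens EVd EV)).

Lemma mc_unbraid p p' : mc unbraid p p' = opposite_skew R p.1 p.2 p'.1 p'.2.
Proof. by rewrite mc_lmap ffunE. Qed.

Lemma past_unbraid : intertwiner past_corep unbraid.
Proof.
apply: (intertwiner_inv (f := braiding EVd EV) _ _ (@past_letters true false)).
  apply: mcP => -[i j] [k l]; rewrite mc_comp sum_prod mc_id xpair_eqE -mulnb natrM.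
  rewrite -(skew_r hR); do 2![apply: eq_bigr => ? _].
  by rewrite mc_unbraid mc_braiding.
apply: mcP => -[i j] [k l]; rewrite mc_comp sum_prod mc_id xpair_eqE -mulnb natrM.
rewrite -(skew_l hR); do 2![apply: eq_bigr => ? _].
by rewrite mc_unbraid mc_braiding.
Qed.

End BraidPast.

Section PairPast.
Variables (K : fieldType) (N m n : nat) (q : K) (R Rinv Psi : tensor4 K N).
Hypothesis hR : hecke_symmetry q m n R Rinv Psi.

Local Notation braid X Y := (@braid K N R Rinv Psi X Y).

(** Induction on the object that is passed. For Y = V this is skew-invertibility, for the dual of V
    it is R^-1 R = 1. *)
Lemma pair_r_past_coef Y j k y y' :
  \sum_(z : basis N Y) \sum_i braid EVd Y k y z i * braid EV Y j z y' i
  = (j == k)%:R * (y == y')%:R.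
Proof.
elim: Y j k y y' => [|||Y1 I1 Y2 I2|Y1 I1 Y2 I2] j k y y'.
- rewrite (bigD1 tt) //= [X in _ + X]big1 ?addr0; last by case.
  by case: y; case: y'; rewrite (sum_delta_l (fun i => (j == i)%:R)) mulr1.
- rewrite [j == k]eq_sym -(skew_l hR).
  by do 2![apply: eq_bigr => ? _].
- rewrite mulrC [y == y']eq_sym -(Rinv_R hR) exchange_big.
  by do 2![apply: eq_bigr => ? _]; rewrite mulrC.
- case: y y' => [y1 y2] [y1' y2'].
  have tT (i i' : 'I_N) (x x' : basis N (ETens Y1 Y2)) :
      braid EVd (ETens Y1 Y2) i x x' i'
      = \sum_a braid EVd Y1 i x.1 x'.1 a * braid EVd Y2 a x.2 x'.2 i' by [].
  have tF (i i' : 'I_N) (x x' : basis N (ETens Y1 Y2)) :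
      braid EV (ETens Y1 Y2) i x x' i'
      = \sum_a braid EV Y1 i x.1 x'.1 a * braid EV Y2 a x.2 x'.2 i' by [].
  (* The two letters arrive between [Y1] and [Y2] as [e] and [f]. The pairing first closes behind
     [Y2], which forces [e = f], and what remains is the pairing behind [Y1]. *)
  transitivity (\sum_e \sum_f \sum_z (braid EVd Y1 k y1 z e * braid EV Y1 j z y1' f)
      * \sum_w \sum_i (braid EVd Y2 e y2 w i * braid EV Y2 f w y2' i)).
    rewrite sum_prod [RHS]sum_rotate; apply: eq_bigr => z _.
    under eq_bigr => w _ do (under eq_bigr => i _ do rewrite tT tF big_distrlr).
    rewrite sum_rotate; apply: eq_bigr => e _.
    rewrite sum_rotate; apply: eq_bigr => f _.
    rewrite mulr_sumr; apply: eq_bigr => w _.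
    by rewrite mulr_sumr; apply: eq_bigr => i _; rewrite mulrACA.
  under eq_bigr => e _ do (under eq_bigr => f _ do (rewrite I2 -mulr_suml)).
  transitivity ((y2 == y2')%:R
      * \sum_e \sum_z braid EVd Y1 k y1 z e * braid EV Y1 j z y1' e : K).
    rewrite mulr_sumr; apply: eq_bigr => e _.
    rewrite (bigD1 e) //= eqxx mul1r [X in _ + X]big1 ?addr0 1?mulrC //.
    by move=> f /negPf fe; rewrite fe mul0r mulr0.
  by rewrite exchange_big I1 mulrC -mulrA -!natrM !mulnb.
- case: y y' => y [] y'; rewrite big_sumType /=.
  + rewrite [X in _ + X]big1 ?addr0; first exact: I1.
    by move=> z _; rewrite big1 // => i _; rewrite mul0r.
  + rewrite !big1 ?addr0 ?mulr0 // => z _; rewrite big1 // => i _.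
      by rewrite mul0r.
    by rewrite mulr0.
  + rewrite !big1 ?addr0 ?mulr0 // => z _; rewrite big1 // => i _.
      by rewrite mulr0.
    by rewrite mul0r.
  + rewrite [X in X + _]big1 ?add0r; first exact: I2.
    by move=> z _; rewrite big1 // => i _; rewrite mul0r.
Qed.

Lemma pair_r_past Y : intertwiner (past_corep R Rinv Psi Y) (pair_r K N).
Proof.
move=> [j k] []; apply/ffunP => -[y' y]; rewrite !fmx_sumE.
rewrite (bigD1 tt) //= [X in _ + X]big1 ?addr0; last by case.
rewrite fmxZ mc_pair_r cr_unit fmx1 [y' == y]eq_sym -pair_r_past_coef sum_prod.
apply: esym; rewrite [RHS]exchange_big /=; apply: eq_bigr => p _.
rewrite (bigD1 p) //= [X in _ + X]big1 ?addr0.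
  rewrite fmxZ mc_pair_r eqxx mul1r cr_tens fmxM.
  by apply: eq_bigr => a _; rewrite /cr_mx /= !ffunE mulrC.
by move=> a /negPf ap; rewrite fmxZ mc_pair_r /= eq_sym ap mul0r.
Qed.

End PairPast.

(** * The relations of L(R_q,1) as morphisms *)

Section LinearMaps.
Variables (K : fieldType) (V W : lmodType K) (f : V -> W).
Hypothesis f_lin : linear f.

Lemma lin0 : f 0 = 0.
Proof. by have := f_lin (-1) 0 0; rewrite scaler0 add0r scaleN1r addNr. Qed.

Lemma linD u v : f (u + v) = f u + f v.
Proof. by have := f_lin 1 u v; rewrite !scale1r. Qed.

Lemma linZ c u : f (c *: u) = c *: f u.
Proof. by have := f_lin c u 0; rewrite lin0 !addr0. Qed.

Lemma linB u v : f (u - v) = f u - f v.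
Proof. by rewrite linD -scaleN1r linZ scaleN1r. Qed.

Lemma linBB a b c d : f (a - b - (c - d)) = f a - f b - (f c - f d).
Proof. by rewrite !linB. Qed.

Lemma lin_sum (I : Type) (s : seq I) (P : pred I) (F : I -> V) :
  f (\sum_(i <- s | P i) F i) = \sum_(i <- s | P i) f (F i).
Proof. exact: (big_morph f linD lin0). Qed.

Lemma lin_comb (I J : finType) (c : I -> K) (d : J -> K) (u : I -> V)
    (v : J -> V) (u' : I -> W) (v' : J -> W) :
  (forall i, f (u i) = u' i) -> (forall j, f (v j) = v' j) ->
  f (\sum_i c i *: u i - \sum_j d j *: v j)
  = \sum_i c i *: u' i - \sum_j d j *: v' j.
Proof.
move=> uu' vv'; rewrite linB !lin_sum; congr (_ - _); apply: eq_bigr => i _.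
  by rewrite linZ uu'.
by rewrite linZ vv'.
Qed.

Lemma lin_addsub (I : finType) c u v (w : I -> V) u' v' (w' : I -> W) :
  f u = u' -> f v = v' -> (forall i, f (w i) = w' i) ->
  f (u + v - c *: \sum_i w i) = u' + v' - c *: \sum_i w' i.
Proof.
move=> <- <- ww'; rewrite linB linD linZ lin_sum.
by under eq_bigr => i _ do rewrite ww'.
Qed.

End LinearMaps.

Section WordAction.
Variables (K : fieldType) (G : choiceType) (M : lmodType K).
Variable act : G -> M -> M.
Hypothesis act_lin : forall g, linear (act g).

(* The module over the free algebra in which the generator [g] acts by
   [act g]. *)
Definition wact (p : freealg K G) (t : M) : M :=
  linext (fun w : {fmonom G} => foldr act t w) p.

Lemma wact_lin_l t : linear (wact^~ t).
Proof. exact: linext_is_linear. Qed.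

Lemma foldr_act_lin (w : seq G) : linear (fun t => foldr act t w).
Proof. by elim: w => [|g w IH] c u v //=; rewrite IH act_lin. Qed.

Lemma wact_lin_r p : linear (wact p).
Proof.
move=> c u v; rewrite /wact /linext scaler_sumr -big_split.
apply: eq_bigr => w _ /=; rewrite foldr_act_lin scalerDr !scalerA.
by rewrite mulrC.
Qed.

Lemma wactU (w : {fmonom G}) t : wact (mkmalgU w 1) t = foldr act t w.
Proof. exact: linextU. Qed.

Lemma malg_expand (p : freealg K G) :
  p = \sum_(w <- msupp p) p@_w *: (mkmalgU w 1 : freealg K G).
Proof.
rewrite {1}[p]monalgE; apply: eq_bigr => w _; apply/malgP => k.
by rewrite mcoeffZ !mcoeffU mulrnAr mulr1.
Qed.

Lemma wactM p r t : wact (p * r) t = wact p (wact r t).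
Proof.
rewrite {1}[p]malg_expand {1}[r]malg_expand mulr_suml.
rewrite (lin_sum (wact_lin_l t)) [RHS]/wact /linext.
apply: eq_bigr => w _; rewrite mulr_sumr (lin_sum (wact_lin_l t)).
rewrite [wact r t]/wact /linext (lin_sum (@foldr_act_lin w)) scaler_sumr.
apply: eq_bigr => v _; rewrite -scalerAl -scalerAr !(linZ (wact_lin_l t)).
rewrite (linZ (@foldr_act_lin w)); congr (_ *: (_ *: _)).
have -> : (mkmalgU w 1 : freealg K G) * mkmalgU v 1 = mkmalgU (fmmul w v) 1.
  by rewrite [LHS]fgmulUU mulr1.
by rewrite wactU fmmulE /= foldr_cat.
Qed.

Lemma wact1 t : wact 1 t = t.
Proof. by rewrite [LHS]wactU fm1. Qed.

Lemma wact_gen g t : wact (fgen K g) t = act g t.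
Proof. by rewrite [LHS]wactU fmU. Qed.

Variable rel : freealg K G -> Prop.
Hypothesis act_rel : forall x t, rel x -> wact x t = 0.

(** Independence of the representative that [alift] picks. A relation sits between two arbitrary
    factors in the ideal, so it has to annihilate every vector and not just the starting one. *)
Lemma alift_wact p t :
  alift (fun w : seq G => foldr act t w) (qapi rel p) = wact p t.
Proof.
apply: alift_qapi => a x b rx; rewrite -/(wact _ t) !wactM.
by rewrite (act_rel _ rx) (lin0 (wact_lin_r a)).
Qed.

End WordAction.

Lemma sum_delta_rank1 (K : pzRingType) (V : lmodType K) (A B : finType)
    (f : A -> K) (g : B -> K) (F : A -> B -> V) i j :
  \sum_a \sum_b (f a * (j == b)%:R - (i == a)%:R * g b) *: F a b
  = \sum_a f a *: F a j - \sum_b g b *: F i b.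
Proof.
under eq_bigr => a _ do (under eq_bigr => b _ do rewrite scalerBl -!scalerA).
under eq_bigr => a _ do rewrite sumrB -!scaler_sumr eq_sym.
rewrite sumrB sum_delta_scale; congr (_ - _); apply: eq_bigr => a _.
by congr (_ *: _); under eq_bigr => b _ do rewrite eq_sym; rewrite sum_delta_scale.
Qed.

Lemma sum_mulA (A : pzRingType) (I J : finType) (f : I -> A) (g : I -> J -> A)
    (h : J -> A) :
  \sum_i f i * \sum_j g i j * h j = \sum_j (\sum_i f i * g i j) * h j.
Proof.
under eq_bigr => k _ do rewrite mulr_sumr.
rewrite exchange_big /=; apply: eq_bigr => l _; rewrite mulr_suml.
by apply: eq_bigr => k _; rewrite mulrA.
Qed.

Lemma scalar_commutator (K : fieldType) (A : algType K) (I : finType)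
    (c : I -> I -> K) (Q L : I -> I -> A) i j :
  \sum_a c a i *: (Q a j - L a j) - \sum_b c j b *: (Q i b - L i b)
  = \sum_a (c a i)%:A * Q a j - \sum_b Q i b * (c j b)%:A
    - (\sum_a (c a i)%:A * L a j - \sum_b L i b * (c j b)%:A).
Proof.
under eq_bigr => a _ do rewrite
  scalerBr -(mulr_algl _ (Q a j)) -(mulr_algl _ (L a j)).
under [X in _ - X]eq_bigr => a _ do rewrite
  scalerBr -(mulr_algr _ (Q i a)) -(mulr_algr _ (L i a)).
by rewrite !sumrB !opprB addrACA [RHS]addrACA; congr (_ + _); rewrite addrC.
Qed.

Section ReflectionRelation.
Variables (K : fieldType) (N m n : nat) (q : K) (R Rinv Psi : tensor4 K N).
Hypothesis hR : hecke_symmetry q m n R Rinv Psi.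

Local Notation basis := (basis N).
Local Notation sp := (sp K N).
Local Notation braiding := (braiding R Rinv Psi).
Local Notation gens := ('I_N * 'I_N)%type.
Local Notation F := (freealg K gens).
Local Notation VVDD := (ETens (ETens EV EV) (ETens EVd EVd)).

(** The defining relations say that R commutes with the matrix L_1 R L_1 - L_1. Multiplying by R on
    the left is the braiding on the row indices, that is on V (x) V; multiplying on the right is the
    braiding on the column indices, on V^* (x) V^*. Their difference is this commutator. *)
Definition re_ends : 'End(sp VVDD) :=
  tmap (braiding EV EV) \1%VF - tmap \1%VF (braiding EVd EVd).

Definition re_shift : 'Hom(sp VVDD, sp (ETens EV (ETens (ETens EV EVd) EVd))) :=
  (tmap \1 (assocV K N EV EVd EVd) \o assoc K N EV EV (ETens EVd EVd))%VF.

(** The entries of L_1 R L_1, as [re_lin] gives those of L_1: the two inner factors V (x) V^* are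
    exchanged by [unbraid] in the first case and paired in the second. *)
Definition re_quad : 'Hom(sp VVDD, sp (ETens EndV EndV)) :=
  (assocV K N EV EVd EndV \o tmap \1 (assoc K N EVd EV EVd)
     \o tmap \1 (tmap (unbraid R) \1) \o re_shift)%VF.

Definition re_lin : 'Hom(sp VVDD, sp EndV) :=
  (tmap \1 (lunit K N EVd) \o tmap \1 (tmap (pair_r K N) \1) \o re_shift)%VF.

Lemma re_shift_bvec a b c d :
  re_shift (bvec K (((a, b), (c, d)) : basis VVDD))
  = bvec K ((a, ((b, c), d)) : basis (ETens EV (ETens (ETens EV EVd) EVd))).
Proof.
by rewrite comp_lfunE assoc_bvec tmap_bvec id_lfunE assocV_bvec tvec_bvec.
Qed.

Lemma mc_re_quad (a b c d i j k l : 'I_N) :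
  mc re_quad (((a, b), (c, d)) : basis VVDD) ((i, j), (k, l))
  = (a == i)%:R * opposite_skew R b c j k * (d == l)%:R.
Proof.
rewrite /mc 3!comp_lfunE re_shift_bvec assocVE tmap_1_app assocE ffunE.
by rewrite -/(mc _ _ _) !mc_tmap !mc_id mc_unbraid mulrA.
Qed.

Lemma mc_re_lin (a b c d i l : 'I_N) :
  mc re_lin (((a, b), (c, d)) : basis VVDD) (i, l)
  = (a == i)%:R * (b == c)%:R * (d == l)%:R.
Proof.
rewrite /mc 2!comp_lfunE re_shift_bvec tmap_1_app.
have -> u x : lunit K N EVd u x = u (tt, x).
  rewrite mc_app sum_prod (bigD1 tt) //= [X in _ + X]big1 ?addr0; last by case.
  rewrite -[RHS](sum_delta_r (fun y => u (tt, y) : K)).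
  by apply: eq_bigr => y _; rewrite mc_lmap bvecE eq_sym.
by rewrite ffunE -/(mc _ _ _) !mc_tmap !mc_id mc_pair_r mulrA.
Qed.

Definition re_elt (e : basis VVDD) : F :=
  \sum_w mc (re_quad \o re_ends)%VF e w *: (fgen K w.1 * fgen K w.2)
  - \sum_g mc (re_lin \o re_ends)%VF e g *: fgen K g.

Definition quad_elt (e : basis VVDD) : F :=
  \sum_w mc re_quad e w *: (fgen K w.1 * fgen K w.2).

Definition lin_elt (e : basis VVDD) : F :=
  \sum_g mc re_lin e g *: fgen K g.

Lemma re_eltE e :
  re_elt e = \sum_e' mc re_ends e e' *: (quad_elt e' - lin_elt e').
Proof.
under [RHS]eq_bigr => e' _ do rewrite scalerBr !scaler_sumr.
rewrite sumrB; congr (_ - _); rewrite [RHS]exchange_big /=.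
  apply: eq_bigr => w _; rewrite mc_comp scaler_suml.
  by apply: eq_bigr => e' _; rewrite scalerA.
apply: eq_bigr => w _; rewrite mc_comp scaler_suml.
by apply: eq_bigr => e' _; rewrite scalerA.
Qed.

Lemma quad_eltE (a b c d : 'I_N) :
  quad_elt ((a, b), (c, d))
  = \sum_j \sum_k opposite_skew R b c j k *: (fgen K (a, j) * fgen K (k, d)).
Proof.
rewrite /quad_elt sum_prod sum_prod (bigD1 a) //= [X in _ + X]big1 ?addr0.
  apply: eq_bigr => j _; rewrite sum_prod; apply: eq_bigr => k _.
  rewrite (bigD1 d) //= [X in _ + X]big1 ?addr0.
    by rewrite mc_re_quad !eqxx mulr1 mul1r.
  by move=> l /negPf ld; rewrite mc_re_quad [d == l]eq_sym ld mulr0 scale0r.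
move=> i /negPf ia; rewrite big1 // => j _; rewrite big1 // => -[k l] _.
by rewrite mc_re_quad [a == i]eq_sym ia !mul0r scale0r.
Qed.

Lemma lin_eltE (a b c d : 'I_N) :
  lin_elt ((a, b), (c, d)) = (b == c)%:R *: fgen K (a, d).
Proof.
rewrite /lin_elt (bigD1 (a, d)) //= [X in _ + X]big1 ?addr0.
  by rewrite mc_re_lin !eqxx mulr1 mul1r.
move=> [i l]; rewrite mc_re_lin xpair_eqE negb_and.
by rewrite [i == a]eq_sym [l == d]eq_sym => /orP[] /negPf ->;
  rewrite ?mul0r ?mulr0 scale0r.
Qed.

Local Notation rbar := (Rbar R).
Local Notation l1 := (@L1 K N).

Lemma mx2_mulA A B C (i j : gens) :
  mx2_mul A (mx2_mul B C) i j = mx2_mul (K := K) (mx2_mul A B) C i j.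
Proof.
exact: sum_mulA.
Qed.

(** Each dual factor is nested with its partner, in the order V_1 V_2 V_2^* V_1^* of the spaces;
    hence the column index is reversed. *)
Lemma l1_lin_elt (i j : gens) : l1 i j = lin_elt (i, (j.2, j.1)).
Proof.
case: i j => i1 i2 [j1 j2]; rewrite lin_eltE /L1 /=.
by case: (i2 == j2); rewrite ?scale1r ?scale0r.
Qed.

Lemma l1_quad_elt (i j : gens) :
  mx2_mul l1 (mx2_mul rbar l1) i j = quad_elt (i, (j.2, j.1)).
Proof.
case: i j => i1 i2 [j1 j2]; rewrite quad_eltE /mx2_mul sum_prod /=.
apply: eq_bigr => b _; rewrite (bigD1 i2) //= [X in _ + X]big1 ?addr0; last first.
  by move=> c /negPf ci; rewrite /L1 /= eq_sym ci mul0r.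
rewrite sum_prod mulr_sumr; apply: eq_bigr => c _.
rewrite (bigD1 j2) //= [X in _ + X]big1 ?addr0; last first.
  by move=> d /negPf dj; rewrite /L1 /= dj mulr0.
rewrite /L1 /= !eqxx /Rbar /= /opposite_skew.
by rewrite mulr_algl scalerAr.
Qed.

Lemma mc_re_ends (i1 i2 j2 j1 a1 a2 c d : 'I_N) :
  mc re_ends (((i1, i2), (j2, j1)) : basis VVDD) ((a1, a2), (c, d))
  = R a1 a2 i1 i2 * ((j2, j1) == (c, d))%:R
    - ((i1, i2) == (a1, a2))%:R * R j1 j2 d c.
Proof.
rewrite /mc add_lfunE opp_lfunE !ffunE -!/(mc _ _ _) !mc_tmap !mc_braiding.
by rewrite !mc_id.
Qed.

Lemma sum_re_ends (V : lmodType K) (z : basis VVDD -> V) (i1 i2 j1 j2 : 'I_N) :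
  \sum_e mc re_ends (((i1, i2), (j2, j1)) : basis VVDD) e *: z e
  = \sum_(a : gens) R a.1 a.2 i1 i2 *: z (a, (j2, j1))
    - \sum_(b : gens) R j1 j2 b.1 b.2 *: z ((i1, i2), (b.2, b.1)).
Proof.
have -> : \sum_(b : gens) R j1 j2 b.1 b.2 *: z ((i1, i2), (b.2, b.1))
    = \sum_(b : gens) R j1 j2 b.2 b.1 *: z ((i1, i2), b).
  by rewrite !sum_prod exchange_big.
rewrite sum_prod; etransitivity; last exact: (sum_delta_rank1
  (fun a => R a.1 a.2 i1 i2) (fun b => R j1 j2 b.2 b.1) (fun a b => z (a, b))).
by apply: eq_bigr => -[a1 a2] _; apply: eq_bigr => -[c d] _; rewrite mc_re_ends.
Qed.

Lemma re_elt_mx i1 i2 j1 j2 :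
  re_elt ((i1, i2), (j2, j1))
  = mx2_mul rbar (mx2_mul l1 (mx2_mul rbar l1)) (i1, i2) (j1, j2)
    - mx2_mul l1 (mx2_mul rbar (mx2_mul l1 rbar)) (i1, i2) (j1, j2)
    - (mx2_mul rbar l1 (i1, i2) (j1, j2) - mx2_mul l1 rbar (i1, i2) (j1, j2)).
Proof.
rewrite re_eltE.
rewrite (sum_re_ends (fun e => quad_elt e - lin_elt e)).
pose z (M : gens -> gens -> F) : F := mx2_mul rbar M (i1, i2) (j1, j2)
  - mx2_mul M rbar (i1, i2) (j1, j2).
pose Q (i j : gens) := quad_elt (i, (j.2, j.1)).
pose L (i j : gens) := lin_elt (i, (j.2, j.1)).
transitivity (z Q - z L).
  exact: (scalar_commutator (fun a i : gens => R a.1 a.2 i.1 i.2) Q L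
    (i1, i2) (j1, j2)).
have -> : z L = mx2_mul rbar l1 (i1, i2) (j1, j2)
    - mx2_mul l1 rbar (i1, i2) (j1, j2).
  have -> // : L = l1 by apply: funext => a; apply: funext => b; rewrite l1_lin_elt.
have <- : mx2_mul l1 (mx2_mul rbar l1) = Q.
  by apply: funext => a; apply: funext => b; rewrite l1_quad_elt.
rewrite /z; have -> // : mx2_mul (mx2_mul l1 (mx2_mul rbar l1)) rbar
    = mx2_mul l1 (mx2_mul rbar (mx2_mul l1 rbar)).
apply: funext => a; apply: funext => b.
by rewrite -mx2_mulA; apply: eq_bigr => c _; rewrite -mx2_mulA.
Qed.

Lemma re_relP x : re_rel R x <-> exists e, x = re_elt e.
Proof.
split=> [[[i1 i2] [[j1 j2] ->]]|[[[i1 i2] [j2 j1]] ->]].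
  by exists ((i1, i2), (j2, j1)); rewrite re_elt_mx.
by exists (i1, i2), (j1, j2); rewrite re_elt_mx.
Qed.

End ReflectionRelation.

(* The algebra is kept abstract: computing directly in [mrea R] makes
   unification unfold the quotient. *)
Section GeneratorAction.
Variables (K : fieldType) (N m n : nat) (q : K) (R Rinv Psi : tensor4 K N).
Hypothesis hR : hecke_symmetry q m n R Rinv Psi.

Local Notation basis := (basis N).
Local Notation sp := (sp K N).
Local Notation braid X Y := (@braid K N R Rinv Psi X Y).
Local Notation gens := ('I_N * 'I_N)%type.
Local Notation VVDD := (ETens (ETens EV EV) (ETens EVd EVd)).
Local Notation past X := (past_corep R Rinv Psi X).

Variables (A : lmodType K) (mul : A -> A -> A) (l : gens -> A).
Hypothesis mul_lin_l : forall b, linear (mul^~ b).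
Hypothesis mul_lin_r : forall a, linear (mul a).
Hypothesis mulA : associative mul.
Hypothesis l_rel : forall e : basis VVDD,
  \sum_w mc (re_quad R \o re_ends R Rinv Psi)%VF e w *: mul (l w.1) (l w.2)
  = \sum_g mc (re_lin K N \o re_ends R Rinv Psi)%VF e g *: l g.

Variable X : expr.
Local Notation M := {ffun basis X -> A}.

Definition gen_act (g : gens) (t : M) : M :=
  [ffun y => \sum_(x : basis X) \sum_(h : gens)
     braid EndV X g x y h *: mul (l h) (t x)].

Lemma gen_act_lin g : linear (gen_act g).
Proof.
move=> c u v; apply/ffunP => y; rewrite !ffunE scaler_sumr -big_split.
apply: eq_bigr => x _; rewrite scaler_sumr -big_split; apply: eq_bigr => h _.
rewrite !ffunE mul_lin_r scalerDr; congr (_ + _).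
by rewrite !scalerA mulrC.
Qed.

Lemma past_intertwine (V : lmodType K) (Y Z : expr) (f : 'Hom(sp Y, sp Z))
    (v : basis Z -> V) e (y x : basis X) : intertwiner (past X) f ->
  \sum_w mc f e w *: \sum_w' cr_mx (past X) w w' (y, x) *: v w'
  = \sum_e' cr_mx (past X) e e' (y, x) *: \sum_w' mc f e' w' *: v w'.
Proof.
move=> If.
under eq_bigr => w _ do rewrite scaler_sumr.
under [RHS]eq_bigr => w _ do rewrite scaler_sumr.
rewrite exchange_big [RHS]exchange_big; apply: eq_bigr => w' _ /=.
have := congr1 (fun M : fmx (basis X) K => M (y, x)) (If e w').
rewrite /= !fmx_sumE => Ie.
under eq_bigr => w _ do rewrite scalerA -fmxZ.
rewrite -scaler_suml Ie scaler_suml; apply: eq_bigr => e' _.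
by rewrite fmxZ scalerA mulrC.
Qed.

Lemma gen_actE (g : basis EndV) (t : M) y :
  gen_act g t y
  = \sum_x \sum_(h : basis EndV) cr_mx (past X) g h (y, x) *: mul (l h) (t x).
Proof.
rewrite ffunE; do 2![apply: eq_bigr => ? _].
by rewrite [cr_mx _ _ _ _]ffunE.
Qed.

Lemma gen_act2 (g g' : basis EndV) (t : M) y :
  gen_act g (gen_act g' t) y
  = \sum_x \sum_(w : basis (ETens EndV EndV))
      cr_mx (past X) ((g, g') : basis (ETens EndV EndV)) w (y, x)
      *: mul (mul (l w.1) (l w.2)) (t x).
Proof.
rewrite gen_actE.
under eq_bigr => z _ do (under eq_bigr => h _ do
  (rewrite gen_actE (lin_sum (mul_lin_r _)) scaler_sumr)).
under eq_bigr => z _ do rewrite exchange_big.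
rewrite exchange_big; apply: eq_bigr => x _ /=.
rewrite sum_prod exchange_big; apply: eq_bigr => h _ /=.
under eq_bigr => z _ do rewrite (lin_sum (mul_lin_r _)) scaler_sumr.
rewrite exchange_big; apply: eq_bigr => h' _ /=.
rewrite cr_tens fmxM scaler_suml; apply: eq_bigr => z _ /=.
by rewrite (linZ (mul_lin_r _)) scalerA mulA.
Qed.

Lemma past_re_ends : intertwiner (past X) (re_ends R Rinv Psi).
Proof.
apply: intertwinerB; apply: intertwiner_tens; try exact: intertwiner_id.
  exact: (@past_letters _ _ _ _ _ _ _ _ hR X false false).
exact: (@past_letters _ _ _ _ _ _ _ _ hR X true true).
Qed.

Lemma past_re_shift : intertwiner (past X) (re_shift K N).
Proof.
apply: intertwiner_comp; last exact: intertwiner_assoc.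
by apply: intertwiner_tens; [exact: intertwiner_id|exact: intertwiner_assocV].
Qed.

Lemma past_re_quad : intertwiner (past X) (re_quad R).
Proof.
apply: intertwiner_comp; last exact: past_re_shift.
apply: intertwiner_comp.
  apply: intertwiner_comp; first exact: intertwiner_assocV.
  by apply: intertwiner_tens; [exact: intertwiner_id|exact: intertwiner_assoc].
apply: intertwiner_tens; first exact: intertwiner_id.
by apply: intertwiner_tens; [exact: past_unbraid hR X|exact: intertwiner_id].
Qed.

Lemma past_re_lin : intertwiner (past X) (re_lin K N).
Proof.
apply: intertwiner_comp; last exact: past_re_shift.
apply: intertwiner_comp.
  by apply: intertwiner_tens; [exact: intertwiner_id|exact: intertwiner_lunit].
apply: intertwiner_tens; first exact: intertwiner_id.
by apply: intertwiner_tens; [exact: pair_r_past hR X|exact: intertwiner_id].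
Qed.

(** Naturality carries the relation through X. Behind X there is a linear combination of relations
    of the algebra, multiplied by the entries of [t], and these vanish. This is what makes the
    braiding of L(R_q,1) past X well defined. *)
Lemma gen_act_rel x t : re_rel R x -> wact gen_act x t = 0.
Proof.
move=> /(re_relP R Rinv Psi)[e ->]; rewrite /re_elt.
have act2 (w : basis (ETens EndV EndV)) :
    wact gen_act (fgen K w.1 * fgen K w.2) t = gen_act w.1 (gen_act w.2 t).
  by rewrite (wactM gen_act_lin) !wact_gen.
have act1 (g : basis EndV) : wact gen_act (fgen K g) t = gen_act g t.
  by rewrite wact_gen.
rewrite (lin_comb (wact_lin_l gen_act t) _ _ act2 act1).
apply/eqP; rewrite subr_eq0; apply/eqP; apply/ffunP => y.
have sumE (I : finType) (f : I -> M) : (\sum_i f i) y = \sum_i f i y.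
  by apply: (big_morph (fun u : M => u y)) => [a b|]; rewrite ffunE.
rewrite !sumE.
under eq_bigr => w _ do rewrite ffunE gen_act2 scaler_sumr.
under [RHS]eq_bigr => g _ do rewrite ffunE gen_actE scaler_sumr.
rewrite exchange_big [RHS]exchange_big; apply: eq_bigr => x0 _ /=.
transitivity (\sum_e' cr_mx (past X) e e' (y, x0)
    *: \sum_w mc (re_quad R \o re_ends R Rinv Psi)%VF e' w
         *: mul (mul (l w.1) (l w.2)) (t x0)).
  rewrite -past_intertwine; last first.
    by apply: intertwiner_comp; [exact: past_re_quad|exact: past_re_ends].
  by apply: eq_bigr => -[].
symmetry; etransitivity.
  apply: (past_intertwine (f := (re_lin K N \o re_ends R Rinv Psi)%VF)
    (fun h => mul (l h) (t x0))).
  by apply: intertwiner_comp; [exact: past_re_lin|exact: past_re_ends].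
symmetry.
apply: eq_bigr => e' _; congr (_ *: _).
have := congr1 (mul^~ (t x0)) (l_rel e').
rewrite /= !(lin_sum (mul_lin_l _)) => re.
etransitivity; last (etransitivity; first exact: re); apply: eq_bigr => w _;
  by rewrite (linZ (mul_lin_l _)).
Qed.

End GeneratorAction.

(** * The braiding of L(R_q,1) with an object *)

Section EndVBraiding.
Variables (K : fieldType) (N m n : nat) (q : K) (R Rinv Psi : tensor4 K N).
Hypothesis hR : hecke_symmetry q m n R Rinv Psi.

Local Notation basis := (basis N).
Local Notation sp := (sp K N).
Local Notation braid X Y := (@braid K N R Rinv Psi X Y).

Lemma letter_natural_mc b X Y (f : 'Hom(sp X, sp Y)) (x : basis X) (y' : basis Y)
    i i' : generated m n q R Rinv Psi f ->
  \sum_y mc f x y * @braid_letter K N R Rinv Psi b Y i y y' i'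
  = \sum_x' mc f x' y' * @braid_letter K N R Rinv Psi b X i x x' i'.
Proof.
move=> gf; have := congr1 (fun M : fmx 'I_N K => M (i, i'))
  (letter_natural hR b gf x y').
rewrite /= !fmx_sumE => nat_f.
by etransitivity; last (etransitivity; first exact: nat_f);
  apply: eq_bigr => z _; rewrite fmxZ letter_mxE.
Qed.

Lemma EndV_natural X Y (f : 'Hom(sp X, sp Y)) x y' (g h : basis EndV) :
  generated m n q R Rinv Psi f ->
  \sum_y mc f x y * braid EndV Y g y y' h
  = \sum_x' mc f x' y' * braid EndV X g x x' h.
Proof.
move=> gf /=.
under eq_bigr => y _ do rewrite mulr_sumr.
rewrite exchange_big /=.
under eq_bigr => u _ do (under eq_bigr => y _ do rewrite mulrA).
under eq_bigr => u _ do rewrite -mulr_suml (letter_natural_mc true _ _ _ _ gf) mulr_suml.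
rewrite exchange_big /=.
under eq_bigr => v _ do (under eq_bigr => u _ do rewrite mulrAC mulrC).
under eq_bigr => v _ do rewrite -mulr_sumr (letter_natural_mc false _ _ _ _ gf) mulr_sumr.
rewrite exchange_big /=; apply: eq_bigr => x' _; rewrite mulr_sumr.
by apply: eq_bigr => v _; rewrite mulrCA.
Qed.

Lemma EndV_hexagon X1 X2 (z y : basis (ETens X1 X2)) (g h : basis EndV) :
  braid EndV (ETens X1 X2) g z y h
  = \sum_(k : basis EndV) braid EndV X1 g z.1 y.1 k * braid EndV X2 k z.2 y.2 h.
Proof.
case: z y => [z1 z2] [y1 y2] /=.
pose t1 u a := braid EVd X1 g.2 z1 u a; pose t2 a u := braid EVd X2 a z2 u h.2.
pose f1 u c := braid EV X1 g.1 u y1 c; pose f2 c u := braid EV X2 c u y2 h.1.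
transitivity (\sum_u1 \sum_u2
    (\sum_(a < N) t1 u1 a * t2 a u2) * (\sum_(c < N) f1 u1 c * f2 c u2)).
  by rewrite sum_prod.
transitivity (\sum_(c < N) \sum_(a < N)
    (\sum_u t1 u a * f1 u c) * (\sum_u t2 a u * f2 c u)); last by rewrite sum_prod.
under eq_bigr => u1 _ do (under eq_bigr => u2 _ do rewrite big_distrlr).
under eq_bigr => u1 _ do rewrite -sum_rotate exchange_big.
under [RHS]eq_bigr => c _ do (under eq_bigr => a _ do rewrite big_distrlr).
rewrite -sum_rotate; apply: eq_bigr => c _ /=.
apply: eq_bigr => a _; apply: eq_bigr => u1 _; apply: eq_bigr => u2 _.
by ring.
Qed.

End EndVBraiding.

Section BraidMatrix.
Variables (K : fieldType) (N m n : nat) (q : K) (R Rinv Psi : tensor4 K N).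
Hypothesis hR : hecke_symmetry q m n R Rinv Psi.

Local Notation basis := (basis N).
Local Notation sp := (sp K N).
Local Notation braid X Y := (@braid K N R Rinv Psi X Y).
Local Notation gens := ('I_N * 'I_N)%type.

Variables (A : lmodType K) (mul : A -> A -> A) (one : A) (l : gens -> A).
Hypothesis mul_lin_l : forall b, linear (mul^~ b).
Hypothesis mul_lin_r : forall a, linear (mul a).
Hypothesis mulA : associative mul.
Hypothesis mul_1l : left_id one mul.
Hypothesis A_ind : forall P : A -> Prop,
  (forall c a b, P a -> P b -> P (c *: a + b)) -> P one ->
  (forall g a, P a -> P (mul (l g) a)) -> forall a, P a.

(* [M X b y x] is the coefficient of [y] in the image of [b (x) x]. *)
Variable M : forall X, A -> basis X -> basis X -> A.
Hypothesis M_lin : forall X y x, linear (fun b => @M X b y x).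
Hypothesis M_one : forall X y x, @M X one y x = (y == x)%:R *: one.
Hypothesis M_gen : forall X g b y x,
  @M X (mul (l g) b) y x
  = \sum_z \sum_(h : gens) braid EndV X g z y h *: mul (l h) (@M X b z x).

(** The algebra acts by matrices over itself. Both sides obey the recursion [M_gen] in [b]; the
    result makes [past_op] below multiplicative. *)
Lemma M_mul X b b' y x :
  @M X (mul b b') y x = \sum_z mul (@M X b y z) (@M X b' z x).
Proof.
move: y; elim/A_ind: b => [c a b IHa IHb||g b IHb] y.
- rewrite mul_lin_l M_lin IHa IHb scaler_sumr -big_split.
  by apply: eq_bigr => z _; rewrite M_lin mul_lin_l.
- rewrite mul_1l; under eq_bigr => z _ do
    rewrite M_one (linZ (mul_lin_l _)) mul_1l eq_sym.
  by rewrite sum_delta_scale.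
- rewrite -mulA M_gen.
  under eq_bigr => z _ do (under eq_bigr => h _ do
    rewrite IHb (lin_sum (mul_lin_r _)) scaler_sumr).
  under eq_bigr => z _ do rewrite exchange_big.
  rewrite exchange_big; apply: eq_bigr => w _ /=.
  rewrite M_gen (lin_sum (mul_lin_l _)); apply: eq_bigr => z _.
  rewrite (lin_sum (mul_lin_l _)); apply: eq_bigr => h _.
  by rewrite (linZ (mul_lin_l _)) mulA.
Qed.

(** Every element is a combination of words in V (x) V^*, so naturality for the two letters V and
    V^* propagates along the word. *)
Lemma M_natural X Y (f : 'Hom(sp X, sp Y)) b x y' :
  generated m n q R Rinv Psi f ->
  \sum_y mc f x y *: M b y' y = \sum_x' mc f x' y' *: M b x' x.
Proof.
move=> gf; move: y'; elim/A_ind: b => [c a b IHa IHb||g b IHb] y'.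
- under eq_bigr => z _ do rewrite M_lin scalerDr scalerA mulrC -scalerA.
  under [RHS]eq_bigr => z _ do rewrite M_lin scalerDr scalerA mulrC -scalerA.
  by rewrite !big_split /= -!scaler_sumr IHa IHb.
- under eq_bigr => z _ do rewrite M_one eq_sym scalerA mulrC -scalerA.
  under [RHS]eq_bigr => z _ do rewrite M_one scalerA mulrC -scalerA.
  by rewrite !sum_delta_scale.
- under eq_bigr => y _ do rewrite M_gen scaler_sumr.
  rewrite exchange_big /=.
  transitivity (\sum_w \sum_(h : basis EndV)
      (\sum_z mc f w z * braid EndV Y g z y' h) *: mul (l h) (M b w x)).
    transitivity (\sum_z \sum_(h : basis EndV) braid EndV Y g z y' h
        *: mul (l h) (\sum_y mc f x y *: M b z y)).
      apply: eq_bigr => z _; under eq_bigr => y _ do rewrite scaler_sumr.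
      rewrite exchange_big /=; apply: eq_bigr => h _.
      rewrite (lin_sum (mul_lin_r _)) scaler_sumr; apply: eq_bigr => y _.
      by rewrite (linZ (mul_lin_r _)) !scalerA mulrC.
    under eq_bigr => z _ do (under eq_bigr => h _ do
      rewrite IHb (lin_sum (mul_lin_r _)) scaler_sumr).
    under eq_bigr => z _ do rewrite exchange_big.
    rewrite exchange_big; apply: eq_bigr => w _ /=.
    rewrite exchange_big; apply: eq_bigr => h _ /=.
    rewrite scaler_suml; apply: eq_bigr => z _.
    by rewrite (linZ (mul_lin_r _)) scalerA mulrC.
  transitivity (\sum_w \sum_x' \sum_(h : basis EndV)
      (mc f x' y' * braid EndV X g w x' h) *: mul (l h) (M b w x)).
    apply: eq_bigr => w _; rewrite exchange_big; apply: eq_bigr => h _ /=.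
    by rewrite (EndV_natural hR _ _ _ _ gf) scaler_suml.
  rewrite exchange_big; apply: eq_bigr => x' _ /=.
  rewrite M_gen scaler_sumr; apply: eq_bigr => w _.
  by rewrite scaler_sumr; apply: eq_bigr => h _; rewrite scalerA.
Qed.

(** Used for X1 = End(V) and X2 = U, when an element has to pass a generator acting on a vector of
    U: the inner [M] is what is left of [b] behind the generator. *)
Lemma M_hexagon X1 X2 b (y x : basis (ETens X1 X2)) :
  M b y x = M (M b y.1 x.1) y.2 x.2.
Proof.
move: y; elim/A_ind: b => [c a b IHa IHb||g b IHb] y.
- by rewrite !M_lin IHa IHb.
- rewrite !M_one (linZ (M_lin _ _)) M_one scalerA -natrM mulnb.
  by case: x y => [x1 x2] [y1 y2].
- rewrite !M_gen (lin_sum (M_lin _ _)) sum_prod; apply: eq_bigr => z1 _.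
  rewrite (lin_sum (M_lin _ _)) /=.
  under [RHS]eq_bigr => k _ do rewrite (linZ (M_lin _ _)) M_gen scaler_sumr.
  rewrite [RHS]exchange_big; apply: eq_bigr => z2 _ /=.
  under [RHS]eq_bigr => k _ do rewrite scaler_sumr.
  rewrite [RHS]exchange_big; apply: eq_bigr => h _ /=.
  transitivity ((\sum_(k : basis EndV) braid EndV X1 g z1 y.1 k
      * braid EndV X2 k z2 y.2 h)
      *: mul (l h) (M b ((z1, z2) : basis (ETens X1 X2)) x)).
    congr (_ *: _).
    exact: (@EndV_hexagon _ _ R Rinv Psi X1 X2 (z1, z2) y g h).
  rewrite scaler_suml.
  by apply: eq_bigr => k _; rewrite scalerA IHb.
Qed.

Lemma M_gen1 X (g : basis EndV) y x : right_id one mul ->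
  @M X (l g) y x = \sum_(h : basis EndV) braid EndV X g x y h *: l h.
Proof.
move=> mul_1r; rewrite -[l g]mul_1r M_gen exchange_big; apply: eq_bigr => h _ /=.
rewrite -[RHS](sum_delta_scale (K := K) (fun z => braid EndV X g z y h *: l h)).
apply: eq_bigr => z _.
by rewrite M_one (linZ (mul_lin_r _)) mul_1r !scalerA mulrC.
Qed.

End BraidMatrix.

(** * Solutions of the reflection equation *)

Lemma subr_swap_eq (V : zmodType) (a b c d : V) :
  (a - b == c - d) = (b - d == a - c).
Proof.
rewrite -subr_eq0 -[RHS]subr_eq0 -[RHS]oppr_eq0 !opprB.
suff -> : a - b + (d - c) = a - c + (d - b) by [].
by rewrite addrACA [RHS]addrACA [- b - c]addrC.
Qed.

Section ReflectionRing.
Variables (A : pzRingType) (r ri v : A).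
Hypothesis rK : r * ri = 1.
Hypothesis riK : ri * r = 1.
Hypothesis r_hecke : r * r = 1 + v * r.
Hypothesis v_central : forall x, x * v = v * x.

(** The relation of L(R_q,1) with [r] for R and [x] for L_1. Here [v] stands for q - q^-1, as a
    central element of the ring, so that the computations stay within one ring. *)
Definition reflection (x : A) : Prop :=
  r * x * r * x - x * r * x * r = r * x - x * r.

Lemma mulr_v x y : x * (v * y) = v * (x * y).
Proof. by rewrite mulrA v_central -mulrA. Qed.

(** The left equation says that r (1 - x) r commutes with 1 - x. Its part of degree one in x is r^2
    x - x r^2 up to sign, which the Hecke relation r^2 = 1 + v r turns into v (r x - x r). *)
Lemma reflection_shiftE x :
  (r * (1 - x) * r * (1 - x) = (1 - x) * r * (1 - x) * r) <->
  (r * x * r * x - x * r * x * r = v * (r * x - x * r)).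
Proof.
have [y yE] : exists y, y = r * r - r * x * r by eexists.
have -> : r * (1 - x) * r = y by rewrite yE mulrBr mulr1 mulrBl.
have -> : (1 - x) * r * (1 - x) * r = (1 - x) * y.
  by rewrite yE -!mulrA; congr (_ * _); rewrite mulrA mulrBr mulr1 mulrBl !mulrA.
have yx : y * x = x + v * (r * x) - r * x * r * x.
  by rewrite yE mulrBl r_hecke mulrDl mul1r -!mulrA.
have xy : x * y = x + v * (x * r) - x * r * x * r.
  by rewrite yE mulrBr r_hecke mulrDr mulr1 mulr_v !mulrA.
rewrite mulrBr mulr1 mulrBl mul1r yx xy -!addrA mulrBr.
split=> [/addrI /oppr_inj /addrI /eqP|/eqP].
  by rewrite subr_swap_eq => /eqP.
by rewrite -subr_swap_eq => /eqP ->.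
Qed.

(** The substitution of v x for x produces v^2 times the relation for x. Hence 1 - v x solves the
    homogeneous equation in all cases, whereas the way back divides by v^2. *)
Lemma reflection_scaleE x :
  r * (v * x) * r * (v * x) - v * x * r * (v * x) * r
    - v * (r * (v * x) - v * x * r)
  = v * (v * (r * x * r * x - x * r * x * r - (r * x - x * r))).
Proof.
by rewrite -!mulrA !(mulr_v r) !(mulr_v x) !(mulr_v r) -!mulrBr.
Qed.

Lemma reflection_scale x : reflection x ->
  r * (1 - v * x) * r * (1 - v * x) = (1 - v * x) * r * (1 - v * x) * r.
Proof.
move=> rx; apply/reflection_shiftE/eqP; rewrite -subr_eq0 reflection_scaleE.
by rewrite rx subrr !mulr0.
Qed.

Lemma reflection_unscale x : (exists w, w * v = 1) ->
  r * (1 - v * x) * r * (1 - v * x) = (1 - v * x) * r * (1 - v * x) * r ->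
  reflection x.
Proof.
move=> [w wv] /reflection_shiftE/eqP; rewrite -subr_eq0 reflection_scaleE.
move=> /eqP /(congr1 (fun z => w * (w * z))).
rewrite !mulr0 [w * (v * _)]mulrA wv mul1r mulrA wv mul1r => /eqP.
by rewrite subr_eq0 => /eqP.
Qed.

Section Coproduct.
Variables a b : A.
Hypothesis a_refl : reflection a.
Hypothesis b_refl : reflection b.
Hypothesis ba_cross : b * r * a = r * a * ri * b * r.

(** Applying the exchange relation once on each side, and then the reflection equation of one
    factor, brings both sides to k(a) r k(a) k(b) r k(b). *)
Lemma reflection_group_like :
  let k x := 1 - v * x in
  r * (k a * k b) * r * (k a * k b) = (k a * k b) * r * (k a * k b) * r.
Proof.
move=> k.
have ka := reflection_scale a_refl; have kb := reflection_scale b_refl.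
(* The exchange relation passes from a, b to k(a), k(b): the terms of degree zero and one agree
   because r and ri are inverse to each other, and the term of degree two is [ba_cross]. *)
have kbka : k b * r * k a = r * k a * ri * k b * r.
  have kl x y : k x * y = y - v * (x * y) by rewrite mulrBl mul1r mulrA.
  have kr x y : y * k x = y - v * (y * x) by rewrite mulrBr mulr1 mulr_v.
  have -> : k b * r * k a = r - v * (b * r) - v * (r * a - v * (b * r * a)).
    by rewrite kr kl mulrBl -[v * _ * a]mulrA.
  have [z zE] : exists z, z = r * a * ri by eexists.
  have zr : z * r = r * a by rewrite zE -mulrA riK mulr1.
  have -> : r * k a * ri = 1 - v * z.
    by rewrite kr mulrBl rK zE !mulrA.
  have -> : (1 - v * z) * k b * r = r - v * (r * a) - v * (b * r - v * (b * r * a)).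
    rewrite kr [LHS]mulrBl mulrBl mul1r -[v * z * r]mulrA zr; congr (_ - _).
    by rewrite -[LHS]mulrA !mulrBl mul1r ba_cross zE !mulrA.
  rewrite !mulrBr !opprB -!addrA; congr (_ + _).
  by rewrite addrCA [RHS]addrCA [- (v * (b * r)) - _]addrC.
have kbkaA y : k b * (r * (k a * y)) = r * (k a * (ri * (k b * (r * y)))).
  by rewrite !mulrA kbka.
have kaA y : r * (k a * (r * (k a * y))) = k a * (r * (k a * (r * y))).
  by rewrite !mulrA ka.
have kbr : k b * (r * (k b * r)) = r * (k b * (r * k b)) by rewrite !mulrA kb.
rewrite -!mulrA !kbkaA kaA kbr.
by rewrite [r * (ri * _)]mulrA rK mul1r [ri * (r * _)]mulrA riK mul1r.
Qed.

Lemma reflection_coproduct :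
  v = 0 \/ (exists w, w * v = 1) -> reflection (a + b - v * (a * b)).
Proof.
move=> [v0|v_unit]; last first.
  apply: (reflection_unscale v_unit).
  have -> : 1 - v * (a + b - v * (a * b)) = (1 - v * a) * (1 - v * b).
    rewrite mulrBl mul1r [v * a * _]mulrBr mulr1 -[v * a * (_ * _)]mulrA (mulr_v a)
      mulrBr mulrDr.
    by rewrite !opprB opprD !addrA [1 - _ + _]addrAC [RHS]addrAC.
  exact: reflection_group_like.
(* For v = 0 one has 1 - v x = 1, which says nothing about x. Here r is an involution, the coproduct
   is a + b, and the exchange relation identifies the mixed terms of r (a + b) r (a + b) with those
   of (a + b) r (a + b) r. *)
have rr : r * r = 1 by rewrite r_hecke v0 mul0r addr0.
have rir : ri = r by rewrite -[ri]mulr1 -rr mulrA riK mul1r.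
have bra : b * r * a = r * a * r * b * r by rewrite ba_cross rir.
have rbra : r * b * r * a = a * r * b * r.
  by rewrite -!mulrA [b * (r * a)]mulrA bra !mulrA rr mul1r.
have brar : b * r * a * r = r * a * r * b by rewrite bra -!mulrA rr mulr1.
rewrite v0 mul0r subr0 /reflection !(mulrDl, mulrDr).
rewrite rbra brar; set x := a * r * b * r; set y := r * a * r * b.
have ac p t : p + x + (y + t) = p + t + (x + y) by rewrite [y + t]addrC addrACA.
have ca p t : p + y + (x + t) = p + t + (x + y).
  by rewrite [x + t]addrC addrACA [y + x]addrC.
rewrite ac ca opprD addrACA subrr addr0 opprD addrACA a_refl b_refl.
by rewrite addrACA -opprD.
Qed.

End Coproduct.

End ReflectionRing.

Section EndomorphismRing.
Variables (K : fieldType) (V : vectType K).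

(** Endomorphisms with composition as product, as a ring that is allowed to be zero. *)
Definition endo := 'End(V).

HB.instance Definition _ := GRing.Lmodule.on endo.

Lemma comp_lfun_distl : left_distributive (@comp_lfun _ V V V) +%R.
Proof. by move=> f g h; rewrite comp_lfunDl. Qed.

Lemma comp_lfun_distr : right_distributive (@comp_lfun _ V V V) +%R.
Proof. by move=> f g h; rewrite comp_lfunDr. Qed.

HB.instance Definition _ := GRing.Zmodule_isPzRing.Build endo
  (@comp_lfunA _ V V V V) (@comp_lfun1l _ V V) (@comp_lfun1r _ V V)
  comp_lfun_distl comp_lfun_distr.

Implicit Types f g : endo.

Lemma endo_scaleAl c f g : c *: (f * g) = (c *: f) * g.
Proof. exact: comp_lfunZl. Qed.

Lemma endo_scaleAr c f g : c *: (f * g) = f * (c *: g).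
Proof. exact: comp_lfunZr. Qed.

Lemma endo_mulE f g u : (f * g) u = f (g u).
Proof. exact: comp_lfunE. Qed.

End EndomorphismRing.

Lemma fmxB (I : finType) (A : pzRingType) (a b : fmx I A) p :
  (a - b) p = a p - b p.
Proof. by rewrite !ffunE. Qed.

Lemma fmxD (I : finType) (A : pzRingType) (a b : fmx I A) p :
  (a + b) p = a p + b p.
Proof. by rewrite ffunE. Qed.

Section ScalarMatrices.
Variables (K : fieldType) (V : vectType K) (I : finType).
Local Notation E := (endo V).

Definition scalar_fmx (a : fmx I K) : fmx I E := [ffun p => a p *: (1 : E)].

Lemma scalar_fmxE a i j : scalar_fmx a (i, j) = a (i, j) *: (1 : E).
Proof. by rewrite ffunE. Qed.

Lemma scalar_fmxM a b : scalar_fmx (a * b) = scalar_fmx a * scalar_fmx b.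
Proof.
apply/ffunP => -[i j]; rewrite scalar_fmxE !fmxM scaler_suml.
apply: eq_bigr => k _; rewrite !scalar_fmxE -endo_scaleAl -endo_scaleAr mulr1.
by rewrite scalerA.
Qed.

Lemma scalar_fmxD a b : scalar_fmx (a + b) = scalar_fmx a + scalar_fmx b.
Proof. by apply/ffunP => p; rewrite !ffunE scalerDl. Qed.

Lemma scalar_fmx1 : scalar_fmx 1 = 1.
Proof.
apply/ffunP => -[i j]; rewrite scalar_fmxE !fmx1.
by case: (i == j); rewrite ?scale1r ?scale0r.
Qed.

Lemma mul_scalar_fmx a (x : fmx I E) i j :
  (scalar_fmx a * x) (i, j) = \sum_k a (i, k) *: x (k, j).
Proof.
rewrite fmxM; apply: eq_bigr => k _.
by rewrite scalar_fmxE -endo_scaleAl mul1r.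
Qed.

Lemma mul_fmx_scalar a (x : fmx I E) i j :
  (x * scalar_fmx a) (i, j) = \sum_k a (k, j) *: x (i, k).
Proof.
rewrite fmxM; apply: eq_bigr => k _.
by rewrite scalar_fmxE -endo_scaleAr mulr1.
Qed.

Definition const_fmx (c : K) : fmx I E := scalar_fmx (c *: (1 : fmx I K)).

Lemma mul_const_fmx c x p : (const_fmx c * x) p = c *: x p.
Proof.
case: p => i j; rewrite mul_scalar_fmx.
rewrite -[x (i, j)](sum_delta_scale (K := K) (fun k => x (k, j))).
rewrite scaler_sumr; apply: eq_bigr => k _.
by rewrite fmxZ fmx1 scalerA eq_sym.
Qed.

Lemma const_fmx_central c x : x * const_fmx c = const_fmx c * x.
Proof.
apply/ffunP => -[i j]; rewrite mul_const_fmx mul_fmx_scalar.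
rewrite -[x (i, j)](sum_delta_scale (K := K) (fun k => x (i, k))) scaler_sumr.
by apply: eq_bigr => k _; rewrite fmxZ fmx1 scalerA.
Qed.

End ScalarMatrices.

Section Families.
Variables (K : fieldType) (N m n : nat) (q : K) (R Rinv Psi : tensor4 K N).
Hypothesis hR : hecke_symmetry q m n R Rinv Psi.

Local Notation basis := (basis N).
Local Notation sp := (sp K N).
Local Notation braid X Y := (@braid K N R Rinv Psi X Y).
Local Notation gens := ('I_N * 'I_N)%type.
Local Notation F := (freealg K gens).
Local Notation VVDD := (ETens (ETens EV EV) (ETens EVd EVd)).

Variable Z : vectType K.
Local Notation E := (endo Z).

Definition ev (X : gens -> E) (p : F) : E :=
  wact (fun g (f : E) => X g * f) p 1.

Section Evaluation.
Variable X : gens -> E.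

Lemma ev_act_lin g : linear (fun f : E => X g * f).
Proof. by move=> c u v; rewrite mulrDr -endo_scaleAr. Qed.

Lemma ev_lin : linear (ev X).
Proof. exact: wact_lin_l. Qed.

Lemma wact_ev p f : wact (fun g (f : E) => X g * f) p f = ev X p * f.
Proof.
have f_lin : linear (fun u : E => u * f).
  by move=> c u v; rewrite mulrDl -endo_scaleAl.
rewrite /ev /wact /linext (lin_sum f_lin); apply: eq_bigr => w _.
rewrite (linZ f_lin); congr (_ *: _).
by elim: (fmonom_val w) => [|g s IH] /=; rewrite ?mul1r // IH mulrA.
Qed.

Lemma ev_mul p r : ev X (p * r) = ev X p * ev X r.
Proof. by rewrite -wact_ev /ev (wactM ev_act_lin). Qed.

Lemma ev1 : ev X 1 = 1.
Proof. exact: wact1. Qed.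

Lemma ev_gen g : ev X (fgen K g) = X g.
Proof. by rewrite /ev wact_gen mulr1. Qed.

Definition ev_mx (a : gens -> gens -> F) : fmx gens E :=
  [ffun p => ev X (a p.1 p.2)].

Lemma ev_mxM a b : ev_mx (mx2_mul a b) = ev_mx a * ev_mx b.
Proof.
apply/ffunP => -[i j]; rewrite fmxM ffunE (lin_sum ev_lin).
by apply: eq_bigr => k _; rewrite ev_mul !ffunE.
Qed.

Definition tensor_mx (T : tensor4 K N) : fmx gens K :=
  [ffun p => T p.2.1 p.2.2 p.1.1 p.1.2].

Definition family_mx : fmx gens E :=
  [ffun p => if p.1.2 == p.2.2 then X (p.1.1, p.2.1) else 0].

Lemma ev_rbar : ev_mx (Rbar R) = scalar_fmx Z (tensor_mx R).
Proof.
by apply/ffunP => p; rewrite !ffunE (linZ ev_lin) ev1.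
Qed.

Lemma ev_L1 : ev_mx (@L1 K N) = family_mx.
Proof.
apply/ffunP => p; rewrite !ffunE /L1; case: ifP => _; first exact: ev_gen.
exact: (lin0 ev_lin).
Qed.

Definition reflection_family : Prop := forall e : basis VVDD,
  \sum_w mc (re_quad R \o re_ends R Rinv Psi)%VF e w *: (X w.1 * X w.2)
  = \sum_g mc (re_lin K N \o re_ends R Rinv Psi)%VF e g *: X g.

Lemma reflection_family_ev :
  reflection_family <-> forall e, ev X (re_elt R Rinv Psi e) = 0.
Proof.
have evE e : ev X (re_elt R Rinv Psi e)
  = \sum_w mc (re_quad R \o re_ends R Rinv Psi)%VF e w *: (X w.1 * X w.2)
    - \sum_g mc (re_lin K N \o re_ends R Rinv Psi)%VF e g *: X g.
  by apply: (lin_comb ev_lin) => [w|g]; rewrite ?ev_mul !ev_gen.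
by split=> XR e; apply/eqP; have /eqP := XR e; rewrite evE subr_eq0.
Qed.

(** The bridge between the two forms of the relations: as maps between objects, where naturality
    applies, and as a matrix equation, where the ring computation takes place. *)
Lemma reflection_familyP :
  reflection_family <-> reflection (scalar_fmx Z (tensor_mx R)) family_mx.
Proof.
pose r := scalar_fmx Z (tensor_mx R); pose x := family_mx.
have evE i1 i2 j1 j2 : ev X (re_elt R Rinv Psi ((i1, i2), (j2, j1)))
    = (r * x * r * x - x * r * x * r - (r * x - x * r)) ((i1, i2), (j1, j2)).
  etransitivity; first exact: (congr1 (ev X) (re_elt_mx R Rinv Psi i1 i2 j1 j2)).
  etransitivity; first exact: (linBB ev_lin).
  rewrite -[r * x * r * x]mulrA -[r * x * (r * x)]mulrA.
  rewrite -[x * r * x * r]mulrA -[x * r * (x * r)]mulrA /r /x.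
  by rewrite -!ev_rbar -!ev_L1 -!ev_mxM !ffunE.
split=> [/reflection_family_ev XR|XR].
  apply/eqP; rewrite -subr_eq0; apply/eqP.
  by apply/ffunP => -[[i1 i2] [j1 j2]]; rewrite -evE XR ffunE.
apply/reflection_family_ev => -[[i1 i2] [j2 j1]]; rewrite evE.
by move/eqP: XR; rewrite -subr_eq0 => /eqP XR; rewrite /r /x XR ffunE.
Qed.

End Evaluation.

Lemma tensor_mx_hecke : q != 0 ->
  tensor_mx R * tensor_mx R = 1 + (q - q^-1) *: tensor_mx R.
Proof.
move=> q0; have [_ hecke _ _ _] := hR.
apply/ffunP => -[x y].
have opE u w : op_of R (bvec K u) w = tensor_mx R (u, w).
  by rewrite -/(mc _ _ _) mc_op_of ffunE.
have /lfunP/(_ (bvec K (x : basis (ETens EV EV)))) := hecke.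
rewrite comp_lfunE !add_lfunE !opp_lfunE !scale_lfunE !id_lfunE linearD linearZ /=.
rewrite zero_lfunE => /(congr1 (fun u : sp (ETens EV EV) => u y)) op2.
have {}op2 : \sum_z tensor_mx R (x, z) * tensor_mx R (z, y)
    + q^-1 * tensor_mx R (x, y) - q * (tensor_mx R (x, y) + q^-1 * (y == x)%:R) = 0.
  transitivity ((0 : sp (ETens EV EV)) y); last by rewrite ffunE.
  have -> : \sum_z tensor_mx R (x, z) * tensor_mx R (z, y)
      = op_of R (op_of R (bvec K (x : basis (ETens EV EV)))) y.
    by rewrite mc_app; apply: eq_bigr => z _; rewrite -!opE.
  by rewrite -!opE -op2 !ffunE.
rewrite mulrDr mulrA divff // mul1r in op2.
rewrite fmxM [RHS]ffunE fmx1 fmxZ.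
have solve (s t d c : K) : s + c * t - (q * t + d) = 0 -> s = d + (q - c) * t.
  by move=> /eqP; rewrite subr_eq0 => /eqP std; rewrite -[s](addrK (c * t)) std; ring.
by rewrite eq_sym; exact: solve op2.
Qed.

Lemma tensor_mx_inverse (T T' : tensor4 K N) :
  inverse_crossing (fun i j k l => T k l i j) (fun i j k l => T' k l i j) ->
  tensor_mx T * tensor_mx T' = 1.
Proof.
move=> TT'; apply/ffunP => -[[i j] [k l]].
rewrite fmxM fmx1 xpair_eqE -mulnb natrM -TT' sum_prod.
by do 2![apply: eq_bigr => ? _]; rewrite !ffunE.
Qed.

Section Coproduct.
Variables A B : gens -> E.
Hypothesis cross : forall g h : basis EndV,
  B g * A h = \sum_h' \sum_g' braid EndV EndV g h h' g' *: (A h' * B g').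

Local Notation r := (scalar_fmx Z (tensor_mx R)).
Local Notation ri := (scalar_fmx Z (tensor_mx Rinv)).

Lemma family_mx_quad (X Y : gens -> E) (i a l b : 'I_N) :
  (family_mx X * r * family_mx Y) ((i, a), (l, b))
  = \sum_j \sum_k R k b j a *: (X (i, j) * Y (k, l)).
Proof.
rewrite -mulrA fmxM sum_prod; apply: eq_bigr => j _.
rewrite (bigD1 a) //= [X in _ + X]big1 ?addr0; last first.
  by move=> c /negPf ca; rewrite !ffunE /= eq_sym ca mul0r.
rewrite mul_scalar_fmx mulr_sumr sum_prod; apply: eq_bigr => k _.
rewrite (bigD1 b) //= [X in _ + X]big1 ?addr0; last first.
  by move=> c /negPf cb; rewrite !ffunE /= cb scaler0 mulr0.
by rewrite !ffunE /= !eqxx -endo_scaleAr.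
Qed.

(** Passing V (x) V^* through itself uses Psi, R, R and R^-1. The R that stands between B and A
    cancels Psi by skew-invertibility; the other three crossings are the three factors on the
    right. *)
Lemma family_cross :
  family_mx B * r * family_mx A = r * family_mx A * ri * family_mx B * r.
Proof.
apply/ffunP => -[[i a] [l b]]; rewrite family_mx_quad.
have entry X (T : tensor4 K N) x y z w :
    (scalar_fmx Z (tensor_mx T) * family_mx X) ((x, y), (z, w))
    = \sum_k T k w x y *: X (k, z).
  rewrite mul_scalar_fmx sum_prod; apply: eq_bigr => k _.
  rewrite (bigD1 w) //= [Y in _ + Y]big1 ?addr0; last first.
    by move=> c /negPf cw; rewrite !ffunE /= cw scaler0.
  by rewrite !ffunE /= eqxx.
have braidE (x y z w x' y' z' w' : 'I_N) :
    braid EndV EndV (x, y) (z, w) (x', y') (z', w')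
    = \sum_k \sum_d (\sum_c Psi k y c z * R w c w' d)
        * \sum_e R x' e x k * Rinv z' d y' e.
  by rewrite /= sum_prod.
have coef x' y' z' w' :
    \sum_j \sum_k R k b j a * braid EndV EndV (i, j) (k, l) (x', y') (z', w')
    = \sum_d \sum_e R l b w' d * (R x' e i a * Rinv z' d y' e).
  pose f k d := \sum_e R x' e i k * Rinv z' d y' e.
  (* The R between the two families is regrouped with Psi as [opposite_skew] followed by the
     braiding of V^* past V, which [skew_r] then replaces by Kronecker deltas. *)
  transitivity (\sum_p \sum_c
      (\sum_j \sum_k opposite_skew R a b j k * ext_braid R Rinv Psi true false j k p c)
      * \sum_d R l c w' d * f p d).
    under eq_bigr => j _ do (under eq_bigr => k _ do rewrite braidE mulr_sumr).
    rewrite sum_rotate; apply: eq_bigr => p _.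
    under [RHS]eq_bigr => c _ do rewrite mulr_suml.
    rewrite [RHS]exchange_big; apply: eq_bigr => j _ /=.
    under [RHS]eq_bigr => c _ do rewrite mulr_suml.
    rewrite [RHS]exchange_big; apply: eq_bigr => k _ /=.
    rewrite mulr_sumr; under [RHS]eq_bigr => c _ do rewrite mulr_sumr.
    rewrite [RHS]exchange_big; apply: eq_bigr => d _ /=.
    rewrite mulr_suml mulr_sumr; apply: eq_bigr => c _.
    by rewrite /opposite_skew /f /=; ring.
  under eq_bigr => p _ do (under eq_bigr => c _ do rewrite (skew_r hR) -mulrA).
  under eq_bigr => p _ do rewrite -mulr_sumr sum_delta_l.
  rewrite sum_delta_l; apply: eq_bigr => d _.
  by rewrite /f mulr_sumr.
have front4 (V : nmodType) (f : 'I_N -> 'I_N -> 'I_N -> 'I_N -> V) :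
    \sum_x \sum_y \sum_z \sum_w f x y z w = \sum_w \sum_x \sum_y \sum_z f x y z w.
  by under eq_bigr => x _ do rewrite sum_rotate; rewrite exchange_big.
rewrite mul_fmx_scalar sum_prod.
transitivity (\sum_x' \sum_y' \sum_z' \sum_w' \sum_d \sum_e
   (R l b w' d * (R x' e i a * Rinv z' d y' e)) *: (A (x', y') * B (z', w'))).
  under eq_bigr => j _ do (under eq_bigr => k _ do rewrite cross scaler_sumr).
  transitivity (\sum_j \sum_k \sum_x' \sum_y' \sum_z' \sum_w'
     (R k b j a * braid EndV EndV (i, j) (k, l) (x', y') (z', w'))
     *: (A (x', y') * B (z', w'))).
    apply: eq_bigr => j _; apply: eq_bigr => k _; rewrite sum_prod.
    apply: eq_bigr => x' _; apply: eq_bigr => y' _.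
    rewrite scaler_sumr sum_prod; apply: eq_bigr => z' _.
    by apply: eq_bigr => w' _; rewrite scalerA.
  do 4![rewrite sum_rotate; apply: eq_bigr => ? _].
  under eq_bigr => j _ do rewrite -scaler_suml.
  rewrite -scaler_suml coef scaler_suml; apply: eq_bigr => d _.
  by rewrite scaler_suml.
rewrite front4; apply: eq_bigr => w' _.
rewrite front4; apply: eq_bigr => d _.
rewrite -mulrA fmxM scaler_sumr sum_prod exchange_big; apply: eq_bigr => y' _ /=.
rewrite sum_rotate; apply: eq_bigr => e _.
rewrite !entry big_distrlr /= scaler_sumr; apply: eq_bigr => x' _.
rewrite scaler_sumr; apply: eq_bigr => z' _.
by rewrite -endo_scaleAl -endo_scaleAr !scalerA [tensor_mx R _]ffunE.
Qed.

Hypothesis hq : generic_parameter q.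
Hypothesis A_refl : reflection_family A.
Hypothesis B_refl : reflection_family B.

Lemma reflection_family_coproduct :
  reflection_family (fun g =>
    A g + B g - (q - q^-1) *: \sum_k A (g.1, k) * B (k, g.2)).
Proof.
have [q0 _] := hq; pose v := const_fmx Z (gens : finType) (q - q^-1).
apply/reflection_familyP.
have -> : family_mx (fun g =>
    A g + B g - (q - q^-1) *: \sum_k A (g.1, k) * B (k, g.2))
    = family_mx A + family_mx B - v * (family_mx A * family_mx B).
  apply/ffunP => -[[i a] [j b]].
  rewrite fmxB fmxD mul_const_fmx fmxM.
  rewrite sum_prod /=.
  have entry k c : family_mx A (i, a, (k, c)) * family_mx B (k, c, (j, b))
      = (a == c)%:R * ((c == b)%:R * (A (i, k) * B (k, j))).
    rewrite !ffunE /=; case: (a == c); case: (c == b);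
      by rewrite ?mul0r ?mulr0 ?mul1r.
  under [X in _ *: X]eq_bigr => k _ do
    (under eq_bigr => c _ do rewrite entry; rewrite sum_delta_l).
  rewrite -mulr_sumr !ffunE /=.
  by case: (a == b); rewrite ?mul1r ?mul0r ?scaler0 ?subr0 ?addr0.
apply: (@reflection_coproduct _ r ri v).
- by rewrite -scalar_fmxM (tensor_mx_inverse (R_Rinv hR)) scalar_fmx1.
- by rewrite -scalar_fmxM (tensor_mx_inverse (Rinv_R hR)) scalar_fmx1.
- rewrite -scalar_fmxM (tensor_mx_hecke q0) scalar_fmxD scalar_fmx1; congr (_ + _).
  apply/ffunP => p; rewrite mul_const_fmx !ffunE.
  by rewrite scalerA.
- by move=> x; rewrite const_fmx_central.
- exact/reflection_familyP.
- exact/reflection_familyP.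
- exact: family_cross.
- have [v0|v0] := eqVneq (q - q^-1) 0.
    left; apply/ffunP => p; rewrite -[v]mulr1 mul_const_fmx v0 scale0r.
    by rewrite ffunE.
  right; exists (const_fmx Z gens (q - q^-1)^-1).
  apply/ffunP => p; rewrite mul_const_fmx -[v]mulr1 mul_const_fmx scalerA.
  by rewrite mulVf // scale1r.
Qed.

End Coproduct.

End Families.

(** * The action on a tensor product *)

Section TensorOperators.
Variables (K : fieldType) (N m n : nat) (q : K) (R Rinv Psi : tensor4 K N).
Hypothesis hR : hecke_symmetry q m n R Rinv Psi.

Local Notation basis := (basis N).
Local Notation sp := (sp K N).
Local Notation braid X Y := (@braid K N R Rinv Psi X Y).
Local Notation gens := ('I_N * 'I_N)%type.
Local Notation gen := (generated m n q R Rinv Psi).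

Variables (A : lmodType K) (mul : A -> A -> A) (one : A) (l : gens -> A).
Hypothesis mul_1l : left_id one mul.
Hypothesis mul_1r : right_id one mul.

Variable M : forall X, A -> basis X -> basis X -> A.
Hypothesis M_lin : forall X y x, linear (fun b => @M X b y x).
Hypothesis M_one : forall X y x, @M X one y x = (y == x)%:R *: one.
Hypothesis M_mul : forall X b b' y x,
  @M X (mul b b') y x = \sum_z mul (@M X b y z) (@M X b' z x).
Hypothesis M_natural : forall X Y (f : 'Hom(sp X, sp Y)) b x y', gen f ->
  \sum_y mc f x y *: M b y' y = \sum_x' mc f x' y' *: M b x' x.
Hypothesis M_hexagon : forall X1 X2 b (y x : basis (ETens X1 X2)),
  M b y x = M (M b y.1 x.1) y.2 x.2.
Hypothesis M_gen1 : forall X (g : basis EndV) y x,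
  @M X (l g) y x = \sum_(h : basis EndV) braid EndV X g x y h *: l h.

Variables (U W : expr).
Variables (rhoU : A -> 'End(sp U)) (rhoW : A -> 'End(sp W)).
Hypothesis rhoU_lin : linear rhoU.
Hypothesis rhoW_lin : linear rhoW.
Hypothesis rhoU_mul : forall a b, rhoU (mul a b) = (rhoU a \o rhoU b)%VF.
Hypothesis rhoW_mul : forall a b, rhoW (mul a b) = (rhoW a \o rhoW b)%VF.

Local Notation Z := (ETens U W).
Local Notation E := (endo (sp Z)).

(** Here [b] moves past U and then acts on W through [rhoW]. On U it involves no projection, so that
    [past_op one] is the identity on U tensored with [rhoW one]. *)
Definition past_op (b : A) : E :=
  lmap (fun p : basis Z =>
    \sum_y tvec (bvec K y) (rhoW (M b y p.1) (bvec K p.2)) : sp Z).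

Definition first_op (a : A) : E := tmap (rhoU a) \1%VF.

Lemma mc_past_op b x w y w' :
  mc (past_op b) ((x, w) : basis Z) ((y, w') : basis Z) = mc (rhoW (M b y x)) w w'.
Proof.
rewrite mc_lmap sp_sumE (bigD1 y) //= [X in _ + X]big1 ?addr0.
  by rewrite tvecE bvecE eqxx mul1r.
by move=> z /negPf zy; rewrite tvecE bvecE eq_sym zy mul0r.
Qed.

Lemma mc_sum X Y (I : finType) (c : I -> K) (f : I -> 'Hom(sp X, sp Y)) x y :
  mc (\sum_i c i *: f i) x y = \sum_i c i * mc (f i) x y.
Proof.
rewrite /mc sum_lfunE sp_sumE; apply: eq_bigr => i _.
by rewrite scale_lfunE ffunE.
Qed.

Lemma past_op_lin : linear past_op.
Proof.
move=> c a b; apply: mcP => -[x w] [y w'].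
by rewrite mc_lin !mc_past_op M_lin rhoW_lin mc_lin.
Qed.

Lemma past_op_mul a b : past_op (mul a b) = past_op a * past_op b.
Proof.
apply: mcP => -[x w] [y w']; rewrite mc_past_op M_mul (lin_sum rhoW_lin).
under eq_bigr => z _ do rewrite rhoW_mul -[(_ \o _)%VF]scale1r.
rewrite mc_sum [RHS]mc_comp sum_prod; apply: eq_bigr => z _.
rewrite mul1r mc_comp; apply: eq_bigr => v _.
by rewrite !mc_past_op.
Qed.

Lemma past_op_one : past_op one = tmap \1%VF (rhoW one).
Proof.
apply: mcP => -[x w] [y w']; rewrite mc_past_op M_one (linZ rhoW_lin).
by rewrite mc_tmap mc_id eq_sym /mc scale_lfunE ffunE.
Qed.

Lemma past_op_natural b (f : 'End(sp U)) : gen f ->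
  past_op b * tmap f \1%VF = (tmap f \1%VF : E) * past_op b.
Proof.
move=> gf; apply: mcP => -[x w] [y w']; rewrite [LHS]mc_comp [RHS]mc_comp !sum_prod.
transitivity (mc (rhoW (\sum_z mc f x z *: M b y z)) w w').
  rewrite (lin_sum rhoW_lin).
  under [X in _ = mc X _ _]eq_bigr => z _ do rewrite (linZ rhoW_lin).
  rewrite mc_sum; apply: eq_bigr => z _; rewrite (bigD1 w) //=.
  rewrite [X in _ + X]big1 ?addr0; first by rewrite mc_tmap mc_id eqxx mulr1 mc_past_op.
  by move=> v /negPf vw; rewrite mc_tmap mc_id eq_sym vw mulr0 mul0r.
rewrite (M_natural _ _ _ gf) (lin_sum rhoW_lin).
under [X in mc X _ _ = _]eq_bigr => z _ do rewrite (linZ rhoW_lin).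
rewrite mc_sum; apply: eq_bigr => z _; rewrite (bigD1 w') //=.
rewrite [X in _ + X]big1 ?addr0; last first.
  by move=> v /negPf vw; rewrite mc_tmap mc_id vw !mulr0.
by rewrite mc_tmap mc_id eqxx mulr1 mc_past_op mulrC.
Qed.

Lemma first_op_lin : linear first_op.
Proof.
move=> c a b; apply: mcP => x y.
by rewrite mc_lin !mc_tmap rhoU_lin mc_lin mulrDl mulrA.
Qed.

Lemma first_op_mul a b : first_op (mul a b) = first_op a * first_op b.
Proof. by rewrite /first_op rhoU_mul -[RHS]/(_ \o _)%VF tmap_comp comp_lfun1l. Qed.

Definition rep_action : 'Hom(sp (ETens EndV U), sp U) :=
  lmap (fun p : basis (ETens EndV U) => rhoU (l p.1) (bvec K p.2)).

Hypothesis rep_action_gen : gen rep_action.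

(** This is where equivariance of [rhoU] enters: the braiding is natural for the action map from V
    (x) V^* (x) U to U, and by [M_hexagon] passing the source means passing the generator and then
    the vector. *)
Lemma past_op_cross b (g : basis EndV) :
  past_op b * first_op (l g)
  = \sum_(h : basis EndV) first_op (l h) * past_op (M b h g).
Proof.
apply: mcP => -[x w] [y w']; rewrite [LHS]mc_comp sum_prod.
have actE h u v : mc rep_action ((h, u) : basis (ETens EndV U)) v = mc (rhoU (l h)) u v.
  by rewrite mc_lmap.
transitivity (mc (rhoW (\sum_z mc rep_action (g, x) z *: M b y z)) w w').
  rewrite (lin_sum rhoW_lin).
  under [X in _ = mc X _ _]eq_bigr => z _ do rewrite (linZ rhoW_lin).
  rewrite mc_sum; apply: eq_bigr => z _; rewrite (bigD1 w) //= actE.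
  rewrite [X in _ + X]big1 ?addr0; first by rewrite mc_tmap mc_id eqxx mulr1 mc_past_op.
  by move=> v /negPf vw; rewrite mc_tmap mc_id eq_sym vw mulr0 mul0r.
rewrite (M_natural _ _ _ rep_action_gen) (lin_sum rhoW_lin).
under [X in mc X _ _ = _]eq_bigr => z _ do rewrite (linZ rhoW_lin).
rewrite mc_sum sum_prod.
under [X in _ = mc X _ _]eq_bigr => h _ do rewrite -[_ * _]scale1r.
rewrite mc_sum; apply: eq_bigr => h _; rewrite mul1r [RHS]mc_comp sum_prod.
apply: eq_bigr => z _; rewrite actE M_hexagon /= (bigD1 w') //=.
rewrite [X in _ + X]big1 ?addr0; last first.
  by move=> v /negPf vw; rewrite mc_tmap mc_id vw !mulr0.
by rewrite mc_tmap mc_id eqxx mulr1 mc_past_op mulrC.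
Qed.

Hypothesis one_gen : gen (rhoU one).

Lemma first_past_one a : past_op one * first_op a = first_op a * past_op one.
Proof.
rewrite past_op_one -[LHS]/(_ \o _)%VF -[RHS]/(_ \o _)%VF !tmap_comp.
by rewrite !comp_lfun1l !comp_lfun1r.
Qed.

Lemma past_first_one b : past_op b * first_op one = first_op one * past_op b.
Proof. exact: past_op_natural. Qed.

(** The operator of a (x) b on the ambient space. When [rhoU one] and [rhoW one] are projections,
    [tens_op one one] is the projection of U (x) W; the operators [tens_op a b] have it as a unit on
    both sides. *)
Definition tens_op (a b : A) : E := first_op a * past_op b.

Lemma tens_op_split a b : tens_op a one * tens_op one b = tens_op a b.
Proof.
rewrite /tens_op -mulrA [past_op one * _]mulrA past_first_one.
by rewrite -mulrA -past_op_mul mul_1l mulrA -first_op_mul mul_1r.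
Qed.

Lemma tens_op_cross (g h : basis EndV) :
  tens_op one (l g) * tens_op (l h) one
  = \sum_h' \sum_g' braid EndV EndV g h h' g'
      *: (tens_op (l h') one * tens_op one (l g')).
Proof.
rewrite {1 2}/tens_op -mulrA [past_op _ * _]mulrA past_op_cross.
rewrite mulr_suml mulr_sumr; apply: eq_bigr => h' _.
rewrite -mulrA -past_op_mul mul_1r mulrA -first_op_mul mul_1l M_gen1.
rewrite (lin_sum past_op_lin) mulr_sumr; apply: eq_bigr => g' _.
by rewrite (linZ past_op_lin) -endo_scaleAr tens_op_split.
Qed.

Lemma tens_op_idl a b : tens_op one one * tens_op a b = tens_op a b.
Proof.
rewrite /tens_op -mulrA [past_op one * _]mulrA first_past_one -mulrA.
by rewrite -past_op_mul mul_1l mulrA -first_op_mul mul_1l.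
Qed.

Lemma tens_op_idr a b : tens_op a b * tens_op one one = tens_op a b.
Proof.
rewrite /tens_op -mulrA [past_op b * _]mulrA past_first_one -mulrA.
by rewrite -past_op_mul mul_1r mulrA -first_op_mul mul_1r.
Qed.

Lemma tens_op_lin_l b : linear (tens_op^~ b).
Proof. by move=> c a a'; rewrite /tens_op first_op_lin mulrDl -endo_scaleAl. Qed.

Lemma tens_op_lin_r a : linear (tens_op a).
Proof. by move=> c b b'; rewrite /tens_op past_op_lin mulrDr -endo_scaleAr. Qed.

Lemma tens_op_mul a a' b' b :
  tens_op (mul a a') (mul b' b) = first_op a * tens_op a' b' * past_op b.
Proof. by rewrite /tens_op first_op_mul past_op_mul !mulrA. Qed.

(** One step of the fold in [braid_LL], seen on operators: moving a generator to the left of [b]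
    becomes right multiplication by its action on U. *)
Lemma tens_op_step a b (g : basis EndV) :
  \sum_(h : basis EndV) tens_op (mul a (l h)) (M b h g)
  = tens_op a b * first_op (l g).
Proof.
rewrite -mulrA past_op_cross mulr_sumr; apply: eq_bigr => h _.
by rewrite /tens_op first_op_mul mulrA.
Qed.

Lemma tens_op_comp a1 b1 a2 b2 :
  first_op a1 * (tens_op one b1 * first_op a2) * past_op b2
  = tens_op a1 b1 * tens_op a2 b2.
Proof. by rewrite /tens_op !mulrA -first_op_mul mul_1r. Qed.

Lemma tens_op_first_one b : tens_op one b * first_op one = tens_op one b.
Proof. by rewrite /tens_op -mulrA past_first_one mulrA -first_op_mul mul_1l. Qed.

Local Notation VVDD := (ETens (ETens EV EV) (ETens EVd EVd)).

Hypothesis l_rel : forall e : basis VVDD,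
  \sum_w mc (re_quad R \o re_ends R Rinv Psi)%VF e w *: mul (l w.1) (l w.2)
  = \sum_g mc (re_lin K N \o re_ends R Rinv Psi)%VF e g *: l g.

Lemma reflection_family_morph (f : A -> E) : linear f ->
  (forall a b, f (mul a b) = f a * f b) ->
  reflection_family R Rinv Psi (fun g => f (l g)).
Proof.
move=> f_lin f_mul e; have := congr1 f (l_rel e).
rewrite !(lin_sum f_lin) => re.
by etransitivity; last (etransitivity; first exact: re);
  apply: eq_bigr => w _; rewrite (linZ f_lin) ?f_mul.
Qed.

Definition coproduct_op (g : gens) : E :=
  tens_op (l g) one + tens_op one (l g)
  - (q - q^-1) *: \sum_k tens_op (l (g.1, k)) (l (k, g.2)).

Lemma coproduct_op_idl g : tens_op one one * coproduct_op g = coproduct_op g.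
Proof.
rewrite /coproduct_op mulrBr mulrDr !tens_op_idl -endo_scaleAr mulr_sumr.
by under eq_bigr => k _ do rewrite tens_op_idl.
Qed.

Lemma coproduct_op_idr g : coproduct_op g * tens_op one one = coproduct_op g.
Proof.
rewrite /coproduct_op mulrBl mulrDl !tens_op_idr -endo_scaleAl mulr_suml.
by under eq_bigr => k _ do rewrite tens_op_idr.
Qed.

Lemma reflection_family_coproduct_op : generic_parameter q ->
  reflection_family R Rinv Psi coproduct_op.
Proof.
move=> hq; have -> : coproduct_op = fun g =>
    tens_op (l g) one + tens_op one (l g)
    - (q - q^-1) *: \sum_k tens_op (l (g.1, k)) one * tens_op one (l (k, g.2)).
  apply: funext => g; rewrite /coproduct_op.
  by under [in RHS]eq_bigr => k _ do rewrite tens_op_split.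
apply: (reflection_family_coproduct hR (A := fun g => tens_op (l g) one)
  (B := fun g => tens_op one (l g))) => //.
- exact: tens_op_cross.
- apply: (reflection_family_morph (f := fun a => tens_op a one)) => [c a b|a b].
    by rewrite /tens_op first_op_lin mulrDl -endo_scaleAl.
  rewrite /tens_op -mulrA [past_op one * _]mulrA first_past_one -mulrA.
  by rewrite -past_op_mul mul_1l mulrA -first_op_mul.
- apply: (reflection_family_morph (f := fun b => tens_op one b)) => [c a b|a b].
    by rewrite /tens_op past_op_lin mulrDr -endo_scaleAr.
  rewrite /tens_op -mulrA [past_op a * _]mulrA past_first_one -mulrA.
  by rewrite -past_op_mul mulrA -first_op_mul mul_1l.
Qed.

Definition act_first : 'Hom(sp (ETens EndV Z), sp Z) :=
  (tmap rep_action \1 \o assocV K N EndV U W)%VF.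

Definition rep_actionW : 'Hom(sp (ETens EndV W), sp W) :=
  lmap (fun p : basis (ETens EndV W) => rhoW (l p.1) (bvec K p.2)).

Definition act_past : 'Hom(sp (ETens EndV Z), sp Z) :=
  (tmap \1 rep_actionW \o assoc K N U EndV W
    \o tmap (braiding R Rinv Psi EndV U) \1 \o assocV K N EndV U W)%VF.

(** The coproduct of the matrix coalgebra: the copairing inserts V^* (x) V between V and V^*. It
    yields the sum over k in the coproduct of a generator. *)
Definition matrix_coproduct : 'Hom(sp EndV, sp (ETens EndV EndV)) :=
  (assocV K N EV EVd EndV \o tmap \1 (assoc K N EVd EV EVd)
    \o tmap \1 (tmap (pi_r K N) \1) \o tmap \1 (lunitV K N EVd))%VF.

Lemma act_firstE (g : basis EndV) (p : basis Z) :
  act_first (bvec K ((g, p) : basis (ETens EndV Z))) = first_op (l g) (bvec K p).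
Proof.
case: p => x w; rewrite comp_lfunE assocV_bvec !tmap_bvec.
by rewrite lmap_bvec.
Qed.

Lemma act_pastE (g : basis EndV) (p : basis Z) :
  act_past (bvec K ((g, p) : basis (ETens EndV Z))) = past_op (l g) (bvec K p).
Proof.
case: p => x w; apply/ffunP => -[y w'].
rewrite -[RHS]/(mc _ _ _) mc_past_op M_gen1.
rewrite 3!comp_lfunE assocV_bvec tmap_bvec id_lfunE tmap_1_app.
rewrite mc_app sum_prod (lin_sum rhoW_lin) .
under [X in _ = mc X _ _]eq_bigr => h _ do rewrite (linZ rhoW_lin).
rewrite [RHS](mc_sum (fun h => braid EndV U g x y h) (fun h => rhoW (l h))).
apply: eq_bigr => h _; rewrite (bigD1 w) //=.
rewrite [X in _ + X]big1 ?addr0; last first.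
  move=> v /negPf vw; rewrite [X in X * _]ffunE.
  by rewrite (assocE (X := U) (Y := EndV) (Z := W) _ y h v) tvecE bvecE vw mulr0 mul0r.
rewrite [X in X * _]ffunE (assocE (X := U) (Y := EndV) (Z := W) _ y h w) tvecE bvecE eqxx mulr1 braiding_bvec.
by rewrite mc_lmap.
Qed.

Lemma matrix_coproductE (i j : 'I_N) :
  matrix_coproduct (bvec K ((i, j) : basis EndV))
  = \sum_k bvec K (((i, k), (k, j)) : basis (ETens EndV EndV)).
Proof.
apply/ffunP => -[[a b] [c d]]; rewrite 3!comp_lfunE tmap_bvec id_lfunE.
rewrite (assocVE (X := EV) (Y := EVd) (Z := EndV) _ a b (c, d)) tmap_1_app.
rewrite (assocE (X := EVd) (Y := EV) (Z := EVd) _ b c d) ffunE.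
rewrite lmap_bvec tvec_bvec tmap_bvec id_lfunE tvecE tmap_bvec id_lfunE tvecE.
rewrite -[pi_r K N _ _]/(mc _ _ _) mc_pi_r /=.
rewrite [RHS](sp_sumE (X := ETens EndV EndV)).
under [RHS]eq_bigr => k _ do rewrite bvecE.
transitivity (\sum_k (b == k)%:R * ((a == i)%:R * ((c == k)%:R * (d == j)%:R)) : K).
  by rewrite sum_delta_l !ffunE [c == b]eq_sym.
apply: eq_bigr => k _; rewrite -!natrM !mulnb; congr (nat_of_bool _)%:R.
transitivity ((a == i) && (b == k) && ((c == k) && (d == j))) => //.
by rewrite andbCA andbA.
Qed.

Lemma spZ X c (u : sp X) x : (c *: u) x = c * u x.
Proof. by rewrite ffunE. Qed.

Lemma tvec_suml X Y (I : finType) (u : I -> sp X) (v : sp Y) :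
  tvec (\sum_i u i) v = \sum_i tvec (u i) v.
Proof.
apply/ffunP => -[x y]; rewrite tvecE sp_sumE (sp_sumE (X := ETens X Y)) mulr_suml.
by apply: eq_bigr => i _; rewrite tvecE.
Qed.

Lemma tvec_expandr X Y (u : sp X) (v : sp Y) :
  tvec u v = \sum_y (v y : K) *: tvec u (bvec K y).
Proof.
apply/ffunP => -[x y]; rewrite tvecE (sp_sumE (X := ETens X Y)).
rewrite {1}[v]sp_expand sp_sumE mulr_sumr; apply: eq_bigr => z _.
by rewrite spZ (spZ (X := ETens X Y)) tvecE mulrCA.
Qed.

Lemma act_first_tvec (g : basis EndV) (u : sp Z) :
  act_first (tvec (bvec K g) u) = first_op (l g) u.
Proof.
rewrite tvec_expandr linear_sum [in RHS](sp_expand u) linear_sum.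
by apply: eq_bigr => p _; rewrite !linearZ /= tvec_bvec act_firstE.
Qed.

(** The action map of the tensor product, assembled from generating maps and the two given actions
    so that it is visibly a morphism. [rhoW one] and [rhoU one] account for the unit factors in l
    (x) 1 and 1 (x) l. *)
Definition coproduct_action : 'Hom(sp (ETens EndV Z), sp Z) :=
  ((tmap \1 (rhoW one) \o act_first) + (tmap (rhoU one) \1 \o act_past)
   - (q - q^-1) *: (act_first \o tmap \1 act_past \o assoc K N EndV EndV Z
        \o tmap matrix_coproduct \1))%VF.

Lemma coproduct_actionE (g : basis EndV) (p : basis Z) :
  coproduct_action (bvec K ((g, p) : basis (ETens EndV Z)))
  = coproduct_op g (bvec K p).
Proof.
rewrite /coproduct_action !add_lfunE !opp_lfunE !scale_lfunE !sum_lfunE.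
have -> : tens_op (l g) one (bvec K p)
    = (tmap \1 (rhoW one) \o act_first)%VF (bvec K ((g, p) : basis (ETens EndV Z))).
  by rewrite comp_lfunE act_firstE -past_op_one -endo_mulE first_past_one.
have -> : tens_op one (l g) (bvec K p)
    = (tmap (rhoU one) \1 \o act_past)%VF (bvec K ((g, p) : basis (ETens EndV Z))).
  by rewrite [RHS]comp_lfunE act_pastE [LHS]endo_mulE.
congr (_ + _ - _ *: _).
case: g => i j; rewrite 3!comp_lfunE tmap_bvec matrix_coproductE id_lfunE.
rewrite tvec_suml !linear_sum; apply: eq_bigr => k _ /=.
rewrite tvec_bvec assoc_bvec tmap_bvec id_lfunE act_pastE act_first_tvec.
by rewrite [RHS]endo_mulE.
Qed.

Lemma tens_opE a b x w :
  tens_op a b (bvec K ((x, w) : basis Z))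
  = \sum_y tvec (rhoU a (bvec K y)) (rhoW (M b y x) (bvec K w)).
Proof.
rewrite /tens_op endo_mulE [past_op b _]lmap_bvec linear_sum.
by apply: eq_bigr => y _; rewrite [LHS]tmap_tvec id_lfunE.
Qed.

Lemma tens_op_one : tens_op one one = tmap (rhoU one) (rhoW one).
Proof.
by rewrite /tens_op past_op_one -[LHS]/(_ \o _)%VF tmap_comp comp_lfun1r comp_lfun1l.
Qed.

Hypothesis rep_actionW_gen : gen rep_actionW.
Hypothesis oneW_gen : gen (rhoW one).

Lemma act_first_gen : gen act_first.
Proof.
apply: Gen_comp; last exact: Gen_assocV.
by apply: Gen_tens; [exact: rep_action_gen|exact: Gen_id].
Qed.

Lemma act_past_gen : gen act_past.
Proof.
apply: Gen_comp; last exact: Gen_assocV.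
apply: Gen_comp; last by apply: Gen_tens; [exact: Gen_braiding|exact: Gen_id].
apply: Gen_comp; last exact: Gen_assoc.
by apply: Gen_tens; [exact: Gen_id|exact: rep_actionW_gen].
Qed.

Lemma matrix_coproduct_gen : gen matrix_coproduct.
Proof.
have idt X Y f : gen f -> gen (tmap (\1%VF : 'End(sp EV)) (f : 'Hom(sp X, sp Y))).
  by move=> gf; apply: Gen_tens; first exact: Gen_id.
apply: Gen_comp; last by apply: idt; apply: Gen_lunitV.
apply: Gen_comp; last first.
  by apply: idt; apply: Gen_tens; [exact: Gen_pi_r|exact: Gen_id].
by apply: Gen_comp; [exact: Gen_assocV|apply: idt; exact: Gen_assoc].
Qed.

Lemma coproduct_action_gen : gen coproduct_action.
Proof.
rewrite /coproduct_action addrC -scaleNr; apply: Gen_lin.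
  apply: Gen_comp; last by apply: Gen_tens; [exact: matrix_coproduct_gen|exact: Gen_id].
  apply: Gen_comp; last exact: Gen_assoc.
  apply: Gen_comp; first exact: act_first_gen.
  by apply: Gen_tens; [exact: Gen_id|exact: act_past_gen].
rewrite -[X in X + _]scale1r; apply: Gen_lin.
  apply: Gen_comp; last exact: act_first_gen.
  by apply: Gen_tens; [exact: Gen_id|exact: oneW_gen].
apply: Gen_comp; last exact: act_past_gen.
by apply: Gen_tens; [exact: one_gen|exact: Gen_id].
Qed.

End TensorOperators.

(** * ** Evaluating words and tensors under linear maps *)

Section WordLemmas.
Variables (K : fieldType) (G : choiceType).

Lemma wact_morph (M M' : lmodType K) (act : G -> M -> M) (act' : G -> M' -> M')
    (f : M -> M') p t : linear f ->
  (forall g u, f (act g u) = act' g (f u)) ->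
  f (wact act p t) = wact act' p (f t).
Proof.
move=> f_lin f_act; rewrite /wact /linext (lin_sum f_lin); apply: eq_bigr => w _.
rewrite (linZ f_lin); congr (_ *: _).
by elim: (fmonom_val w) => [|g s IH] //=; rewrite f_act IH.
Qed.

Lemma wact_ind (M : lmodType K) (act : G -> M -> M) (P : M -> Prop) p t :
  (forall c a b, P a -> P b -> P (c *: a + b)) -> P t ->
  (forall g a, P a -> P (act g a)) -> P (wact act p t).
Proof.
move=> P_lin Pt P_act.
have P0 : P 0 by have := P_lin (-1) _ _ Pt Pt; rewrite scaleN1r addNr.
rewrite /wact /linext; apply: big_ind => // [a b Pa Pb|w _].
  by rewrite -[a]scale1r; apply: P_lin.
rewrite -[_ *: _]addr0; apply: P_lin => //.
by elim: (fmonom_val w) => [|g s IH] //=; apply: P_act.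
Qed.

Lemma freealg_word (w : seq G) :
  foldr (fun g x => fgen K g * x) 1 w = mkmalgU (FMonom w) 1 :> freealg K G.
Proof.
elim: w => [|g w IH] /=; first by rewrite -fmoneE.
rewrite IH [LHS]fgmulUU mulr1.
by congr (mkmalgU _ _); rewrite [LHS]fmmulE fmuE.
Qed.

Lemma wact_free (p : freealg K G) : p = wact (fun g x => fgen K g * x) p 1.
Proof.
rewrite {1}[p]malg_expand /wact /linext; apply: eq_bigr => w _.
by rewrite freealg_word; case: w.
Qed.

End WordLemmas.

Lemma ev_comm (K : fieldType) (N : nat) (Z : vectType K)
    (X : 'I_N * 'I_N -> endo Z) p f :
  (forall g, f * X g = X g * f) -> f * ev X p = ev X p * f.
Proof.
move=> fX; have f_lin : linear (fun u : endo Z => f * u).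
  by move=> c u v; rewrite mulrDr -endo_scaleAr.
rewrite -[RHS]wact_ev -[X in wact _ _ X](mulr1 f).
by apply: (wact_morph _ _ f_lin) => g u; rewrite !mulrA fX.
Qed.

Section TensorLift.
Variables (K : fieldType) (A B : lmodType K).

(** Both lifts evaluate the same representative of [t], so the identity holds for arbitrary [f] and
    [g]. Thus [braid_LL] and [star] can be computed under a linear map before anything is known
    about their dependence on representatives. *)
Lemma tlift_comp (V W : lmodType K) (phi : V -> W) (f : A -> B -> V)
    (g : A -> B -> W) t : linear phi -> (forall a b, phi (f a b) = g a b) ->
  phi (tlift f t) = tlift g t.
Proof.
move=> phi_lin fg; rewrite /tlift /linext (lin_sum phi_lin).
by apply: eq_bigr => p _; rewrite (linZ phi_lin) fg.
Qed.

End TensorLift.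

(** * ** The algebra L(R_q,1) and its braiding past an object *)

Section Concrete.
Variables (K : fieldType) (N m n : nat) (q : K) (R Rinv Psi : tensor4 K N).
Hypothesis hR : hecke_symmetry q m n R Rinv Psi.

Local Notation basis := (basis N).
Local Notation sp := (sp K N).
Local Notation braid X Y := (@braid K N R Rinv Psi X Y).
Local Notation gens := ('I_N * 'I_N)%type.
Local Notation VVDD := (ETens (ETens EV EV) (ETens EVd EVd)).
Local Notation L := (mrea R).

Definition mrea_mul (x y : L) : L := x * y.
Definition mrea_one : L := 1.

Lemma mrea_mul_lin_l b : linear (mrea_mul^~ b).
Proof.
move=> c x y; rewrite /mrea_mul.
have -> : (c *: x + y) * b = (c *: x) * b + y * b := mulrDl _ _ _.
by congr (_ + _); rewrite -[LHS]qalg_scaleAl.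
Qed.

Lemma mrea_mul_lin_r a : linear (mrea_mul a).
Proof.
move=> c x y; rewrite /mrea_mul.
have -> : a * (c *: x + y) = a * (c *: x) + a * y := mulrDr _ _ _.
by congr (_ + _); rewrite -[LHS]qalg_scaleAr.
Qed.

Lemma mrea_mulA : associative mrea_mul.
Proof. exact: mulrA. Qed.

Lemma mrea_mul1l : left_id mrea_one mrea_mul.
Proof. exact: mul1r. Qed.

Lemma mrea_mul1r : right_id mrea_one mrea_mul.
Proof. exact: mulr1. Qed.

Local Notation pi := (qapi (re_rel R)).

Lemma mrea_piM p r : pi (p * r) = mrea_mul (pi p) (pi r).
Proof. exact: qapiM. Qed.

Lemma mrea_rel (e : basis VVDD) :
  \sum_w mc (re_quad R \o re_ends R Rinv Psi)%VF e w
    *: mrea_mul (lgen R w.1) (lgen R w.2)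
  = \sum_g mc (re_lin K N \o re_ends R Rinv Psi)%VF e g *: lgen R g.
Proof.
apply/eqP; rewrite -subr_eq0; apply/eqP.
have re0 : pi (re_elt R Rinv Psi e) = 0.
  by apply: qapi_rel; apply/(re_relP R Rinv Psi); exists e.
rewrite -{}[RHS]re0; symmetry.
apply: (lin_comb (qapi_is_linear (re_rel R))) => [w|g //].
exact: mrea_piM.
Qed.

Lemma pi_wact p : pi p = wact (fun g b => mrea_mul (lgen R g) b) p mrea_one.
Proof.
rewrite {1}[p]wact_free.
apply: (wact_morph _ _ (qapi_is_linear (re_rel R))) => g u.
exact: mrea_piM.
Qed.

Lemma mrea_ind (P : L -> Prop) :
  (forall c a b, P a -> P b -> P (c *: a + b)) -> P mrea_one ->
  (forall g a, P a -> P (mrea_mul (lgen R g) a)) -> forall a, P a.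
Proof.
move=> P_lin P1 P_gen a; rewrite -[a](@qapiK _ _ (re_rel R)) pi_wact.
exact: wact_ind.
Qed.

Definition braid_mx X (b : L) (y x : basis X) : L := braid_LX Rinv Psi b (bvec K x) y.

(** Here the representative used by [braid_LX] is replaced by an arbitrary one, which gives
    linearity and the recursion on generators. *)
Lemma braid_mx_pi X p (y x : basis X) :
  braid_mx (pi p) y x
  = wact (@gen_act K N R Rinv Psi L mrea_mul (lgen R) X) p
      ([ffun z => (bvec K x z : K) *: mrea_one] : {ffun basis X -> L}) y.
Proof.
have act_lin : forall g, linear (@gen_act K N R Rinv Psi L mrea_mul (lgen R) X g).
  by move=> g; apply: gen_act_lin; apply: mrea_mul_lin_r.
have act_rel z t : re_rel R z ->
    wact (@gen_act K N R Rinv Psi L mrea_mul (lgen R) X) z t = 0.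
  by apply: (gen_act_rel hR);
    [exact: mrea_mul_lin_l|exact: mrea_mul_lin_r|exact: mrea_mulA|exact: mrea_rel].
have := alift_wact act_lin act_rel p
  ([ffun z => (bvec K x z : K) *: mrea_one] : {ffun basis X -> L}).
exact: (congr1 (fun t : {ffun basis X -> L} => t y)).
Qed.

Lemma braid_mx_lin X (y x : basis X) : linear (fun b => braid_mx b y x).
Proof.
move=> c a b; rewrite -[a](@qapiK _ _ (re_rel R)) -[b](@qapiK _ _ (re_rel R)).
rewrite -(qapi_is_linear (re_rel R)) !braid_mx_pi.
by rewrite (wact_lin_l _ _ c) !ffunE.
Qed.

Lemma braid_mx_one X (y x : basis X) :
  braid_mx mrea_one y x = (y == x)%:R *: mrea_one.
Proof. by rewrite [LHS]braid_mx_pi wact1 !ffunE. Qed.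

Lemma braid_mx_gen X g b (y x : basis X) :
  braid_mx (mrea_mul (lgen R g) b) y x
  = \sum_z \sum_(h : gens)
      braid EndV X g z y h *: mrea_mul (lgen R h) (braid_mx b z x).
Proof.
rewrite -[b](@qapiK _ _ (re_rel R)) -[mrea_mul _ _]mrea_piM !braid_mx_pi.
rewrite wactM ?wact_gen; last by move=> k; apply: gen_act_lin; exact: mrea_mul_lin_r.
rewrite ffunE; apply: eq_bigr => z _; apply: eq_bigr => h _.
by rewrite braid_mx_pi.
Qed.

Lemma braid_mx_mul X b b' (y x : basis X) :
  braid_mx (mrea_mul b b') y x
  = \sum_z mrea_mul (braid_mx b y z) (braid_mx b' z x).
Proof.
exact: (M_mul mrea_mul_lin_l mrea_mul_lin_r mrea_mulA mrea_mul1l mrea_ind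
  braid_mx_lin braid_mx_one braid_mx_gen).
Qed.

Lemma braid_mx_natural X Y (f : 'Hom(sp X, sp Y)) b x y' :
  generated m n q R Rinv Psi f ->
  \sum_y mc f x y *: braid_mx b y' y = \sum_x' mc f x' y' *: braid_mx b x' x.
Proof.
exact: (M_natural hR mrea_mul_lin_r mrea_ind braid_mx_lin braid_mx_one braid_mx_gen).
Qed.

Lemma braid_mx_hexagon X1 X2 b (y x : basis (ETens X1 X2)) :
  braid_mx b y x = braid_mx (braid_mx b y.1 x.1) y.2 x.2.
Proof.
exact: (M_hexagon mrea_ind braid_mx_lin braid_mx_one braid_mx_gen).
Qed.

Lemma braid_mx_gen1 X (g : basis EndV) (y x : basis X) :
  braid_mx (lgen R g) y x
  = \sum_(h : basis EndV) braid EndV X g x y h *: lgen R h.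
Proof.
exact: (M_gen1 mrea_mul_lin_r braid_mx_one braid_mx_gen _ _ _ mrea_mul1r).
Qed.

End Concrete.

Lemma mul_idem_comm (A : pzRingType) (x y e : A) :
  e * e = e -> e * y = y * e -> x * y * e = x * e * (y * e).
Proof. by move=> ee ey; rewrite -mulrA -[RHS]mulrA [e * _]mulrA ey -mulrA ee. Qed.

(** * ** The representation on the tensor product *)

Section TensorRepresentation.
Variables (K : fieldType) (N m n : nat) (q : K) (R Rinv Psi : tensor4 K N).
Hypothesis hq : generic_parameter q.
Hypothesis hR : hecke_symmetry q m n R Rinv Psi.

Local Notation sp := (sp K N).
Local Notation gens := ('I_N * 'I_N)%type.
Local Notation L := (mrea R).
Local Notation gen := (generated m n q R Rinv Psi).
Local Notation braid_mx := (@braid_mx K N R Rinv Psi).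
Local Notation one := (mrea_one R).

Variables (U W : robj K N).
Variables (rhoU : L -> 'End(sp (amb U))) (rhoW : L -> 'End(sp (amb W))).
Hypothesis rhoU_rep : representation rhoU.
Hypothesis rhoW_rep : representation rhoW.
Hypothesis projU_gen : gen (proj U).
Hypothesis projW_gen : gen (proj W).
Hypothesis actU_gen : gen (action_map rhoU).
Hypothesis actW_gen : gen (action_map rhoW).

Local Notation Z := (ETens (amb U) (amb W)).
Local Notation E := (endo (sp Z)).
Local Notation fo := (first_op (amb W) rhoU).
Local Notation po := (past_op braid_mx (amb U) rhoW).
Local Notation T := (tens_op braid_mx rhoU rhoW).
Local Notation C := (coproduct_op q one (lgen R) braid_mx rhoU rhoW).

Let rhoU_lin : linear rhoU. Proof. by case: rhoU_rep. Qed.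
Let rhoW_lin : linear rhoW. Proof. by case: rhoW_rep. Qed.
Let rhoU_one : rhoU one = proj U. Proof. by case: rhoU_rep. Qed.
Let rhoW_one : rhoW one = proj W. Proof. by case: rhoW_rep. Qed.
Let rhoU_mul a b : rhoU (mrea_mul a b) = (rhoU a \o rhoU b)%VF.
Proof. by case: rhoU_rep => _ _; apply. Qed.
Let rhoW_mul a b : rhoW (mrea_mul a b) = (rhoW a \o rhoW b)%VF.
Proof. by case: rhoW_rep => _ _; apply. Qed.
Let oneU_gen : gen (rhoU one). Proof. by rewrite rhoU_one. Qed.
Let oneW_gen : gen (rhoW one). Proof. by rewrite rhoW_one. Qed.
Let mx_lin := @braid_mx_lin K N m n q R Rinv Psi hR.
Let mx_one := @braid_mx_one K N m n q R Rinv Psi hR.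
Let mx_mul := @braid_mx_mul K N m n q R Rinv Psi hR.
Let mx_nat := @braid_mx_natural K N m n q R Rinv Psi hR.
Let mx_hex := @braid_mx_hexagon K N m n q R Rinv Psi hR.
Let mx_gen1 := @braid_mx_gen1 K N m n q R Rinv Psi hR.
Let L1l := @mrea_mul1l K N R.
Let L1r := @mrea_mul1r K N R.

Let T_lin_l b : linear (T^~ b).
Proof. exact: (tens_op_lin_l _ _ rhoU_lin). Qed.

Let T_lin_r a : linear (T a).
Proof. exact: (tens_op_lin_r mx_lin _ rhoW_lin). Qed.

Lemma rho_tens_lift t :
  rho_tens Rinv Psi rhoU rhoW t = tlift T t.
Proof.
congr (tlift _ t); apply: funext => a; apply: funext => b.
apply: lfun_bvecP => -[x w]; rewrite lmap_bvec tens_opE.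
by [].
Qed.

Local Notation rho := (tlift T).

Let rho_lin : linear rho.
Proof. by move=> c s t; rewrite (tlift_is_linear T_lin_l T_lin_r). Qed.

Let rho_ten a b : rho (tenL a b) = T a b.
Proof. exact: (tlift_ten T_lin_l T_lin_r). Qed.

Lemma rho_Delta_gen g : rho (Delta_gen q R g) = C g.
Proof.
by apply: (lin_addsub rho_lin) => [||k]; exact: rho_ten.
Qed.

(** By [tens_op_step], each generator of the chosen representative of [a] contributes its action on
    U as a factor on the right, and the product of these factors no longer depends on the
    representative. *)
Lemma rho_braid_LL b a : rho (braid_LL Rinv Psi b a) = T one b * fo a.
Proof.
pose step (t : LL R) (g : gens) := tlift (fun a' b' : L =>
  \sum_(h : gens) tenL (a' * lgen R h) (@braid_LX K N R Rinv Psi EndV b' (@bvec K N EndV g) h)) t.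
pose wo (w : seq gens) : E := foldr (fun g f => fo (lgen R g) * f) 1 w.
have step_rho t g : rho (step t g) = rho t * fo (lgen R g).
  have r_lin : linear (fun f : E => f * fo (lgen R g)).
    by move=> c u v; rewrite mulrDl -endo_scaleAl.
  transitivity (tlift (fun a' b' => T a' b' * fo (lgen R g)) t).
    apply: (tlift_comp _ rho_lin) => a' b'; rewrite (lin_sum rho_lin).
    rewrite -(tens_op_step mx_nat mx_hex rhoW_lin rhoU_mul actU_gen).
    by apply: eq_bigr => h _; rewrite rho_ten.
  by symmetry; apply: (tlift_comp _ r_lin).
have fold_rho w t : rho (foldl step t w) = rho t * wo w.
  elim: w t => [|g w IH] t /=; first by rewrite mulr1.
  by rewrite IH step_rho mulrA.
have T_wo_lin : linear (fun f : E => T one b * f).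
  by move=> c u v; rewrite mulrDr -endo_scaleAr.
transitivity (T one b * ev (fun g => fo (lgen R g)) (qrepr a)).
  transitivity (linext (fun w : {fmonom gens} => T one b * wo w) (qrepr a)).
    rewrite /linext [LHS](lin_sum rho_lin); apply: eq_bigr => w _.
    by rewrite (linZ rho_lin) fold_rho rho_ten.
  rewrite /ev /wact /linext (lin_sum T_wo_lin); apply: eq_bigr => w _.
  by rewrite (linZ T_wo_lin).
have fo1 x : fo one * fo x = fo x * fo one.
  by rewrite -!(first_op_mul _ rhoU_mul) L1l L1r.
(* The empty word evaluates to the identity under [ev], but the unit of the algebra goes to the
   projection [fo one]. The missing factor is absorbed by [T one b]. *)
have -> : fo a = ev (fun g => fo (lgen R g)) (qrepr a) * fo one.
  rewrite -wact_ev -[a in LHS](@qapiK _ _ (re_rel R)) pi_wact.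
  apply: (wact_morph _ _ (first_op_lin _ rhoU_lin)) => g u.
  exact: (first_op_mul _ rhoU_mul).
rewrite -(@ev_comm K N (sp Z) (fun g => fo (lgen R g)) (qrepr a) (fo one)) // mulrA.
by rewrite (tens_op_first_one L1l mx_nat rhoW_lin rhoU_mul oneU_gen).
Qed.

(** The braided product is made for this: exchanging [b1] and [a2] by the braiding is the exchange
    of the operators of 1 (x) b1 and a2 (x) 1. *)
Lemma rho_star s t : rho (star Rinv Psi s t) = rho s * rho t.
Proof.
have l_lin (f : E) : linear (fun u : E => f * u).
  by move=> c u v; rewrite mulrDr -endo_scaleAr.
have r_lin (f : E) : linear (fun u : E => u * f).
  by move=> c u v; rewrite mulrDl -endo_scaleAl.
have lr_lin (f g : E) : linear (fun u : E => f * u * g).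
  by move=> c u v; rewrite l_lin r_lin.
transitivity (tlift (fun a b => T a b * rho t) s); last first.
  by symmetry; apply: (tlift_comp _ (r_lin _)).
apply: (tlift_comp _ rho_lin) => a1 b1.
transitivity (tlift (fun a b => T a1 b1 * T a b) t); last first.
  by symmetry; apply: (tlift_comp _ (l_lin _)).
apply: (tlift_comp _ rho_lin) => a2 b2.
transitivity (fo a1 * rho (braid_LL Rinv Psi b1 a2) * po b2).
  transitivity (tlift (fun a b => fo a1 * T a b * po b2) (braid_LL Rinv Psi b1 a2)).
    apply: (tlift_comp _ rho_lin) => a b; rewrite rho_ten.
    exact: (tens_op_mul mx_mul rhoW_lin rhoU_mul rhoW_mul).
  exact: esym (@tlift_comp K L L E E (fun u : E => fo a1 * u * po b2) T
    (fun a b => fo a1 * T a b * po b2) _ (lr_lin (fo a1) (po b2)) (fun _ _ => erefl)).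
rewrite rho_braid_LL.
exact: (tens_op_comp L1r _ _ rhoU_mul).
Qed.

Local Notation D := (Delta q Rinv Psi).
Let E0 : E := T one one.

Lemma rho_Delta_word (a : L) :
  rho (D a) = wact (fun g (f : E) => C g * f) (qrepr a) E0.
Proof.
rewrite /Delta /alift /wact /linext (lin_sum rho_lin); apply: eq_bigr => w _.
rewrite (linZ rho_lin); congr (_ *: _).
elim: (fmonom_val w) => [|g s IH] /=; first exact: rho_ten.
by rewrite rho_star rho_Delta_gen IH.
Qed.

Lemma ev_C_rel x : re_rel R x -> ev C x = 0.
Proof.
move=> /(re_relP R Rinv Psi) [e ->].
have C_family : reflection_family R Rinv Psi C.
  exact: (reflection_family_coproduct_op hR L1l L1r mx_lin mx_one mx_mul mx_nat
    mx_hex mx_gen1 rhoU_lin rhoW_lin rhoU_mul rhoW_mul actU_gen oneU_gen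
    (mrea_rel R Rinv Psi) hq).
by move/reflection_family_ev: C_family; apply.
Qed.

(** The representative chosen in [Delta] drops out under [rho], because the operators [C g] satisfy
    the defining relations. [E0] is the value at the empty word. *)
Lemma rho_Delta_pi p : rho (D (qapi (re_rel R) p)) = ev C p * E0.
Proof.
rewrite rho_Delta_word -[RHS]wact_ev.
have C_rel x (t : E) : re_rel R x -> wact (fun g (f : E) => C g * f) x t = 0.
  by move=> /ev_C_rel xC; rewrite wact_ev xC mul0r.
exact: (alift_wact (ev_act_lin C) C_rel).
Qed.

Local Notation rhoD := (fun a : L => rho (D a)).

Let E0C g : E0 * C g = C g.
Proof.
exact: (coproduct_op_idl q (lgen R) L1l mx_one mx_mul rhoW_lin rhoU_mul rhoW_mul).
Qed.

Let CE0 g : C g * E0 = C g.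
Proof.
exact: (coproduct_op_idr (lgen R) L1r mx_mul mx_nat rhoW_lin rhoU_mul rhoW_mul
  oneU_gen).
Qed.

Let E0E0 : E0 * E0 = E0.
Proof. exact: (tens_op_idl L1l mx_one mx_mul rhoW_lin rhoU_mul rhoW_mul). Qed.

Lemma rho_Delta_one : rhoD one = E0.
Proof. by rewrite [LHS]rho_Delta_pi ev1 mul1r. Qed.

Lemma E0_proj : E0 = tmap (proj U) (proj W).
Proof. by rewrite -rhoU_one -rhoW_one; exact: (tens_op_one mx_one rhoU rhoW_lin). Qed.

Lemma rho_Delta_mul a b : rhoD (mrea_mul a b) = rhoD a * rhoD b.
Proof.
rewrite -[a](@qapiK _ _ (re_rel R)) -[b](@qapiK _ _ (re_rel R)) -mrea_piM.
apply: etrans (rho_Delta_pi _) _.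
apply: etrans (esym (congr2 *%R (rho_Delta_pi _) (rho_Delta_pi _))).
set x := ev C (qrepr a); set y := ev C (qrepr b).
have -> : ev C (qrepr a * qrepr b) = x * y by exact: ev_mul.
(* Each factor carries its own [E0]; being idempotent and commuting with the operators, the two
   merge into one. *)
have E0y : E0 * y = y * E0 by apply: ev_comm => g; rewrite E0C CE0.
exact: mul_idem_comm E0E0 E0y.
Qed.

Lemma rho_Delta_lin : linear rhoD.
Proof.
move=> c a b; rewrite -[a](@qapiK _ _ (re_rel R)) -[b](@qapiK _ _ (re_rel R)).
rewrite -(qapi_is_linear (re_rel R)); apply: etrans (rho_Delta_pi _) _.
apply: etrans (esym (congr2 (fun f g : E => c *: f + g) (rho_Delta_pi _) (rho_Delta_pi _))).
by rewrite (ev_lin C c) mulrDl -endo_scaleAl.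
Qed.

Lemma rho_Delta_lgen g : rhoD (lgen R g) = C g.
Proof. by rewrite [LHS]rho_Delta_pi ev_gen CE0. Qed.

Lemma rho_Delta_representation : @representation K N R (rtens U W) rhoD.
Proof.
split; first exact: rho_Delta_lin.
  exact: etrans rho_Delta_one E0_proj.
exact: rho_Delta_mul.
Qed.

Local Notation act := (coproduct_action q R Rinv Psi one (lgen R) rhoU rhoW).

Lemma rho_Delta_action : @action_map K N R (rtens U W) rhoD = act.
Proof.
apply: lfun_bvecP => -[g p]; rewrite [LHS]lmap_bvec rho_Delta_lgen.
by rewrite (coproduct_actionE q mx_one mx_gen1 rhoU rhoW_lin).
Qed.

Lemma act_tvec g u : act (tvec (bvec K (g : basis N EndV)) u) = C g u.
Proof.
rewrite tvec_expandr linear_sum [in RHS](sp_expand u) linear_sum.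
apply: eq_bigr => p _; rewrite !linearZ /= tvec_bvec.
by rewrite (coproduct_actionE q mx_one mx_gen1 rhoU rhoW_lin).
Qed.

Lemma rho_Delta_morphism :
  @SW_morphism K N m n q R Rinv Psi (rtens (EndV_obj K N) (rtens U W)) (rtens U W)
    (@action_map K N R (rtens U W) rhoD).
Proof.
rewrite rho_Delta_action; split.
  exact: (coproduct_action_gen actU_gen oneU_gen actW_gen oneW_gen).
have -> : proj (rtens U W) = E0 by rewrite E0_proj.
have -> : proj (rtens (EndV_obj K N) (rtens U W)) = tmap \1%VF (E0 : 'End(sp Z)).
  by rewrite E0_proj.
apply: lfun_bvecP => -[g p]; rewrite 2!comp_lfunE tmap_bvec id_lfunE act_tvec.
transitivity (C g (bvec K (p : basis N Z))).
  exact: (coproduct_actionE q mx_one mx_gen1 rhoU rhoW_lin).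
(* The operators of the generators already absorb the projection of U (x) W on both sides, which is
   the condition for a map between realized objects. *)
have CE : E0 * (C g * E0) = C g by rewrite CE0 E0C.
by rewrite -[in LHS]CE [LHS]endo_mulE; congr (_ _); rewrite [LHS]endo_mulE.
Qed.

End TensorRepresentation.

(** * ** Projections of objects as generated maps *)

Section ObjectProjections.
Variables (K : fieldType) (N m n : nat) (q : K) (R Rinv Psi : tensor4 K N).

Local Notation sp := (sp K N).
Local Notation gen := (generated m n q R Rinv Psi).

Lemma generatedD X Y (f g : 'Hom(sp X, sp Y)) : gen f -> gen g -> gen (f + g).
Proof. by rewrite -[f in f + g]scale1r; apply: Gen_lin. Qed.

Lemma generatedZ X Y c (f : 'Hom(sp X, sp Y)) : gen f -> gen (c *: f).
Proof. by move=> gf; rewrite -[_ *: _]addr0; apply: Gen_lin => //; apply: Gen_0. Qed.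

Lemma at_pos_generated Z (r : 'End(sp (ETens Z Z))) k i : gen r -> gen (at_pos r k i).
Proof.
move=> gr; elim: k i => [|k IH] [|i] /=; try exact: Gen_0.
  case: k {IH} => [|k]; first exact: Gen_0.
  apply: Gen_comp; last exact: Gen_assocV.
  apply: Gen_comp; first exact: Gen_assoc.
  by apply: Gen_tens => //; apply: Gen_id.
by apply: Gen_tens; [exact: Gen_id|exact: IH].
Qed.

Lemma hecke_act_generated Z (r : 'End(sp (ETens Z Z))) k (e : hecke q k) :
  gen r -> gen (hecke_act r e).
Proof.
move=> gr; rewrite /hecke_act /alift /linext; apply: big_ind.
- exact: Gen_0.
- by move=> f g; apply: generatedD.
move=> w _; apply: generatedZ; elim: (fmonom_val w) => [|j s IH] /=.
  exact: Gen_id.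
by apply: Gen_comp => //; apply: at_pos_generated.
Qed.

(** Idempotents of Hecke algebras act through combinations of braidings. This matters because
    elements of L(R_q,1) have to pass rho_U(1), the projection of U, and because the projections of
    U and W both enter [coproduct_action]. *)
Lemma SW_object_generated (U : robj K N) :
  SW_object q R Rinv Psi U -> gen (proj U).
Proof.
elim=> {U} [k l lam mu e f _ _ _ _|k l lam mu e f _ _ _ _|U W _ gU _ gW|U W _ gU _ gW] /=.
- by apply: Gen_tens; apply: hecke_act_generated; apply: Gen_braiding.
- by apply: Gen_tens; apply: hecke_act_generated; apply: Gen_braiding.
- apply: generatedD; apply: Gen_comp; try exact: Gen_prj1; try exact: Gen_prj2;
  by apply: Gen_comp => //; [exact: Gen_inj1 || exact: Gen_inj2].
exact: Gen_tens.
Qed.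

End ObjectProjections.

Theorem corollary29 (K : fieldType) (N m n : nat) (q : K)
    (R Rinv Psi : tensor4 K N)
    (hq : generic_parameter q)
    (hR : hecke_symmetry q m n R Rinv Psi)
    (U W : robj K N)
    (hU : SW_object q R Rinv Psi U)
    (hW : SW_object q R Rinv Psi W)
    (rhoU : mrea R -> 'End(sp K N (amb U)))
    (rhoW : mrea R -> 'End(sp K N (amb W)))
    (hrhoU : equivariant_representation m n q Rinv Psi rhoU)
    (hrhoW : equivariant_representation m n q Rinv Psi rhoW) :
  equivariant_representation (U := rtens U W) m n q Rinv Psi
    (fun a : mrea R => rho_tens Rinv Psi rhoU rhoW (Delta q Rinv Psi a)).
Proof.
have -> : (fun a : mrea R => rho_tens Rinv Psi rhoU rhoW (Delta q Rinv Psi a))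
    = fun a => tlift (tens_op (@braid_mx K N R Rinv Psi) rhoU rhoW) (Delta q Rinv Psi a).
  by apply: funext => a; exact: rho_tens_lift.
case: hrhoU hrhoW => repU [actU _] [repW [actW _]].
have genU := SW_object_generated m n hU; have genW := SW_object_generated m n hW.
split; first exact: (rho_Delta_representation hq hR).
exact: (rho_Delta_morphism hq hR).
Qed.
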